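(* There exist absolute constants $c_0,c_1>0$ and a randomized local reconstruction algorithm that takes as input parameters $n\ge1$, $d>10$, $k\ge1$, $\phi\in(0,1)$, $\varepsilon\in[c_0\frac{\phi}{n},1]$, has query access to the adjacency list of an $n$-vertex graph $G=(V,E)$ that is an $\varepsilon$-perturbation of a $(k,\phi,\frac{c_1\varepsilon\phi}{k^3\log n})$-clusterable graph, and provides query access to a graph $G'=(V,E')$ such that, with probability at least $1-\frac4n$: 1. $G'$ is $(k,\Omega(\frac{\varepsilon\phi}{k^4\log n}),1)$-clusterable (with conductances computed with respect to degree bound $d$), and has maximum degree at most $d+16$; 2. the number of edges in which $G$ and $G'$ differ is at most $O(\min\{1,k\sqrt{\varepsilon/\phi}\}\cdot n)$; 3. $G'$ is determined by $G$ and the internal randomness of the algorithm, and is independent of the order of queries; 4. on each query $v$, the neighborhood of $v$ in $G'$ is returned in $O(\sqrt{n}\cdot\mathrm{poly}(\frac{k\log n}{\phi\varepsilon}))$ time.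
   Context: A graph is $d$-bounded if its maximum degree is at most $d$. Query access to the adjacency list means in constant time one can query the $i$-th neighbor of any vertex. For $S,T\subseteq V$, $E(S,T)$ is the set of edges between $S$ and $T$. For $S\subseteq V$, $\phi_G(S)=\frac{|E(S,V\setminus S)|}{d|S|}$; $\phi(G)=\min_{S:|S|\le n/2}\phi_G(S)$ (single-vertex graph: $\phi=1$); $\phi(G[S])$ is the conductance of the induced subgraph. A set $S$ is a $(\phi_{in},\phi_{out})$-cluster if $\phi_G(S)\le\phi_{out}$ and $\phi(G[S])\ge\phi_{in}$. $G$ is $(k,\phi_{in},\phi_{out})$-clusterable if $V$ can be partitioned into $h\le k$ sets each of which is a $(\phi_{in},\phi_{out})$-cluster. $G$ is an $\varepsilon$-perturbation of a $(k,\phi_{in},\phi_{out})$-clusterable $d$-bounded graph $G^*$ if $G$ arises from $G^*$ by choosing such a partition $P_1,\dots,P_h$ of $G^*$ and inserting/deleting at most $\varepsilon dn$ edges with both endpoints in a common $P_i$, preserving degree bound $d$. A local reconstruction algorithm (local filter) fixes its random seed once and then, on any query vertex $v$, deterministically outputs the neighborhood of $v$ in $G'$. $d,k$ are treated as constants. *)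

(* Defs.v *)
From mathcomp Require Import all_boot all_order all_algebra.
From mathcomp Require Import boolp classical_sets reals exp.
(* Last, so that setX, set0, ... are those of finset, not of classical_sets. *)
From mathcomp Require Import finset.

Set Implicit Arguments.
Unset Strict Implicit.
Unset Printing Implicit Defensive.

Import Order.TTheory GRing.Theory Num.Theory.

Local Open Scope ring_scope.

Record sgraph (V : finType) := SGraph {
  adj :> rel V;
  adj_sym : symmetric adj;
  adj_irrefl : irreflexive adj }.

Section Graphs.
Variable V : finType.
Implicit Types (G : sgraph V) (S T : {set V}).

Definition nbhd G (x : V) : {set V} := [set y | G x y].

Definition max_degree G : nat := \max_(x : V) #|nbhd G x|.

Definition edges_between G S T : {set {set V}} :=
  [set [set p.1; p.2] | p in setX S T & G p.1 p.2].

Definition edges G : {set {set V}} := edges_between G setT setT.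

Definition edge_diff G1 G2 : {set {set V}} :=
  (edges G1 :\: edges G2) :|: (edges G2 :\: edges G1).

Definition induced G S : sgraph {x : V | x \in S} :=
  @SGraph {x : V | x \in S} (fun x y => G (val x) (val y))
    (fun x y => adj_sym G (val x) (val y)) (fun x => adj_irrefl G (val x)).

End Graphs.

Section Conductance.
Variables (R : realType) (d : nat).

Definition set_conductance (V : finType) (G : sgraph V) (S : {set V}) : R :=
  #|edges_between G S (~: S)|%:R / (d * #|S|)%:R.

(* For #|V| >= 2 the set below is finite and nonempty, so its inf is its
   minimum.  A conductance may exceed 1 when degrees exceed d, so 1 could not
   serve as the default value of an iterated minimum. *)
Definition graph_conductance (V : finType) (G : sgraph V) : R :=
  if (#|V| <= 1)%N then 1 else
  inf [set set_conductance G S | S in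
        [set S : {set V} | S != set0 /\ (2 * #|S| <= #|V|)%N]]%classic.

Variables (V : finType) (G : sgraph V).

Definition is_cluster (phi_in phi_out : R) (S : {set V}) : Prop :=
  set_conductance G S <= phi_out /\ phi_in <= graph_conductance (induced G S).

Definition cluster_partition (k : nat) (phi_in phi_out : R)
    (P : {set {set V}}) : Prop :=
  [/\ partition P [set: V], (#|P| <= k)%N &
      forall S, S \in P -> is_cluster phi_in phi_out S].

Definition clusterable (k : nat) (phi_in phi_out : R) : Prop :=
  exists P, cluster_partition k phi_in phi_out P.

End Conductance.

(* G is an eps-perturbation of some d-bounded (k, phi_in, phi_out)-clusterable
   graph G0. *)
Definition perturbed_clusterable (R : realType) (d : nat) (V : finType)
    (G : sgraph V) (k : nat) (phi_in phi_out eps : R) : Prop :=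
  exists (G0 : sgraph V) (P : {set {set V}}),
    [/\ (max_degree G0 <= d)%N,
        cluster_partition d G0 k phi_in phi_out P,
        (max_degree G <= d)%N,
        (forall f, f \in edge_diff G0 G -> exists2 S, S \in P & f \subset S) &
        #|edge_diff G0 G|%:R <= eps * d%:R * #|V|%:R].

Definition adjacency_list (V : finType) (G : sgraph V) (A : V -> seq V) : Prop :=
  forall x, uniq (A x) /\ A x =i nbhd G x.

(* Machine model: structured programs over a random-access memory of natural
   numbers, with the logarithmic cost criterion: producing a value v costs the
   number of bits of v.  Since v < 2 ^ (time spent), this agrees with the
   word RAM up to factors logarithmic in the numbers handled.  A program
   reads the graph, the random seed and the real parameters only through
   oracles:
   - the i-th neighbour of x;
   - the i-th bit of the seed;
   - comparison of a real parameter with a rational p / q. *)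
Record oracles := Oracles {
  o_nbr : nat -> nat -> nat;
  o_seed : nat -> bool;
  o_phi : nat -> nat -> bool;
  o_eps : nat -> nat -> bool }.

Inductive expr :=
| Const of nat
| Mem of expr
| Add of expr & expr
| Sub of expr & expr
| Mul of expr & expr
| Div of expr & expr
| Leq of expr & expr
| Nbr of expr & expr
| Seed of expr
| LePhi of expr & expr
| LeEps of expr & expr.

Inductive cmd :=
| Skip
| Store of expr & expr
| Emit of expr
| Seq of cmd & cmd
| If of expr & cmd & cmd
| While of expr & cmd.

Record state := State { mem : nat -> nat; out : seq nat }.

Definition bits (v : nat) : nat := (trunc_log 2 v).+1.

Section Semantics.
Variable O : oracles.

Fixpoint eval (m : nat -> nat) (e : expr) : nat :=
  match e with
  | Const c => c
  | Mem a => m (eval m a)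
  | Add a b => (eval m a + eval m b)%N
  | Sub a b => (eval m a - eval m b)%N
  | Mul a b => (eval m a * eval m b)%N
  | Div a b => (eval m a %/ eval m b)%N
  | Leq a b => (eval m a <= eval m b)%N
  | Nbr a b => o_nbr O (eval m a) (eval m b)
  | Seed a => o_seed O (eval m a)
  | LePhi a b => o_phi O (eval m a) (eval m b)
  | LeEps a b => o_eps O (eval m a) (eval m b)
  end.

Fixpoint cost (m : nat -> nat) (e : expr) : nat :=
  (bits (eval m e) +
   match e with
   | Const _ => 0
   | Mem a | Seed a => cost m a
   | Add a b | Sub a b | Mul a b | Div a b | Leq a b
   | Nbr a b | LePhi a b | LeEps a b => cost m a + cost m b
   end)%N.

(* exec c s t s' : started in state s, the command c halts in state s' after
   time t. *)
Inductive exec : cmd -> state -> nat -> state -> Prop :=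
| ExecSkip s : exec Skip s 1 s
| ExecStore s a e :
    exec (Store a e) s (cost (mem s) a + cost (mem s) e).+1
      (State (fun i => if i == eval (mem s) a then eval (mem s) e else mem s i)
             (out s))
| ExecEmit s e :
    exec (Emit e) s (cost (mem s) e).+1
      (State (mem s) (rcons (out s) (eval (mem s) e)))
| ExecSeq c1 c2 s t1 s1 t2 s2 :
    exec c1 s t1 s1 -> exec c2 s1 t2 s2 -> exec (Seq c1 c2) s (t1 + t2)%N s2
| ExecIf e c1 c2 s t s1 :
    exec (if eval (mem s) e != 0%N then c1 else c2) s t s1 ->
    exec (If e c1 c2) s (cost (mem s) e + t).+1 s1
| ExecWhileDone e c s :
    eval (mem s) e = 0%N -> exec (While e c) s (cost (mem s) e).+1 s
| ExecWhileStep e c s t1 s1 t2 s2 :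
    eval (mem s) e != 0%N -> exec c s t1 s1 -> exec (While e c) s1 t2 s2 ->
    exec (While e c) s (cost (mem s) e + t1 + t2).+1 s2.

Lemma exec_det c s t1 s1 t2 s2 :
  exec c s t1 s1 -> exec c s t2 s2 -> t1 = t2 /\ s1 = s2.
Proof.
move=> H; elim: H t2 s2 => {c s t1 s1}.
- by move=> s t2 s2 H; inversion H.
- by move=> s a e t2 s2 H; inversion H.
- by move=> s e t2 s2 H; inversion H.
- move=> c1 c2 s t1 s1 t2 s2 _ IH1 _ IH2 t3 s3 H.
  inversion H as [| | |? ? ? u1 r1 u2 r2 H1 H2| | |]; subst.
  have [? ?] := IH1 _ _ H1; subst.
  by have [-> ->] := IH2 _ _ H2.
- move=> e c1 c2 s t s1 _ IH t3 s3 H.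
  inversion H as [| | | |? ? ? ? ? ? H1| |]; subst.
  by have [-> ->] := IH _ _ H1.
- move=> e c s e0 t3 s3 H; inversion H as [| | | | | |? ? ? ? ? ? ? n0]; subst => //.
  by rewrite e0 in n0.
- move=> e c s t1 s1 t2 s2 n0 _ IH1 _ IH2 t3 s3 H.
  inversion H as [| | | | |? ? ? e0|? ? ? ? ? ? ? _ H1 H2]; subst.
    by rewrite e0 in n0.
  have [? ?] := IH1 _ _ H1; subst.
  by have [-> ->] := IH2 _ _ H2.
Qed.

(* Started with input xs in cells 0, 1, ... and all other cells 0, the program
   halts after time t having emitted the sequence l. *)
Definition halts_with (p : cmd) (xs : seq nat) (t : nat) (l : seq nat) : Prop :=
  exists2 s, exec p (State (nth 0%N xs) [::]) t s & out s = l.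

End Semantics.

Section LocalFilter.
Variables (R : realType) (n d k : nat) (phi eps : R).

(* A neighbour y is reported as y + 1, and 0 means that there is no i-th
   neighbour.  Seed bits beyond the length of the seed read as 0. *)
Definition filter_oracles (A : 'I_n -> seq 'I_n) (r : seq bool) : oracles :=
  Oracles
    (fun x i => if insub x is Some v then nth 0%N [seq (val y).+1 | y <- A v] i
                else 0%N)
    (nth false r)
    (fun p q => p%:R <= q%:R * phi)
    (fun p q => p%:R <= q%:R * eps).

(* With graph A and seed r, the query v is answered after time t by the list of
   the neighbours of v in H.  Every query is run from a fresh memory, so that
   an answer depends only on A, r and v and not on the other queries. *)
Definition answers (p : cmd) (A : 'I_n -> seq 'I_n) (r : seq bool)
    (H : sgraph 'I_n) (v : 'I_n) (t : nat) : Prop :=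
  exists2 l, halts_with (filter_oracles A r) p [:: n; d; k; val v] t l &
    perm_eq l [seq val y | y <- enum (nbhd H v)].

End LocalFilter.

Definition seed_prob (R : realType) (L : nat) (Q : L.-tuple bool -> Prop) : R :=
  #|[set r : L.-tuple bool | `[< Q r >]]|%:R / (2 ^ L)%:R.

(* Main.v *)
(* The conductance asked for is so small that all of V can serve as the only
   cluster of G', once every sparse cut of G has been destroyed. Two kinds of
   edges are added.

   Links: each vertex x in a component of G with fewer than M ~ log n / sqrt eps
   vertices is joined to x + 1 mod n, so that no set of fewer than M vertices is
   closed. The clusters of G0 have conductance at least phi, so all but
   O(eps n / phi) vertices lie in a component containing more than half of their
   cluster, and at most O(eps n / phi + k M) links are added.

   Chords: the vertices are laid out on a square grid, and in every row and column
   each block of K ~ 1 / sqrt eps positions is given a random chord to a random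
   position of its line, which costs O(sqrt eps n) edges. By the isoperimetry of
   the grid, a set S of s <= n / 2 vertices is crossed by only O(s / M) chords with
   probability at most exp (- Omega (s / K)). On the other hand, a set with fewer
   than s / M boundary edges among the edges of G and the links is determined by
   its boundary and by one vertex in each of at most s / M closed parts, so there
   are only n ^ O(s / M) of them, and a union bound applies.

   A query explores at most M vertices around v and v - 1, and reads the random
   words of the at most four lines through v. *)

(* The grid reconciles random chords with locality. A query at v must also find the chords whose
   target is v, so every block that could aim at v has to be inspected. Confining targets to a line
   leaves O(sqrt n) words to read, and rows and columns together still expand enough. Dropping
   repeated targets makes the chords dependent: a proposal counts only if no earlier block of its
   line has the same target. Hence the words are exposed block by block. When a block is reached, at
   most m / K targets of its line are taken, and K >= 16 limits this loss to half of the crossings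
   given by isoperimetry. Each block thus keeps a conditional lower bound, and a Chernoff-type
   estimate works without independence. The union bound ranges over a family that depends on G and
   the links alone, not on the chords. The constant 1024 in M makes the exponent s / (32 K) beat the
   entropy of this family. When n * eps is below lg, M would be too large compared with n for the
   edge budget. Connectedness then suffices, and n is small enough in terms of log n / eps for whole
   components to be explored. *)
Require Import Defs.
From mathcomp Require Import all_boot all_order all_algebra.
From mathcomp Require Import boolp classical_sets reals sequences exp.
From mathcomp Require Import finset.
From mathcomp Require Import zify ring lra.

Import Defs.
Import Order.TTheory GRing.Theory Num.Theory.

Set Implicit Arguments.
Unset Strict Implicit.
Unset Printing Implicit Defensive.

(** * Cost-bounded execution of programs *)

Lemma bits_gt0 x : 0 < bits x. Proof. by []. Qed.

Lemma bits_le x k : 0 < k -> x < 2 ^ k -> bits x <= k.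
Proof.
move=> k0 hx; rewrite /bits; case: x hx => [|x] hx; first by rewrite trunc_log0.
rewrite -(ltn_exp2l _ _ (isT : 1 < 2)).
exact: leq_ltn_trans (trunc_logP (isT : 1 < 2) (isT : 0 < x.+1)) hx.
Qed.

Lemma lt_bits x : x < 2 ^ bits x.
Proof. exact: trunc_log_ltn. Qed.

Lemma bits_mono x y : x <= y -> bits x <= bits y.
Proof. by move=> h; rewrite /bits ltnS leq_trunc_log. Qed.

Lemma bitsM x y : bits (x * y) <= bits x + bits y.
Proof.
apply: bits_le; first by rewrite addn_gt0 bits_gt0.
rewrite expnD; case: x => [|x]; first by rewrite mul0n muln_gt0 !expn_gt0.
apply: leq_ltn_trans (_ : _ <= 2 ^ bits x.+1 * y) _.
  by rewrite leq_mul2r ltnW ?orbT ?lt_bits.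
by rewrite ltn_pmul2l ?expn_gt0 ?lt_bits.
Qed.

Lemma bitsD x y : bits (x + y) <= bits x + bits y.
Proof.
case: (posnP x) => [->|x0]; first by rewrite add0n leq_addl.
case: (posnP y) => [->|y0]; first by rewrite addn0 leq_addr.
apply: bits_le; first by rewrite addn_gt0 bits_gt0.
rewrite expnD; have := lt_bits x; have := lt_bits y.
move: (2 ^ bits x) (2 ^ bits y) => A B; nia.
Qed.

Lemma bits_bool (c : bool) : bits c = 1.
Proof. by case: c; vm_compute. Qed.

Section Hoare.
Variable O : oracles.
Variable b : nat.
Hypothesis b_gt0 : 0 < b.
Hypothesis nbr_bits : forall x i, bits (o_nbr O x i) <= b.

Definition bounded (g : nat -> nat) := forall i, g i < 2 ^ b.

Definition upd (g : nat -> nat) (a x : nat) : nat -> nat :=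
  fun i => if i == a then x else g i.

Lemma bounded_upd g a x : bounded g -> x < 2 ^ b -> bounded (upd g a x).
Proof. by move=> hg hx i; rewrite /upd; case: ifP. Qed.

(** Length of a value in units of [b] bits, for memory cells below [2 ^ b]. Lengths add under sums
    and products, while truncated subtraction and division never exceed their first argument. *)
Fixpoint edeg (e : expr) : nat :=
  match e with
  | Const c => bits c
  | Mem _ | Nbr _ _ => 1
  | Add a c | Mul a c => edeg a + edeg c
  | Sub a _ | Div a _ => edeg a
  | Leq _ _ | Seed _ | LePhi _ _ | LeEps _ _ => 1
  end.

Fixpoint ecost (e : expr) : nat :=
  edeg e +
  match e with
  | Const _ => 0
  | Mem a | Seed a => ecost a
  | Add a c | Sub a c | Mul a c | Div a c | Leq a c
  | Nbr a c | LePhi a c | LeEps a c => ecost a + ecost c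
  end.

Lemma bits_eval g e : bounded g -> bits (eval O g e) <= edeg e * b.
Proof.
move=> hg; elim: e => /=.
- by move=> c; rewrite leq_pmulr.
- by move=> e _; rewrite mul1n bits_le.
- by move=> e1 h1 e2 h2; rewrite mulnDl (leq_trans (bitsD _ _)) ?leq_add.
- by move=> e1 h1 e2 h2; rewrite (leq_trans _ h1) ?bits_mono ?leq_subr.
- by move=> e1 h1 e2 h2; rewrite mulnDl (leq_trans (bitsM _ _)) ?leq_add.
- by move=> e1 h1 e2 h2; rewrite (leq_trans _ h1) ?bits_mono ?leq_div.
- by move=> *; rewrite bits_bool mul1n.
- by move=> *; rewrite mul1n.
- by move=> *; rewrite bits_bool mul1n.
- by move=> *; rewrite bits_bool mul1n.
- by move=> *; rewrite bits_bool mul1n.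
Qed.

Lemma cost_eval g e : bounded g -> cost O g e <= ecost e * b.
Proof.
move=> hg; have hb := fun e => bits_eval e hg.
elim: e => [c|e1 h1|e1 h1 e2 h2|e1 h1 e2 h2|e1 h1 e2 h2|e1 h1 e2 h2|e1 h1 e2 h2
  |e1 h1 e2 h2|e1 h1|e1 h1 e2 h2|e1 h1 e2 h2];
  rewrite [cost _ _ _]/= [ecost _]/= mulnDl ?mulnDl.
- by move: (hb (Const c)); rewrite /= addn0 mul0n addn0.
- by move: (hb (Mem e1)) => /=; lia.
- by move: (hb (Add e1 e2)) => /=; lia.
- by move: (hb (Sub e1 e2)) => /=; lia.
- by move: (hb (Mul e1 e2)) => /=; lia.
- by move: (hb (Div e1 e2)) => /=; lia.
- by move: (hb (Leq e1 e2)) => /=; lia.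
- by move: (hb (Nbr e1 e2)) => /=; lia.
- by move: (hb (Seed e1)) => /=; lia.
- by move: (hb (LePhi e1 e2)) => /=; lia.
- by move: (hb (LeEps e1 e2)) => /=; lia.
Qed.

Variable U : nat.

(** A total-correctness triple with a price of [U * b] per step. As [U] is strictly above the
    [ecost] of the expressions involved, the slack pays for the extra unit that each command
    costs. *)
Definition runs (c : cmd) (s : state) (N : nat) (Q : state -> Prop) : Prop :=
  exists t s', [/\ exec O c s t s', t <= N * (U * b) & Q s'].

Lemma runs_le c s N N' (Q Q' : state -> Prop) :
  runs c s N Q -> N <= N' -> (forall s', Q s' -> Q' s') -> runs c s N' Q'.
Proof.
move=> [t [s' [h1 h2 h3]]] hN hQ; exists t, s'; split => //; last exact: hQ.
by rewrite (leq_trans h2) // leq_mul2r hN orbT.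
Qed.

Lemma runs_leN c s N N' (Q : state -> Prop) : runs c s N Q -> N <= N' -> runs c s N' Q.
Proof. by move=> h hN; apply: runs_le h hN _. Qed.

Lemma one_unit x : x < U -> (x * b).+1 <= U * b.
Proof. by move=> h; rewrite (@leq_trans (x.+1 * b)) ?leq_mul2r ?h ?orbT // mulSn; lia. Qed.

Lemma runs_store a e g o (Q : state -> Prop) :
  ecost a + ecost e < U -> bounded g ->
  Q (State (upd g (eval O g a) (eval O g e)) o) ->
  runs (Store a e) (State g o) 1 Q.
Proof.
move=> hU hg hQ; exists (cost O g a + cost O g e).+1, (State (upd g (eval O g a) (eval O g e)) o).
split => //; first exact: ExecStore.
rewrite mul1n; apply: leq_trans (one_unit hU).
by rewrite ltnS mulnDl leq_add ?cost_eval.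
Qed.

Lemma runs_emit e g o (Q : state -> Prop) :
  ecost e < U -> bounded g -> Q (State g (rcons o (eval O g e))) ->
  runs (Emit e) (State g o) 1 Q.
Proof.
move=> hU hg hQ; exists (cost O g e).+1, (State g (rcons o (eval O g e))).
split => //; first exact: ExecEmit.
by rewrite mul1n; apply: leq_trans (one_unit hU); rewrite ltnS cost_eval.
Qed.

Lemma runs_skip s (Q : state -> Prop) : 0 < U -> Q s -> runs Skip s 1 Q.
Proof.
move=> hU hQ; exists 1, s; split => //; first exact: ExecSkip.
by rewrite mul1n muln_gt0 hU.
Qed.

Lemma runs_seq c1 c2 s N1 N2 (Q1 Q : state -> Prop) :
  runs c1 s N1 Q1 -> (forall s1, Q1 s1 -> runs c2 s1 N2 Q) ->
  runs (Seq c1 c2) s (N1 + N2) Q.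
Proof.
move=> [t1 [s1 [h1 l1 q1]]] /(_ _ q1) [t2 [s2 [h2 l2 q2]]].
exists (t1 + t2), s2; split => //; first exact: ExecSeq h1 h2.
by rewrite mulnDl leq_add.
Qed.

Lemma runs_if e c1 c2 g o N (Q : state -> Prop) :
  ecost e < U -> bounded g ->
  (eval O g e != 0 -> runs c1 (State g o) N Q) ->
  (eval O g e = 0 -> runs c2 (State g o) N Q) ->
  runs (If e c1 c2) (State g o) N.+1 Q.
Proof.
move=> hU hg H1 H2.
have [t [s' [h l q]]] : runs (if eval O g e != 0 then c1 else c2) (State g o) N Q.
  by case: ifP => [/H1|/negbFE/eqP/H2].
exists (cost O g e + t).+1, s'; split => //; first exact: ExecIf.
rewrite mulSn -addSn leq_add //; apply: leq_trans (one_unit hU).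
by rewrite ltnS cost_eval.
Qed.

(** The index of the invariant is a variant: it drops strictly in every round, which gives
    termination and the number of rounds at once. The last unit pays for the failing test. *)
Lemma runs_while e c (I : nat -> state -> Prop) N k g o :
  ecost e < U -> I k (State g o) ->
  (forall k g o, I k (State g o) -> bounded g) ->
  (forall k g o, I k (State g o) -> eval O g e != 0 ->
     runs c (State g o) N (fun s => exists2 k', k' < k & I k' s)) ->
  runs (While e c) (State g o) (k * N.+1).+1
    (fun s => (exists2 k', k' <= k & I k' s) /\ eval O (mem s) e = 0).
Proof.
move=> hU hI hb hc; elim/ltn_ind: k g o hI => k IH g o hI.
have hcost : (cost O g e).+1 <= U * b.
  by apply: leq_trans (one_unit hU); rewrite ltnS cost_eval //; exact: hb hI.
case: (eqVneq (eval O g e) 0) => [e0|en0].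
  exists (cost O g e).+1, (State g o); split.
  - by apply: ExecWhileDone.
  - by rewrite (leq_trans hcost) // mulSn leq_addr.
  - by split => //; exists k.
have [t1 [[g1 o1] [h1 l1 [k' hk' hI']]]] := hc _ _ _ hI en0.
have [t2 [s2 [h2 l2 [[k2 hk2 hI2] e0]]]] := IH k' hk' _ _ hI'.
exists (cost O g e + t1 + t2).+1, s2; split.
- exact: (ExecWhileStep _ h1 h2).
- have -> : (cost O g e + t1 + t2).+1 = (cost O g e).+1 + t1 + t2 by lia.
  have hh : (k * N.+1).+1 = 1 + N + (k' * N.+1).+1 + ((k - k'.+1) * N.+1) by nia.
  rewrite hh !mulnDl; lia.
- by split => //; exists k2 => //; exact: leq_trans hk2 (ltnW hk').
Qed.

Lemma runs_set a e g o (Q : state -> Prop) :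
  ecost a + ecost e < U -> bounded g -> eval O g e < 2 ^ b ->
  (bounded (upd g (eval O g a) (eval O g e)) ->
     Q (State (upd g (eval O g a) (eval O g e)) o)) ->
  runs (Store a e) (State g o) 1 Q.
Proof. by move=> hU hg he hQ; apply: runs_store => //; apply/hQ/bounded_upd. Qed.

Lemma runs_set_seq a e c g o N (Q : state -> Prop) :
  ecost a + ecost e < U -> bounded g -> eval O g e < 2 ^ b ->
  (bounded (upd g (eval O g a) (eval O g e)) ->
     runs c (State (upd g (eval O g a) (eval O g e)) o) N Q) ->
  runs (Seq (Store a e) c) (State g o) N.+1 Q.
Proof.
move=> hU hg he hQ; rewrite -add1n.
apply: (runs_seq (Q1 := eq (State (upd g (eval O g a) (eval O g e)) o))).
  exact: runs_store.
by move=> s1 <-; apply/hQ/bounded_upd.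
Qed.

End Hoare.

(** * Random chords in the lines of a grid *)

Section Lines.
Variables (n K m NB : nat) (u : nat -> nat).

(* The m * m grid has n <= m * m <= 2 * n cells, numbered in row-major order, and
   cell c carries vertex c mod n. Line l < m is row l, line m + l is column l.
   Block be consists of positions be * K, ..., be * K + K - 1 of its line, and
   proposes the chord from position sel to position tgt, read off one random
   word. Repeated targets in a line are dropped, which keeps degrees bounded. *)
Definition cell (l q : nat) := if l < m then l * m + q else q * m + (l - m).
Definition sel (l be : nat) := be * K + u (l * NB + be) %% K.
Definition tgt (l be : nat) := u (l * NB + be) %/ K.
Definition fresh l be := all (fun be' => tgt l be' != tgt l be) (iota 0 be).
Definition accepted l be := [&& fresh l be, sel l be < m & tgt l be < m].

(** Directed from the selected end to the target. Loops can occur, for instance when two cells carry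
    the same vertex; [filter_adj] discards them. *)
Definition hedge (x y : nat) :=
  has (fun l => has (fun be => [&& accepted l be, x == cell l (sel l be) %% n
                                  & y == cell l (tgt l be) %% n])
                    (iota 0 NB)) (iota 0 (2 * m)).

Definition block_cands l p be :=
  if accepted l be then
    (if sel l be == p then [:: cell l (tgt l be) %% n] else [::]) ++
    (if tgt l be == p then [:: cell l (sel l be) %% n] else [::])
  else [::].

Definition line_cands l p := flatten [seq block_cands l p be | be <- iota 0 NB].

(* A vertex lies in at most two cells, hence on at most four lines, indexed by j. *)
Definition run_cell v j := v + j %/ 2 * n.
Definition run_line c j := if odd j then m + c %% m else c %/ m.
Definition run_pos c j := if odd j then c %/ m else c %% m.

Definition run_cands v j :=
  let c := run_cell v j in
  if c < m * m then line_cands (run_line c j) (run_pos c j) else [::].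

Definition hcands v := flatten [seq run_cands v j | j <- iota 0 4].

Lemma hedgeP x y :
  reflect (exists l be, [/\ l < 2 * m, be < NB, accepted l be,
             x = cell l (sel l be) %% n & y = cell l (tgt l be) %% n])
          (hedge x y).
Proof.
apply: (iffP hasP) => [[l]|[l [be [hl hbe ha hx hy]]]].
  rewrite mem_iota => hl /hasP[be]; rewrite mem_iota => hbe /and3P[ha /eqP hx /eqP hy].
  by exists l, be.
exists l; first by rewrite mem_iota.
by apply/hasP; exists be; rewrite ?mem_iota // ha hx hy !eqxx.
Qed.

Hypothesis m_gt0 : 0 < m.
Hypothesis n_gt0 : 0 < n.
Hypothesis m2n : m * m <= 2 * n.

Lemma cell_lt l q : l < 2 * m -> q < m -> cell l q < m * m.
Proof. by rewrite /cell; case: ifP => hl hl2 hq; nia. Qed.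

Lemma run_cellP c j : c < m * m ->
  [/\ run_line c j < 2 * m, run_pos c j < m, cell (run_line c j) (run_pos c j) = c
    & (run_line c j < m) = ~~ odd j].
Proof.
move=> hc; rewrite /run_line /run_pos /cell.
have h1 : c %% m < m by rewrite ltn_mod.
have h2 : c %/ m < m by rewrite ltn_divLR.
have h3 := divn_eq c m.
by case: (odd j) => /=; case: ifP => h4; split => //; lia.
Qed.

Lemma run_cell_uniq l q j : l < 2 * m -> q < m -> (l < m) = ~~ odd j ->
  run_line (cell l q) j = l /\ run_pos (cell l q) j = q.
Proof.
move=> hl hq hj; rewrite /run_line /run_pos /cell hj.
case: (odd j) hj => /= hj.
  have hlm : l - m < m by lia.
  by rewrite modnMDl modn_small // divnMDl // divn_small //; lia.
by rewrite modnMDl modn_small // divnMDl // divn_small //; lia.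
Qed.

Lemma line_candsP l p y :
  reflect (exists2 be, be < NB & accepted l be /\
     ((sel l be = p /\ y = cell l (tgt l be) %% n) \/
      (tgt l be = p /\ y = cell l (sel l be) %% n)))
  (y \in line_cands l p).
Proof.
apply: (iffP flatten_mapP) => [[be]|[be hbe [ha h]]].
  rewrite mem_iota => hbe; rewrite /block_cands; case: ifP => // ha.
  rewrite mem_cat => /orP[]; case: eqP => // e; rewrite inE => /eqP ->;
    exists be => //; split => //; by [left|right].
exists be; first by rewrite mem_iota.
rewrite /block_cands ha mem_cat.
by case: h => -[<- ->]; rewrite eqxx inE eqxx ?orbT.
Qed.

(** Since [m * m <= 2 * n], only the cells v and v + n can carry v. So [j %/ 2] chooses the cell,
    the parity of [j] chooses row or column, and four runs see every chord at v from either end. *)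
Lemma hcandsP v y : v < n ->
  (y \in hcands v) = (hedge v y || hedge y v).
Proof.
move=> hv; apply/idP/idP.
  case/flatten_mapP => j; rewrite mem_iota /= add0n => hj.
  rewrite /run_cands; case: ifP => // hc /line_candsP[be hbe [ha h]].
  have [h1 h2 h3 h4] := run_cellP j hc.
  have hcv : run_cell v j %% n = v by rewrite /run_cell addnC modnMDl modn_small.
  case: h => -[hp ->]; apply/orP; [left|right]; apply/hedgeP;
    exists (run_line (run_cell v j) j), be; split; rewrite // hp h3 hcv //.
case/orP => /hedgeP[l [be [hl hbe ha hx hy]]]; apply/flatten_mapP;
  case/and3P: (ha) => _ hs ht.
  have hc := cell_lt hl hs.
  have hj : exists2 j, j < 4 & run_cell v j = cell l (sel l be) /\ (l < m) = ~~ odd j.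
    have hd := divn_eq (cell l (sel l be)) n.
    have hq : cell l (sel l be) %/ n < 2 by rewrite ltn_divLR //; lia.
    exists (2 * (cell l (sel l be) %/ n) + ~~ (l < m)); first by case: (l < m) => /=; lia.
    rewrite /run_cell; split; last by case: (l < m) => /=; lia.
    have -> : (2 * (cell l (sel l be) %/ n) + ~~ (l < m)) %/ 2 = cell l (sel l be) %/ n.
      by case: (l < m) => /=; lia.
    by rewrite {2}hd -hx addnC.
  case: hj => j hj [hc2 hodd]; exists j; first by rewrite mem_iota.
  have [e1 e2] := run_cell_uniq hl hs hodd.
  rewrite /run_cands hc2 hc e1 e2; apply/line_candsP; exists be => //; split => //; by left.
have hc := cell_lt hl ht.
have hj : exists2 j, j < 4 & run_cell v j = cell l (tgt l be) /\ (l < m) = ~~ odd j.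
  have hd := divn_eq (cell l (tgt l be)) n.
  have hq : cell l (tgt l be) %/ n < 2 by rewrite ltn_divLR //; lia.
  exists (2 * (cell l (tgt l be) %/ n) + ~~ (l < m)); first by case: (l < m) => /=; lia.
  rewrite /run_cell; split; last by case: (l < m) => /=; lia.
  have -> : (2 * (cell l (tgt l be) %/ n) + ~~ (l < m)) %/ 2 = cell l (tgt l be) %/ n.
    by case: (l < m) => /=; lia.
  by rewrite {2}hd -hy addnC.
case: hj => j hj [hc2 hodd]; exists j; first by rewrite mem_iota.
have [e1 e2] := run_cell_uniq hl ht hodd.
rewrite /run_cands hc2 hc e1 e2; apply/line_candsP; exists be => //; split => //; by right.
Qed.

End Lines.

(** * The filter program *)

Section FilterProgram.
Local Notation rd i := (Mem (Const i)).
Local Notation set i e := (Store (Const i) e).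
Local Notation one := (Const 1).
Local Notation "c ;; d" := (Seq c d) (at level 60, right associativity).
Local Notation slot a e := (Add (Const a) (Mul (Const 3) e)).

Definition lt_e a c := Leq (Add a one) c.
Definition eq_e a c := Mul (Leq a c) (Leq c a).
Definition mod_e a c := Sub a (Mul (Div a c) c).
Definition incr i := set i (Add (rd i) one).
Definition push e := Store (slot 32 (rd 12)) e ;; incr 12.

(* Cells 0 to 11 hold n, d, k, v, K, m, W, lg, w, NB, M and the flag all_links;
   cells 12 to 30 hold counters and local variables. Three arrays are interleaved
   from cell 32 on: candidate neighbours at 32 + 3 i, the queue of the
   breadth-first search at 33 + 3 i, and marks at 34 + 3 y. Vertex y is marked
   when its mark equals cell 13, so incrementing cell 13 unmarks all vertices. *)
Definition p_setup : cmd :=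
  set 4 (Const 16) ;;
  (* Doubles K until 256 <= K^2 * eps; [Leq _ 0] negates the answer of the oracle. *)
  While (Leq (LeEps (Const 256) (Mul (rd 4) (rd 4))) (Const 0))
    (set 4 (Add (rd 4) (rd 4))) ;;
  set 5 one ;;
  While (lt_e (Mul (rd 5) (rd 5)) (rd 0)) (incr 5) ;;
  set 6 one ;; set 7 one ;;
  While (lt_e (rd 6) (rd 5)) (set 6 (Add (rd 6) (rd 6)) ;; incr 7) ;;
  (* The word length w is the number of doublings that lead from 1 to K * W, a power of two. *)
  set 25 one ;;
  While (lt_e (rd 25) (Mul (rd 4) (rd 6))) (set 25 (Add (rd 25) (rd 25)) ;; incr 8) ;;
  set 9 (Add (Div (rd 5) (rd 4)) one) ;;
  If (LeEps (rd 7) (rd 0))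
    (set 10 (Mul (Const 1024) (Mul (rd 4) (rd 7))) ;; set 11 one)
    (set 10 (Add (rd 0) one)).

Definition p_cand_nbrs : cmd :=
  While (Nbr (rd 3) (rd 12)) (push (Sub (Nbr (rd 3) (rd 12)) one)).

Definition p_visit : cmd :=
  set 18 (Sub (Nbr (Mem (slot 33 (rd 16))) (rd 17)) one) ;;
  (* No mark exceeds the stamp in cell 13, so the truncated difference is nonzero exactly for
     unmarked vertices. *)
  If (Sub (rd 13) (Mem (slot 34 (rd 18))))
    (Store (slot 33 (rd 15)) (rd 18) ;;
     Store (slot 34 (rd 18)) (rd 13) ;;
     incr 15 ;;
     (* Cell 19 tells whether the start of the search is still the largest vertex found. *)
     If (lt_e (rd 14) (rd 18)) (set 19 (Const 0)) Skip)
    Skip ;;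
  incr 17.

Definition p_bfs : cmd :=
  incr 13 ;;
  Store (slot 33 (Const 0)) (rd 14) ;;
  Store (slot 34 (rd 14)) (rd 13) ;;
  set 15 one ;; set 16 (Const 0) ;; set 19 one ;;
  While (Mul (lt_e (rd 16) (rd 15)) (lt_e (rd 15) (rd 10)))
    (set 17 (Const 0) ;;
     While (Nbr (Mem (slot 33 (rd 16))) (rd 17)) p_visit ;;
     incr 16).

(** Product as conjunction and sum as disjunction: fewer than M vertices were found, and either
    [allf] holds or the start is the largest of them. *)
Definition e_link : expr := Mul (lt_e (rd 15) (rd 10)) (Add (rd 11) (rd 19)).

Definition p_link_next : cmd :=
  set 14 (rd 3) ;; p_bfs ;;
  If e_link (push (mod_e (Add (rd 3) one) (rd 0))) Skip.

Definition p_link_prev : cmd :=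
  set 14 (mod_e (Add (rd 3) (Sub (rd 0) one)) (rd 0)) ;; p_bfs ;;
  If e_link (push (rd 14)) Skip.

(** Cells 29 and 30 hold the first cell and the stride of the current line, so rows and columns
    share this code. *)
Definition p_push_cell q : cmd := push (mod_e (Add (rd 29) (Mul (rd 30) (rd q))) (rd 0)).

Definition p_read : cmd :=
  set 25 (Mul (Add (Mul (rd 21) (rd 9)) (rd 23)) (rd 8)) ;;
  set 24 (Const 0) ;; set 17 (Const 0) ;;
  While (lt_e (rd 17) (rd 8))
    (set 24 (Add (Mul (Const 2) (rd 24)) (Seed (Add (rd 25) (rd 17)))) ;; incr 17).

Definition p_block : cmd :=
  p_read ;;
  set 27 (Add (Mul (rd 23) (rd 4)) (mod_e (rd 24) (rd 4))) ;;
  set 28 (Div (rd 24) (rd 4)) ;;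
  (* Marks are indexed by targets here. A target is marked even if its proposal is then rejected for
     leaving the grid, because [fresh] compares with all earlier blocks. *)
  If (Sub (rd 13) (Mem (slot 34 (rd 28))))
    (Store (slot 34 (rd 28)) (rd 13) ;;
     If (Mul (lt_e (rd 27) (rd 5)) (lt_e (rd 28) (rd 5)))
       (If (eq_e (rd 27) (rd 22)) (p_push_cell 28) Skip ;;
        If (eq_e (rd 28) (rd 22)) (p_push_cell 27) Skip)
       Skip)
    Skip ;;
  incr 23.

Definition p_line : cmd :=
  set 23 (Const 0) ;; While (lt_e (rd 23) (rd 9)) p_block.

Definition p_run : cmd :=
  incr 13 ;;
  set 26 (Add (rd 3) (Mul (Div (rd 20) (Const 2)) (rd 0))) ;;
  If (lt_e (rd 26) (Mul (rd 5) (rd 5)))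
    (If (mod_e (rd 20) (Const 2))
       (set 29 (mod_e (rd 26) (rd 5)) ;; set 30 (rd 5) ;;
        set 21 (Add (rd 5) (rd 29)) ;; set 22 (Div (rd 26) (rd 5)))
       (set 21 (Div (rd 26) (rd 5)) ;; set 22 (mod_e (rd 26) (rd 5)) ;;
        set 29 (Mul (rd 21) (rd 5)) ;; set 30 one) ;;
     p_line)
    Skip ;;
  incr 20.

Definition p_runs : cmd := While (lt_e (rd 20) (Const 4)) p_run.

(** Marking v before the loop suppresses self-loops, and marking each emitted vertex suppresses
    repetitions among the candidates. *)
Definition p_emit : cmd :=
  incr 13 ;; Store (slot 34 (rd 3)) (rd 13) ;; set 17 (Const 0) ;;
  While (lt_e (rd 17) (rd 12))
    (set 18 (Mem (slot 32 (rd 17))) ;;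
     If (Sub (rd 13) (Mem (slot 34 (rd 18))))
       (Store (slot 34 (rd 18)) (rd 13) ;; Emit (rd 18)) Skip ;;
     incr 17).

Definition filter_program : cmd :=
  p_setup ;; p_cand_nbrs ;; p_link_next ;; p_link_prev ;; p_runs ;; p_emit.

(* Exceeds the cost, in words, of every expression of the program. *)
Definition time_unit : nat := 100.

Lemma upd_at g a x : upd g a x a = x. Proof. by rewrite /upd eqxx. Qed.
Lemma upd_ne g a x i : i != a -> upd g a x i = g i.
Proof. by rewrite /upd => /negbTE ->. Qed.

Ltac rdm := repeat (rewrite upd_at || (rewrite upd_ne; last by first [done | lia])).

(** * Correctness and cost of the program, for abstract oracles *)

Section Verify.
Variables (O : oracles) (b : nat) (n d k v K m W lg w NB M kap mu : nat) (allf : bool).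
Hypothesis b_gt0 : 0 < b.
Hypothesis nbr_bits : forall x i, bits (o_nbr O x i) <= b.
Hypothesis n_gt0 : 0 < n.
Hypothesis v_lt : v < n.
(** The scales are described by natural numbers and the oracle [o_eps] alone, which keeps the
    verification of the program free of reals. [fp_big] keeps the values stored in memory within [b]
    bits. *)
Record filter_params : Prop := FilterParams {
  fp_K : K = 16 * 2 ^ kap;
  fp_eps : forall i, i <= kap ->
    o_eps O 256 ((16 * 2 ^ i) * (16 * 2 ^ i)) = (kap <= i);
  fp_m0 : 0 < m;
  fp_mge : n <= m * m;
  fp_mmin : forall i, i < m -> i * i < n;
  fp_m2n : m * m <= 2 * n;
  fp_W : W = 2 ^ mu;
  fp_Wge : m <= W;
  fp_Wmin : forall i, i < mu -> 2 ^ i < m;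
  fp_lg : lg = mu.+1;
  fp_w : 2 ^ w = K * W;
  fp_NB : NB = m %/ K + 1;
  fp_all : allf = o_eps O lg n;
  fp_M : M = if allf then 1024 * (K * lg) else n + 1;
  fp_big : K * W + M + 2 * m * NB * w + K + 100 + d + k + 40 * n < 2 ^ b }.
Hypothesis P : filter_params.
Hypothesis big : 100 + d + k + 40 * n < 2 ^ b.

Local Notation runs := (runs O b time_unit).

Definition glob (g : nat -> nat) : Prop :=
  [/\ g 0 = n, g 3 = v, g 4 = K & g 5 = m] /\
  [/\ g 8 = w, g 9 = NB, g 10 = M, g 11 = allf & bounded b g].

(** Invariant between the phases: L is the list of candidates, st the stamp, j the next run. As no
    mark exceeds st, increasing the stamp clears all marks in one step. *)
Definition good (L : seq nat) (st j : nat) (s : state) : Prop :=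
  let: State g o := s in
  [/\ o = [::], glob g, [/\ g 12 = size L, g 13 = st & g 20 = j],
      forall i, i < size L -> g (32 + 3 * i) = nth 0 L i &
      forall y, g (34 + 3 * y) <= st].

Variable nb : nat -> seq nat.
Hypothesis nbrE : forall x i, x < n -> o_nbr O x i = nth 0 [seq y.+1 | y <- nb x] i.
Hypothesis nb_lt : forall x y, y \in nb x -> y < n.
Hypothesis nb_size : forall x, x < n -> size (nb x) <= d.

(* l is the list of vertices found by a breadth-first search from x that gives up
   as soon as it has found M of them. *)
Variable linked : nat -> bool.
Hypothesis linkedE : forall x (l : seq nat), x < n -> uniq l -> x \in l ->
  {in l, forall y, y < n} ->
  (forall S : pred nat, S x -> (forall y z, S y -> z \in nb y -> S z) -> {in l, forall y, S y}) ->
  (size l < M -> {in l, forall y, {subset nb y <= l}}) ->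
  linked x = (size l < M) && (allf || all (fun y => y <= x) l).

Let w_set_seq := @runs_set_seq O b b_gt0 nbr_bits time_unit.
Let w_set := @runs_set O b b_gt0 nbr_bits time_unit.
Let w_while := @runs_while O b b_gt0 nbr_bits time_unit.
Let w_if := @runs_if O b b_gt0 nbr_bits time_unit.
Let w_skip := @runs_skip O b b_gt0 time_unit.
Let w_emit := @runs_emit O b b_gt0 nbr_bits time_unit.

Ltac ev := cbn [eval mem lt_e eq_e mod_e].
Ltac cb := repeat match goal with H : bounded b (upd _ _ _) |- _ => clear H end.
Ltac sq := eapply w_set_seq; [vm_compute; reflexivity|by []|ev; rdm|cb; move=> ?; ev].
Ltac s1 := eapply w_set; [vm_compute; reflexivity|by []|ev; rdm|cb; move=> ?; ev].

Lemma p_setup_ok :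
  runs p_setup (State (nth 0 [:: n; d; k; v]) [::]) (40 + 2 * kap + 2 * m + 3 * mu + 3 * w)
    (fun s => let: State g o := s in
       [/\ o = [::], glob g & forall a, (a == 12) || (a == 13) || (a == 20) || (31 < a) -> g a = 0]).
Proof.
have [KE epsK m_gt0 m_ge m_min m2n WE W_ge W_min lgE wE NBE allE ME bigP] := P.
have hb0 : bounded b (nth 0 [:: n; d; k; v]).
  by case=> [|[|[|[|i]]]] /=; rewrite ?nth_nil; lia.
rewrite /p_setup.
have K0 : 0 < K by rewrite KE muln_gt0 expn_gt0.
eapply runs_leN.
sq; first by lia.
eapply runs_seq.
  eapply (w_while (N := 1) (k := kap) (I := fun j s => let: State g o := s in
    [/\ bounded b g, o = [::], exists2 i, i <= kap & g 4 = 16 * 2 ^ i /\ j = kap - i,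
       g 0 = n /\ g 3 = v & forall a, 4 < a -> g a = 0])).
  - by vm_compute.
  - split=> //.
      by exists 0 => //; split; [rewrite upd_at muln1|lia].
    by move=> [|[|[|[|[|a]]]]] //= _; rdm; rewrite /= nth_nil.
  - by move=> ? ? ? [].
  - move=> j g o [hb -> [i hi [g4 ->]] [g0 g3] hz]; ev; rewrite g4 epsK //.
    case: (leqP kap i) => //= hik _.
    have h2 : 16 * 2 ^ i.+1 <= K by rewrite KE leq_mul2l leq_exp2l.
    rewrite expnS in h2.
    s1; first by rewrite g4; nia.
    exists (kap - i.+1); first by lia.
    split=> //; last by move=> a ha; rdm; apply: hz.
      by exists i.+1 => //; split=> //; rdm; rewrite g4 expnS; lia.
move=> [g o] [[j _ [hb -> [i hi [g4 _]] [g0 g3] hz]]]; ev.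
rewrite g4 epsK // => hki.
have {hki hi} hik : i = kap by move: hki; case: (leqP kap i) => //=; lia.
rewrite hik -KE in g4; clear hik i j.
have hm : m <= n by rewrite leqNgt; apply/negP => /m_min; nia.
have hKW : K <= K * W by rewrite leq_pmulr // WE expn_gt0.
have hWK : W <= K * W by rewrite leq_pmull.
sq; first by lia.
eapply runs_seq.
  eapply (w_while (N := 1) (k := m - 1) (I := fun j s => let: State g o := s in
    [/\ bounded b g, o = [::], exists2 i, i <= m & [/\ 0 < i, g 5 = i & j = m - i],
       [/\ g 0 = n, g 3 = v & g 4 = K] & forall a, 5 < a -> g a = 0])).
  - by vm_compute.
  - split=> //.
      by exists 1.
    by move=> a ha; rdm; apply: hz; lia.
  - by move=> ? ? ? [].
  - cb; move=> j0 {}g o1 [{}hb -> [i hi [i0 g5 ->]] [{}g0 {}g3 {}g4] {}hz]; ev; rewrite g5 g0.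
    case: leqP => //= hin _.
    have him : i < m by rewrite ltnNge; apply/negP => hmi; nia.
    s1; first by lia.
    exists (m - i.+1); first by lia.
    split=> //; last by move=> a ha; rdm; apply: hz.
    by exists i.+1 => //; split=> //; rdm; lia.
cb; move=> [{}g o1] [[j' _ [{}hb -> [i hi [i0 g5 _]] [{}g0 {}g3 {}g4] {}hz]]].
ev; rewrite g5 g0; case: leqP => //= hin _.
have {hin hi} im : i = m by apply/eqP; rewrite eqn_leq hi leqNgt; apply/negP => /m_min; lia.
rewrite im in g5; clear i0 im i j'.
have hmu : mu < W by rewrite WE ltn_expl.
sq; first by lia.
sq; first by lia.
eapply runs_seq.
  eapply (w_while (N := 2) (k := mu) (I := fun j s => let: State g o := s in
    [/\ bounded b g, o = [::], exists2 i, i <= mu & [/\ g 6 = 2 ^ i, g 7 = i.+1 & j = mu - i],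
       [/\ g 0 = n, g 3 = v, g 4 = K & g 5 = m] & forall a, 7 < a -> g a = 0])).
  - by vm_compute.
  - split=> //.
      by exists 0; rewrite // subn0.
    by move=> a ha; rdm; apply: hz; lia.
  - by move=> ? ? ? [].
  - cb; move=> j0 {}g o2 [{}hb -> [i hi [g6 g7 ->]] [{}g0 {}g3 {}g4 {}g5] {}hz]; ev; rewrite g6 g5.
    case: leqP => //= hin _.
    have him : i < mu by rewrite ltnNge; apply/negP => hmi; have := leq_pexp2l (isT : 0 < 2) hmi; lia.
    have hW : 2 ^ i < W by rewrite WE ltn_exp2l.
    sq; first by lia.
    s1; first by lia.
    exists (mu - i.+1); first by lia.
    split=> //; last by move=> a ha; rdm; apply: hz.
    by exists i.+1 => //; split=> //; rdm; rewrite ?expnS; lia.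
cb; move=> [{}g o2] [[j' _ [{}hb -> [i hi [g6 g7 _]] [{}g0 {}g3 {}g4 {}g5] {}hz]]].
ev; rewrite g6 g5; case: leqP => //= hin _.
have {hin hi} im : i = mu.
  by apply/eqP; rewrite eqn_leq hi leqNgt; apply/negP => /W_min; lia.
rewrite im -WE in g6; rewrite im -lgE in g7; clear im i j'.
have hw : w < 2 ^ w by rewrite ltn_expl.
sq; first by lia.
eapply runs_seq.
  eapply (w_while (N := 2) (k := w) (I := fun j s => let: State g o := s in
    [/\ bounded b g, o = [::], exists2 i, i <= w & [/\ g 25 = 2 ^ i, g 8 = i & j = w - i],
       [/\ g 0 = n, g 3 = v, g 4 = K & g 5 = m] /\ (g 6 = W /\ g 7 = lg) &
       forall a, 8 < a -> a != 25 -> g a = 0])).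
  - by vm_compute.
  - split=> //.
      by exists 0; rewrite // subn0; split=> //; rdm; apply: hz.
    by move=> a ha ha2; rdm; apply: hz; lia.
  - by move=> ? ? ? [].
  - cb; move=> j0 {}g o3 [{}hb -> [i hi [g25 g8 ->]] [[{}g0 {}g3 {}g4 {}g5] [{}g6 {}g7]] {}hz].
    ev; rewrite g25 g4 g6 -wE.
    case: leqP => //= hin _.
    have him : i < w by rewrite ltnNge; apply/negP => hmi; have := leq_pexp2l (isT : 0 < 2) hmi; lia.
    have hW : 2 ^ i.+1 <= 2 ^ w by rewrite leq_exp2l.
    rewrite expnS in hW.
    sq; first by lia.
    s1; first by lia.
    exists (w - i.+1); first by lia.
    split=> //; last by move=> a ha ha2; rdm; apply: hz.
    by exists i.+1 => //; split=> //; rdm; rewrite ?expnS; lia.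
cb; move=> [{}g o3] [[j' _ [{}hb -> [i hi [g25 g8 _]] [[{}g0 {}g3 {}g4 {}g5] [{}g6 {}g7]] {}hz]]].
ev; rewrite g25 g4 g6 -wE; case: leqP => //= hin _.
have {hin hi} im : i = w.
  apply/eqP; rewrite eqn_leq hi leqNgt; apply/negP => h.
  by have := ltn_exp2l i w (isT : 1 < 2); lia.
rewrite im in g8; clear im g25 i j'.
have hdiv : m %/ K <= m := leq_div m K.
sq; first by rewrite g5 g4; lia.
eapply (w_if (N := 2)).
- by vm_compute.
- by [].
- ev; rdm; rewrite g7 g0 -allE => ha.
  have {}ha : allf by move: ha; case: (allf).
  have ME1 : M = 1024 * (K * lg) by rewrite ME ha.
  sq; first by rewrite g4 g7 -ME1; lia.
  s1; first by have : 0 < 2 ^ b; rewrite ?expn_gt0 //; lia.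
  split=> //; last by move=> a h; rdm; apply: hz; lia.
  by split; split=> //; rdm; rewrite ?g5 ?g4 ?g7 ?ha ?ME1.
- ev; rdm; rewrite g7 g0 -allE => ha.
  have {}ha : allf = false by move: ha; case: (allf).
  have ME1 : M = n + 1 by rewrite ME ha.
  eapply runs_leN.
    s1; first by rewrite g0; lia.
    split=> //; last by move=> a h; rdm; apply: hz; lia.
    split; split=> //; rdm; rewrite ?g5 ?g4 ?g0 ?ha ?ME1 //.
    by apply: hz.
  by [].
by lia.
Qed.

Lemma good_bounded L st j g o : good L st j (State g o) -> bounded b g.
Proof. by case=> _ [_ []]. Qed.

Lemma glob_upd g a x : glob g -> 11 < a -> x < 2 ^ b -> glob (upd g a x).
Proof.
move=> [[g0 g3 g4 g5] [g8 g9 g10 g11 hb]] ha hx.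
by split; split; rdm => //; apply: bounded_upd.
Qed.

Lemma good_var L st j g o a x :
  good L st j (State g o) -> 13 < a < 32 -> a != 20 -> x < 2 ^ b ->
  good L st j (State (upd g a x) o).
Proof.
move=> [ho hg [h1 h2 h3] h4 h5] ha ha2 hx; split; [by []|by apply: glob_upd => //; lia| | |].
- by split; rdm.
- by move=> i hi; rdm; exact: h4.
- by move=> y; rdm.
Qed.

Lemma good_store L st j g o i x :
  good L st j (State g o) -> x < 2 ^ b -> good L st j (State (upd g (33 + 3 * i) x) o).
Proof.
move=> [ho hg [h1 h2 h3] h4 h5] hx; split; [by []|by apply: glob_upd => //; lia| | |].
- by split; rdm.
- by move=> i' hi; rdm; exact: h4.
- by move=> y; rdm.
Qed.

Lemma good_mark L st j g o y :
  good L st j (State g o) -> good L st j (State (upd g (34 + 3 * y) st) o).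
Proof.
move=> hgood; have [ho hg [h1 h2 h3] h4 h5] := hgood.
have hb := good_bounded hgood; split; first by [].
- by apply: glob_upd => //; rewrite -h2; apply: hb.
- by split; rdm.
- by move=> i' hi; rdm; exact: h4.
- move=> y'; case: (eqVneq y y') => [->|hy]; first by rdm.
  by rdm.
Qed.

Lemma good_push L st j g o x :
  good L st j (State g o) -> x < 2 ^ b -> (size L).+1 < 2 ^ b ->
  good (rcons L x) st j (State (upd (upd g (32 + 3 * size L) x) 12 (size L).+1) o).
Proof.
move=> [ho hg [h1 h2 h3] h4 h5] hx hL; split; first by [].
- by apply: glob_upd => //; apply: glob_upd => //; lia.
- by rewrite size_rcons; split; rdm.
- move=> i; rewrite size_rcons ltnS nth_rcons leq_eqVlt.
  case: eqP => [->|/eqP hi] /= h; first by rewrite ltnn ?eqxx; rdm; rewrite ?eqxx.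
  by rewrite h; rdm; apply: h4.
- by move=> y; rdm.
Qed.

Lemma good_stamp L st j g o :
  good L st j (State g o) -> st.+1 < 2 ^ b ->
  good L st.+1 j (State (upd g 13 st.+1) o) /\
  forall y, upd g 13 st.+1 (34 + 3 * y) < st.+1.
Proof.
move=> [ho hg [h1 h2 h3] h4 h5] hx; split; last by move=> y; rdm; rewrite ltnS.
split; [by []|by apply: glob_upd|by split; rdm| |].
- by move=> i hi; rdm; exact: h4.
- by move=> y; rdm; rewrite leqW.
Qed.

Lemma push_ok L st j g o e x (Q : state -> Prop) :
  ecost (slot 32 (rd 12)) + ecost e < time_unit ->
  good L st j (State g o) -> eval O g e = x -> x < 2 ^ b -> (size L).+1 < 2 ^ b ->
  Q (State (upd (upd g (32 + 3 * size L) x) 12 (size L).+1) o) ->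
  runs (push e) (State g o) 2 Q.
Proof.
move=> hU hgood he hx hL hQ.
have [ho hg [h1 h2 h3] h4 h5] := hgood.
have hb := good_bounded hgood.
eapply runs_leN.
eapply w_set_seq => //; first by rewrite he.
  ev; rewrite h1 he => hb1.
  eapply w_set; [by vm_compute|by []|ev; rdm; rewrite h1; lia|].
  ev; rdm; rewrite h1 addn1 => _; exact: hQ.
by [].
Qed.

Lemma p_cand_nbrs_ok g :
  good [::] 0 0 (State g [::]) ->
  runs p_cand_nbrs (State g [::]) (1 + 3 * d) (good (nb v) 0 0).
Proof.
move=> hgood.
have hsz := nb_size v_lt.
eapply runs_le.
- eapply (w_while (N := 2) (k := size (nb v)) (I := fun j s =>
    exists2 i, i <= size (nb v) & j = size (nb v) - i /\ good (take i (nb v)) 0 0 s)).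
  + by vm_compute.
  + by exists 0; rewrite ?subn0 ?take0.
  + by move=> ? ? ? [? _ [_ /good_bounded]].
  + move=> j {hgood}g o [i hi [-> hgood]].
    have [ho [[g0 g3 g4 g5] _] [h1 h2 h3] h4 h5] := hgood.
    ev; rewrite g3 h1 nbrE // size_takel // => hnz.
    have hil : i < size (nb v).
      by rewrite ltnNge; apply/negP => hge; rewrite nth_default ?size_map in hnz.
    have hn : nth 0 (nb v) i < n := nb_lt (mem_nth 0 hil).
    apply: (push_ok _ hgood (x := nth 0 (nb v) i)).
    * by vm_compute.
    * by ev; rewrite g3 h1 size_takel // nbrE // (nth_map 0) //; lia.
    * by lia.
    * by rewrite size_takel; lia.
    * exists (size (nb v) - i.+1); first by lia.
      exists i.+1 => //; split=> //; rewrite (take_nth 0) //.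
      by apply: good_push => //; [lia|rewrite size_takel; lia].
- by lia.
- move=> [g' o] [[j _ [i hi [_ hgood']]]].
  have [ho [[g0 g3 g4 g5] _] [h1 h2 h3] h4 h5] := hgood'.
  ev; rewrite g3 h1 nbrE // size_takel //.
  case: (ltnP i (size (nb v))) => hil; first by rewrite (nth_map 0).
  by move: hgood'; rewrite take_oversize.
Qed.

(** l is the queue and h its head. That l contains only reachable vertices is expressed without
    paths: every set that contains x and is closed under neighbours contains l. *)
Definition bfs_inv (L : seq nat) (st j x h : nat) (l : seq nat) (g : nat -> nat) : Prop :=
  [/\ good L st j (State g [::]),
      [/\ g 14 = x, g 15 = size l, g 16 = h & g 19 = all (fun y => y <= x) l],
      (forall i, i < size l -> g (33 + 3 * i) = nth 0 l i) /\
      (forall y, (g (34 + 3 * y) == st) = (y \in l)),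
      [/\ uniq l, x \in l, {in l, forall y, y < n} &
          forall S : pred nat, S x -> (forall y z, S y -> z \in nb y -> S z) -> {in l, forall y, S y}] &
      h <= size l /\ forall i, i < h -> {subset nb (nth 0 l i) <= l}].

Lemma bfs_var L st j x h l g a z :
  bfs_inv L st j x h l g -> a \in [:: 17; 18] -> z < 2 ^ b -> bfs_inv L st j x h l (upd g a z).
Proof.
rewrite !inE => -[hg [h1 h2 h3 h4] [h5 h6] h7 h8] ha hz.
split; [by apply: good_var hg _ _ hz; lia|by split; rdm| |by []|by []].
by split=> [i hi|y]; rdm; [exact: h5|exact: h6].
Qed.

Lemma bfs_bounded L st j x h l g : bfs_inv L st j x h l g -> bounded b g.
Proof. by case=> /good_bounded. Qed.

Lemma size_le_n (l : seq nat) : uniq l -> {in l, forall y, y < n} -> size l <= n.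
Proof.
move=> hu hl; rewrite -(size_iota 0 n); apply: uniq_leq_size => // y /hl hy.
by rewrite mem_iota.
Qed.

Lemma p_visit_ok L st j x h l g i y :
  st < 2 ^ b ->
  bfs_inv L st j x h l g -> h < size l -> nth 0 l h = y -> g 17 = i -> i < size (nb y) ->
  runs p_visit (State g [::]) 8 (fun s => let: State g o := s in
    o = [::] /\ exists l', [/\ bfs_inv L st j x h l' g, h < size l', nth 0 l' h = y,
      {subset l <= l'} & g 17 = i.+1 /\ nth 0 (nb y) i \in l']).
Proof.
move=> hst hI hh hy h17 hi.
have yl : y \in l by rewrite -hy mem_nth.
have [hg [g14 g15 g16 g19] [harr hmk] [hu hx hln hS] [hhl hpr]] := hI.
have yn := hln _ yl.
have hb := good_bounded hg.
have hz : nth 0 (nb y) i < n := nb_lt (mem_nth 0 hi).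
have hyb := nb_size yn.
set z := nth 0 (nb y) i in hz *.
have hev : o_nbr O (g (33 + 3 * g 16)) (g 17) = z.+1.
  by rewrite g16 harr // hy h17 nbrE // (nth_map 0).
eapply runs_leN.
sq; first by rewrite hev; lia.
rewrite hev subn1 /=.
pose Qmid s := let: State g o := s in
  o = [::] /\ exists l', [/\ bfs_inv L st j x h l' g, h < size l', nth 0 l' h = y,
  {subset l <= l'} & g 17 = i /\ z \in l'].
eapply (runs_seq (Q1 := Qmid)).
  have hI1 : bfs_inv L st j x h l (upd g 18 z).
    by apply: bfs_var hI _ _; rewrite ?inE //; lia.
  have hb1 := bfs_bounded hI1.
  eapply (w_if (N := 5)); [by vm_compute|by []| |]; ev; rdm.
  - have hg13 : g 13 = st by case: hg => _ _ [].
    rewrite hg13 => hne.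
    have zl : z \notin l by rewrite -hmk; apply/eqP; lia.
    have hsl : size (rcons l z) <= n.
      apply: size_le_n; first by rewrite rcons_uniq zl hu.
      by move=> y'; rewrite mem_rcons inE => /orP[/eqP ->|/hln].
    rewrite size_rcons in hsl.
    eapply runs_leN.
    sq; first by lia.
    sq; first by lia.
    sq; first by lia.
    rdm; rewrite g15 hg13.
    set g1 := upd _ 15 _.
    have hbg1 : bounded b g1.
      rewrite /g1.
      apply: bounded_upd; last by lia.
      apply: bounded_upd; last by lia.
      apply: bounded_upd; last by lia.
      exact: bfs_bounded hI1.
    have hI2 : bfs_inv L st j x h (rcons l z) (upd g1 19 (all (fun y => y <= x) (rcons l z))).
      have hal : (all (fun y => y <= x) (rcons l z) : nat) < 2 ^ b by case: all => /=; lia.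
      split.
      + apply: good_var => //.
        apply: good_var => //; last by lia.
        apply: good_mark; apply: good_store; last by lia.
        by apply: good_var => //; lia.
      + by rewrite size_rcons; split; rdm => //; rewrite /g1; rdm => //; rewrite addn1.
      + split=> [i'|y'].
          rewrite size_rcons ltnS nth_rcons leq_eqVlt /g1.
          case: eqP => [->|/eqP hne'] /= h'; first by rewrite ltnn ?eqxx; rdm; rewrite ?eqxx.
          by rewrite h'; rdm; apply: harr.
        rewrite mem_rcons inE /g1; case: (eqVneq y' z) => [->|hy'] /=; first by rdm; rewrite eqxx.
        by rdm; apply: hmk.
      + split; first by rewrite rcons_uniq zl hu.
        * by rewrite mem_rcons inE hx orbT.
        * by move=> y'; rewrite mem_rcons inE => /orP[/eqP ->|/hln].
        * move=> S Sx hcl y'; rewrite mem_rcons inE => /orP[/eqP ->|/(hS _ Sx hcl) //].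
          exact: hcl (hS _ Sx hcl _ yl) (mem_nth 0 hi).
      + split; first by rewrite size_rcons leqW.
        move=> i' hi' t; rewrite nth_rcons (leq_trans hi' hhl) => /(hpr _ hi') tl.
        by rewrite mem_rcons inE tl orbT.
    have hsame : forall g2, g2 = upd g1 19 (all (fun y => y <= x) (rcons l z)) -> 
      Qmid (State g2 [::]).
      move=> g2 ->; split=> //; exists (rcons l z); split=> //.
      * by rewrite size_rcons leqW.
      * by rewrite nth_rcons hh.
      * by move=> t tl; rewrite mem_rcons inE tl orbT.
      * by rewrite mem_rcons mem_head; split=> //; rewrite /g1; rdm.
    eapply (w_if (N := 1)); [by vm_compute|exact: hbg1| |]; ev; rewrite /g1; rdm; rewrite g14 -/g1 addn1.
    + case: leqP => //= hxz _.
      s1; first by rewrite /=; lia.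
      apply: hsame; congr upd; rewrite all_rcons.
      by rewrite leqNgt hxz.
    + case: leqP => //= hxz _.
      apply: w_skip => //; apply: hsame; apply: funext => a; rewrite /upd.
      case: eqP => // ->; rewrite all_rcons hxz /= -g19 /g1.
      by rdm.
    by [].
  - have hg13 : g 13 = st by case: hg => _ _ [].
    rewrite hg13 => hne.
    have zl : z \in l by rewrite -hmk; case: hg => _ _ _ _ /(_ z); lia.
    eapply runs_leN; first apply: w_skip => //.
      by split=> //; exists l; split=> //; split=> //; rdm.
    by [].
cb; move=> [g1 o] [-> [l' [hI' hh' hy' hsub [h17' hzl]]]].
have [hg' _ _ _ _] := hI'.
have hb' := good_bounded hg'.
s1; first by lia.
split=> //; exists l'; split=> //.
  by apply: bfs_var hI' _ _; rewrite ?inE //; lia.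
by split=> //; rdm; lia.
by [].
Qed.

(** A round is entered only if h < size l < M, and size l <= n, so there are at most [minn n M]
    rounds. The list may overshoot M; if it stays shorter, the loop ended because the queue was
    exhausted, and l is closed under neighbours. *)
Lemma p_bfs_ok L st j x g :
  good L st j (State g [::]) -> g 14 = x -> x < n -> st.+1 < 2 ^ b ->
  runs p_bfs (State g [::]) (10 + minn n M * (9 * d + 5)) (fun s => let: State g o := s in
    o = [::] /\ exists l h, bfs_inv L st.+1 j x h l g /\ (size l < M -> h = size l)).
Proof.
move=> hgood g14 hx hst.
have hb := good_bounded hgood.
have [_ hglob [g12 g13 g20] _ _] := hgood.
have [hgood1 hmk1] := good_stamp hgood hst.
eapply runs_leN.
sq; first by lia.
sq; first by lia.
sq; first by lia.
sq; first by lia.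
sq; first by lia.
sq; first by lia.
rdm; rewrite g13 g14 addn1.
set g1 := upd _ 19 1.
have hI1 : bfs_inv L st.+1 j x 0 [:: x] g1.
  split.
  - do 3! (apply: good_var => //; last by lia).
    by apply: good_mark; apply: good_store => //; lia.
  - by rewrite /g1; split; rdm => //; rewrite /= leqnn.
  - split=> [i|y]; first by rewrite /g1; case: i => //= _; rdm.
    rewrite inE /g1; case: (eqVneq y x) => [->|hy]; first by rdm; rewrite eqxx.
    by rdm; have := hmk1 y; rdm; lia.
  - split=> //; first by rewrite mem_head.
    + by move=> y; rewrite inE => /eqP ->.
    + by move=> S Sx _ y; rewrite inE => /eqP ->.
  - by [].
eapply runs_le.
- eapply (w_while (N := 9 * d + 4) (k := minn n M) (I := fun k s => let: State g o := s in
    o = [::] /\ exists l h, bfs_inv L st.+1 j x h l g /\ (k = minn n M - h))).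
  + by vm_compute.
  + by split=> //; exists [:: x], 0; split=> //; rewrite subn0.
  + by move=> k0 g0 o [_ [l [h [/bfs_bounded]]]].
  + move=> k0 {hgood1 hmk1 hI1 g1}g1 o [-> [l [h [hI ->]]]].
    have [hg [h14 h15 h16 h19] [harr hmk] [hu hxl hln hS] [hhl hpr]] := hI.
    have [_ [_ [_ _ h10 _ _]] [_ h13 _] _ _] := hg.
    have hb1 := bfs_bounded hI.
    have hsn := size_le_n hu hln.
    ev; rewrite h16 h15 h10 muln_eq0 negb_or !eqb0 !negbK => /andP[hh hM].
    have hh1 : h < size l by lia.
    have yl : nth 0 l h \in l := mem_nth 0 hh1.
    set y := nth 0 l h in yl *.
    have yn := hln _ yl.
    eapply runs_leN.
    sq; first by lia.
    pose J k s := let: State g o := s in o = [::] /\ exists l' i,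
      [/\ bfs_inv L st.+1 j x h l' g, h < size l', nth 0 l' h = y &
         [/\ g 17 = i, i <= size (nb y), k = size (nb y) - i &
          forall i', i' < i -> nth 0 (nb y) i' \in l']].
    eapply (runs_seq (Q1 := fun s => J 0 s)).
      eapply runs_le.
      * eapply (w_while (N := 8) (k := size (nb y)) (I := J)).
        -- by vm_compute.
        -- split=> //; exists l, 0; split=> //; first by apply: bfs_var hI _ _; rewrite ?inE //; lia.
           by split=> //; rdm => //; rewrite subn0.
        -- by move=> k2 g2 o2 [_ [l' [i [/bfs_bounded]]]].
        -- cb; move=> k2 g2 o2 [-> [l' [i [hI' hh' hy' [h17 hi -> hin]]]]].
           have [hg' [h14' h15' h16' h19'] [harr' hmk'] _ _] := hI'.
           ev; rewrite h16' harr' // hy' h17 nbrE // => hnz.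
           have hil : i < size (nb y).
             by rewrite ltnNge; apply/negP => hge; rewrite nth_default ?size_map in hnz.
           apply: runs_le (p_visit_ok hst hI' hh' hy' h17 hil) _ _ => //.
           move=> [g3 o3] [-> [l3 [hI3 hh3 hy3 hsub3 [h173 hin3]]]].
           exists (size (nb y) - i.+1); first by lia.
           split=> //; exists l3, i.+1; split=> //; split=> //.
           move=> i'; rewrite ltnS leq_eqVlt => /orP[/eqP -> //|/hin/hsub3 //].
      * by apply: leqnn.
      * move=> [g2 o2] [[k' _ [-> [l' [i [hI' hh' hy' [h17 hi _ hin]]]]]]].
        have [hg' [h14' h15' h16' h19'] [harr' hmk'] _ _] := hI'.
        ev; rewrite h16' harr' // hy' h17 nbrE //.
        case: (ltnP i (size (nb y))) => hil; first by rewrite (nth_map 0).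
        move=> _; split=> //; exists l', i; split=> //; split=> //; lia.
    cb; move=> [g2 o2] [-> [l' [i [hI' hh' hy' [h17 hi hi0 hin]]]]].
    have [hg' [h14' h15' h16' h19'] [harr' hmk'] hl4 [hhl' hpr']] := hI'.
    have hb2 := bfs_bounded hI'.
    have hsn' := size_le_n (let: And4 u _ _ _ := hl4 in u) (let: And4 _ _ u _ := hl4 in u).
    s1; first by lia.
    exists (minn n M - h.+1); first by rewrite /minn; case: ifP; lia.
    split=> //; exists l', h.+1; split=> //.
    split=> //.
    * by apply: good_var => //; lia.
    * by split; rdm => //; rewrite h16' addn1.
    * split; first exact: hh'.
      move=> i'; rewrite ltnS leq_eqVlt => /orP[/eqP -> |/hpr' //].
      rewrite hy' => t tin; rewrite -(nth_index 0 tin); apply: hin.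
      by apply: leq_trans (_ : size (nb y) <= i); [rewrite index_mem|lia].
    by have := nb_size yn; lia.
- by apply: leqnn.
- move=> [g2 o2] [[k' _ [-> [l [h [hI _]]]]]].
  have [hg [h14 h15 h16 h19] [harr hmk] _ [hhl hpr]] := hI.
  have [_ [_ [_ _ h10 _ _]] _ _ _] := hg.
  ev; rewrite h16 h15 h10 => h0; split=> //; exists l, h; split=> //.
  by move: h0 => /eqP; rewrite muln_eq0 !eqb0; lia.
by lia.
Qed.

Lemma modn_sub a c : a - a %/ c * c = a %% c.
Proof. by rewrite {1}(divn_eq a c) addKn. Qed.

Lemma p_link_ok L st j x g e y :
  good L st j (State g [::]) -> g 14 = x -> x < n -> st.+1 < 2 ^ b ->
  ecost (slot 32 (rd 12)) + ecost e < time_unit ->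
  (forall g', glob g' -> g' 14 = x -> eval O g' e = y) -> y < n -> (size L).+1 < 2 ^ b ->
  runs (p_bfs ;; If e_link (push e) Skip) (State g [::]) (13 + minn n M * (9 * d + 5))
    (good (if linked x then rcons L y else L) st.+1 j).
Proof.
move=> hgood g14 hx hst he hev hy hL.
eapply runs_leN.
eapply runs_seq; first by apply: p_bfs_ok hgood g14 hx hst.
move=> [g1 o] [-> [l [h [hI hh]]]].
have [hg [h14 h15 h16 h19] [harr hmk] [hu hxl hln hS] [hhl hpr]] := hI.
have [_ hglob _ _ _] := hg.
have [_ [_ _ h10 h11 hb]] := hglob.
have -> : linked x = (eval O g1 e_link != 0).
  rewrite /e_link; ev; rewrite h15 h10 h11 h19 addn1.
  rewrite (linkedE hx hu hxl hln hS); last first.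
    move=> hM y' /(nthP 0)[i hi <-]; apply: hpr; by rewrite hh.
  by rewrite muln_eq0 addn_eq0 !eqb0 negb_or negbK -negb_or negbK; case: allf.
eapply (w_if (N := 2)); [by vm_compute|by []| |] => hc.
  have hy2 : y < 2 ^ b by lia.
  apply: (push_ok he hg (hev _ hglob h14) hy2 hL).
  by rewrite hc; apply: good_push.
eapply runs_leN; first apply: w_skip => //; first by rewrite hc.
by [].
by lia.
Qed.

Lemma p_link_next_ok L st j g :
  good L st j (State g [::]) -> st.+1 < 2 ^ b -> (size L).+1 < 2 ^ b ->
  runs p_link_next (State g [::]) (14 + minn n M * (9 * d + 5))
    (good (if linked v then rcons L (v.+1 %% n) else L) st.+1 j).
Proof.
move=> hgood hst hL.
have hb := good_bounded hgood.
have [_ [[_ g3 _ _] _] _ _ _] := hgood.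
eapply runs_leN.
sq; first by lia.
apply: p_link_ok => //; rdm => //.
- by apply: good_var => //; lia.
- move=> g' [[h0 h3 _ _] _] _; ev; rewrite h0 h3 modn_sub addn1; reflexivity.
- by rewrite ltn_mod.
- by lia.
Qed.

Lemma p_link_prev_ok L st j g :
  good L st j (State g [::]) -> st.+1 < 2 ^ b -> (size L).+1 < 2 ^ b ->
  runs p_link_prev (State g [::]) (14 + minn n M * (9 * d + 5))
    (good (if linked ((v + (n - 1)) %% n) then rcons L ((v + (n - 1)) %% n) else L) st.+1 j).
Proof.
move=> hgood hst hL.
have hb := good_bounded hgood.
have [_ [[g0 g3 _ _] _] _ _ _] := hgood.
have hx : (v + (n - 1)) %% n < n by rewrite ltn_mod.
eapply runs_leN.
sq; first by rewrite g0 g3 modn_sub; lia.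
rewrite g0 g3 modn_sub.
apply: p_link_ok => //; rdm => //.
by apply: good_var => //; lia.
by lia.
Qed.

Definition uval B := foldl (fun a i => 2 * a + o_seed O (B * w + i)) 0 (iota 0 w).

Local Notation cands l p be := (flatten [seq block_cands n K m NB uval l p be' | be' <- iota 0 be]).

Lemma uval_lt i B : foldl (fun a i => 2 * a + o_seed O (B * w + i)) 0 (iota 0 i) < 2 ^ i.
Proof.
elim: i => // i IH; rewrite -[i.+1]addn1 iotaD foldl_cat add0n /= addn1 expnS.
by case: (o_seed _ _) => /=; lia.
Qed.

Lemma size_block_cands l p be : size (block_cands n K m NB uval l p be) <= 2.
Proof. by rewrite /block_cands; case: ifP => //; do 2 case: ifP. Qed.

Lemma size_cands l p be : size (cands l p be) <= 2 * be.
Proof.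
elim: be => // be IH; rewrite -[be.+1]addn1 iotaD map_cat flatten_cat size_cat add0n /= cats0.
by have := size_block_cands l p be; lia.
Qed.

Lemma cands_S l p be : cands l p be.+1 = cands l p be ++ block_cands n K m NB uval l p be.
Proof. by rewrite -[be.+1]addn1 iotaD map_cat flatten_cat add0n /= cats0. Qed.

(** The marks carrying the current stamp are exactly the targets of the earlier blocks, so one
    memory access decides [fresh]. *)
Definition line_inv (L : seq nat) (st j l p be : nat) (g : nat -> nat) : Prop :=
  [/\ good L st j (State g [::]),
      [/\ g 21 = l, g 22 = p, g 23 = be & forall q, g 29 + g 30 * q = cell m l q] &
      forall y, (g (34 + 3 * y) == st) = has (fun be' => tgt K NB uval l be' == y) (iota 0 be)].

Lemma line_var L st j l p be g a z :
  line_inv L st j l p be g -> a \in [:: 17; 24; 25; 27; 28] -> z < 2 ^ b ->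
  line_inv L st j l p be (upd g a z).
Proof.
rewrite !inE => -[hg [h1 h2 h3 h4] h5] ha hz.
split; first by apply: good_var hg _ _ hz; lia.
  by split; rdm.
by move=> y; rdm; exact: h5.
Qed.

Lemma line_bounded L st j l p be g : line_inv L st j l p be g -> bounded b g.
Proof. by case=> /good_bounded. Qed.

Lemma seed_bound l be : l < 2 * m -> be < NB -> (l * NB + be) * w + w < 2 ^ b.
Proof.
have [KE epsK m_gt0 m_ge m_min m2n WE W_ge W_min lgE wE NBE allE ME bigP] := P.
move=> hl hbe.
have h1 : (l.+1) * NB <= 2 * m * NB by rewrite leq_mul2r hl orbT.
have h2 : (l * NB + be).+1 * w <= 2 * m * NB * w by rewrite leq_mul2r; apply/orP; right; lia.
move: h2; rewrite mulSn; lia.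
Qed.

Lemma p_read_ok L st j l p be g :
  line_inv L st j l p be g -> l < 2 * m -> be < NB ->
  runs p_read (State g [::]) (3 * w + 4) (fun s => let: State g o := s in
    [/\ o = [::], line_inv L st j l p be g & g 24 = uval (l * NB + be)]).
Proof.
move=> hI hl hbe.
have hsb := seed_bound hl hbe.
have [_ _ _ _ _ _ WE _ _ _ wE _ _ _ bigP] := P.
have [[_ [_ [h8 h9 _ _ hb]] _ _ _] [h21 h22 h23 h29] hmk] := hI.
eapply runs_leN.
sq; first by rewrite h21 h9 h23 h8; lia.
sq; first by lia.
sq; first by lia.
rdm; rewrite h21 h9 h23 h8.
set B := l * NB + be in hsb *.
eapply runs_le.
- eapply (w_while (N := 2) (k := w) (I := fun k s => let: State g o := s in
    exists i, [/\ o = [::], line_inv L st j l p be g, i <= w & k = w - i] /\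
      [/\ g 25 = B * w, g 17 = i &
          g 24 = foldl (fun a i => 2 * a + o_seed O (B * w + i)) 0 (iota 0 i)])).
  + by vm_compute.
  + exists 0; split.
      split; rewrite ?subn0 //.
      by do 3! (apply: line_var => //; last by lia).
    by split; rdm.
  + by move=> k0 g0 o [i [[_ /line_bounded]]].
  + cb; move=> k0 g0 o [i [[-> hI' hi ->] [h25 h17 h24]]].
    have [[_ [_ [h8' _ _ _ hb']] _ _ _] _ _] := hI'.
    ev; rewrite h17 h8'; case: leqP => //= hiw _.
    have hlt := uval_lt i.+1 B.
    have hpw : 2 ^ i.+1 <= 2 ^ w by rewrite leq_exp2l // -addn1.
    have hE : 2 * g0 24 + o_seed O (g0 25 + i) =
      foldl (fun a i => 2 * a + o_seed O (B * w + i)) 0 (iota 0 i.+1).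
      by rewrite -[i.+1]addn1 iotaD foldl_cat /= h24 h25.
    sq; first by rewrite h17 hE; lia.
    s1; first by rewrite h17; lia.
    exists (w - i.+1); first by lia.
    exists i.+1; split.
      split=> //; last by lia.
      apply: line_var => //; last by rdm; lia.
      by apply: line_var => //; rewrite h17 hE; lia.
    by split; rdm => //; [rewrite h17 addn1|rewrite h17 hE].
- by apply: leqnn.
- move=> [g1 o] [[k' _ [i [[-> hI' hi _] [h25 h17 h24]]]]].
  have [[_ [_ [h8' _ _ _ hb']] _ _ _] _ _] := hI'.
  ev; rewrite h17 h8'; case: leqP => //= hiw _.
  by split=> //; rewrite h24 /uval; have -> : i = w by lia.
by lia.
Qed.

Lemma p_block_ok L st j l p be g :
  line_inv (L ++ cands l p be) st j l p be g -> l < 2 * m -> p < m -> be < NB ->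
  size L + 2 * NB < 2 ^ b -> st < 2 ^ b ->
  runs p_block (State g [::]) (3 * w + 17) (fun s => let: State g o := s in
    o = [::] /\ line_inv (L ++ cands l p be.+1) st j l p be.+1 g).
Proof.
move=> hI hl hp hbe hL hst.
have [KE epsK m_gt0 m_ge m_min m2n WE W_ge W_min lgE wE NBE allE ME bigP] := P.
have K0 : 0 < K by rewrite KE muln_gt0 expn_gt0.
have mn : m <= n by rewrite leqNgt; apply/negP => /m_min; nia.
have hNB : NB * K <= m + K by rewrite NBE mulnDl mul1n leq_add2r leq_trunc_div.
have hbK : be.+1 * K <= NB * K by rewrite leq_mul2r hbe orbT.
have hWK : W <= K * W by rewrite leq_pmull.
have hNB1 : NB <= m.+1 by rewrite NBE addn1 ltnS leq_div.
clear KE epsK m_ge m_min WE W_ge W_min lgE NBE allE ME.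
eapply runs_leN.
eapply runs_seq; first by apply: p_read_ok hI hl hbe.
move=> [{hI}g o] [-> hI h24].
set B := l * NB + be in h24.
have [hg [h21 h22 h23 h29] hmk] := hI.
have [_ [[h0 h3 h4 h5] [h8 h9 h10 h11 hb]] [h12 h13 _] _ _] := hg.
have hu : uval B < K * W by rewrite -wE uval_lt.
have hmod : uval B %% K < K by rewrite ltn_mod.
have hdiv : uval B %/ K < W by rewrite ltn_divLR // mulnC.
rewrite mulSn in hbK.
have hselE : be * K + uval B %% K = sel K NB uval l be by [].
have htgtE : uval B %/ K = tgt K NB uval l be by [].
sq; first by rewrite h23 h4 h24 modn_sub; lia.
sq; first by rewrite h24 h4; lia.
rdm; rewrite h23 h4 h24 modn_sub hselE htgtE.
rewrite htgtE in hdiv.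
set s := sel K NB uval l be in hselE *.
set t := tgt K NB uval l be in htgtE hdiv *.
have hsb : s < 2 ^ b by rewrite -hselE; lia.
have {htgtE}htb : t < 2 ^ b by lia.
set g1 := upd _ 28 t.
have hI1 : line_inv (L ++ cands l p be) st j l p be g1.
  by apply: line_var => //; apply: line_var.
have g127 : g1 27 = s by rewrite /g1; rdm.
have g128 : g1 28 = t by rewrite /g1; rdm.
move: g1 hI1 g127 g128 => g1 hI1 g127 g128.
pose Q1 s := let: State g o := s in o = [::] /\
  [/\ good (L ++ cands l p be.+1) st j (State g [::]),
      [/\ g 21 = l, g 22 = p, g 23 = be & forall q, g 29 + g 30 * q = cell m l q] &
      forall y, (g (34 + 3 * y) == st) = has (fun be' => tgt K NB uval l be' == y) (iota 0 be.+1)].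
apply: (runs_seq (Q1 := Q1) (N1 := 9) (N2 := 1)); last first.
  move=> [g2 o2] [-> [hg2 [i21 i22 i23 i29] imk]].
  have hb2 := good_bounded hg2.
  s1; first by rewrite i23; lia.
  split=> //; split.
  - by apply: good_var => //; rewrite i23; lia.
  - by split; rdm => //; rewrite i23 addn1.
  - by move=> y; rdm; exact: imk.
clear hI hg hmk h21 h22 h23 h29 h0 h3 h4 h5 h8 h9 h10 h11 hb h12 h13 h24.
have {hI1}[hg [h21 h22 h23 h29] hmk] := hI1.
have [_ [[h0 h3 h4 h5] [h8 h9 h10 h11 hb]] [h12 h13 _] _ hst2] := hg.
have hhas y : has (fun be' => tgt K NB uval l be' == y) (iota 0 be.+1) =
   has (fun be' => tgt K NB uval l be' == y) (iota 0 be) || (t == y).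
  by rewrite -[be.+1]addn1 iotaD has_cat add0n /= orbF.
have hfr : fresh K NB uval l be = ~~ (g1 (34 + 3 * t) == st).
  by rewrite hmk -all_predC /fresh; apply: eq_all => i /=; rewrite eq_sym.
have hcs := size_cands l p be.
have hbc : block_cands n K m NB uval l p be =
    if [&& ~~ (g1 (34 + 3 * t) == st), s < m & t < m] then
      (if s == p then [:: cell m l t %% n] else [::]) ++
      (if t == p then [:: cell m l s %% n] else [::])
    else [::] by rewrite /block_cands /accepted hfr.
rewrite /Q1 cands_S {}hbc catA.
move: (cands l p be) hg hcs => C hg hcs.
have hszL : size (L ++ C) + 2 < 2 ^ b by rewrite size_cat; lia.
eapply (w_if (N := 8)); [by vm_compute|by []| |]; ev; rewrite h13 g128.
- move=> hne; have -> : (g1 (34 + 3 * t) == st) = false by apply/eqP; lia.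
  rewrite /=.
  eapply runs_leN.
  sq; first by rewrite h13.
  rewrite h13 g128.
  set g2 := upd g1 _ st.
  have hI2 : [/\ good (L ++ C) st j (State g2 [::]),
      [/\ g2 21 = l, g2 22 = p, g2 23 = be & forall q, g2 29 + g2 30 * q = cell m l q] &
      forall y, (g2 (34 + 3 * y) == st) = has (fun be' => tgt K NB uval l be' == y) (iota 0 be.+1)].
    split; first exact: good_mark.
      by rewrite /g2; split; rdm.
    move=> y; rewrite hhas /g2; case: (eqVneq t y) => [->|hy]; first by rdm; rewrite eqxx orbT.
    by rdm; rewrite orbF; apply: hmk.
  have g227 : g2 27 = s by rewrite /g2; rdm.
  have g228 : g2 28 = t by rewrite /g2; rdm.
  have g25 : g2 5 = m by rewrite /g2; rdm.
  move: g2 hI2 g227 g228 g25 => g2 [hg2 i2 imk2] g227 g228 g25.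
  have hb2 := good_bounded hg2.
  cb.
  eapply (w_if (N := 6)); [by vm_compute|by []| |]; ev; rewrite g227 g228 g25.
  + rewrite muln_eq0 negb_or !eqb0 !negbK !addn1 => /andP[hsm htm].
    rewrite hsm htm /=.
    pose Q2 (L' : seq nat) s' := let: State g o := s' in o = [::] /\
      [/\ good L' st j (State g [::]),
      [/\ g 21 = l, g 22 = p, g 23 = be & forall q, g 29 + g 30 * q = cell m l q],
      forall y, (g (34 + 3 * y) == st) = has (fun be' => tgt K NB uval l be' == y) (iota 0 be.+1),
      g 27 = s & g 28 = t].
    (* Serves both ends of the chord, with cells 27 and 28 exchanged. *)
    have hstep L' g3 (q q' x x' : nat) : Q2 L' (State g3 [::]) -> g3 q = x -> g3 q' = x' ->
       q \in [:: 27; 28] -> q' \in [:: 27; 28] -> x' < m -> (size L').+1 < 2 ^ b ->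
       runs (If (eq_e (rd q) (rd 22)) (p_push_cell q') Skip) (State g3 [::]) 3
          (Q2 (L' ++ if x == p then [:: cell m l x' %% n] else [::])).
      move=> [_ [hg3 [i21 i22 i23 i29] imk3 i27 i28]] hq hq' hqi hqi' hx' hsz.
      have hb3 := good_bounded hg3.
      have hcell : cell m l x' < m * m by exact: (cell_lt m_gt0 n_gt0 m2n hl hx').
      have [_ [[j0 _ _ _] _] _ _ _] := hg3.
      eapply (w_if (N := 2)).
      * by move: hqi; rewrite !inE => /orP[]/eqP ->; vm_compute.
      * by [].
      * ev; rewrite hq i22 muln_eq0 negb_or !eqb0 !negbK => /andP[h1 h2].
        have -> : (x == p) by rewrite eqn_leq h1 h2.
        rewrite cats1.
        have hlt : cell m l x' %% n < n by rewrite ltn_mod.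
        apply: (push_ok _ hg3 (x := cell m l x' %% n)) => //.
        -- by move: hqi'; rewrite !inE => /orP[]/eqP ->; vm_compute.
        -- by ev; rewrite hq' i29 j0 modn_sub.
        -- by lia.
        split=> //; split; rdm => //.
        -- by apply: good_push => //; lia.
        -- by move=> y'; rdm; exact: imk3.
      * ev; rewrite hq i22 => h1.
        have -> : (x == p) = false by apply/eqP => exp; move: h1; rewrite exp leqnn.
        eapply runs_leN; first apply: w_skip => //; first by rewrite cats0.
        by [].
    eapply runs_leN.
    eapply (runs_seq (Q1 := Q2 _)).
      apply: (hstep (L ++ C) g2 27 28 s t) => //; lia.
    move=> [g3 o3] hQ2; have ho3 : o3 = [::] by case: hQ2.
    subst o3; have [_ [hg3 i3 imk3 i27 i28]] := hQ2.
    eapply runs_le.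
    * apply: (hstep _ g3 28 27 t s hQ2) => //.
      by rewrite size_cat; case: ifP => /= _; lia.
    * by apply: leqnn.
    * by move=> [g4 o4] [-> [hg4 i4 imk4 _ _]]; split=> //; rewrite catA; split.
    by [].
  + move=> h1.
    have -> : (s < m) && (t < m) = false.
      by apply/negP => /andP[hsm htm]; move: h1; rewrite !addn1 hsm htm.
    eapply runs_leN; first apply: w_skip => //; first by rewrite cats0.
    by [].
  by [].
- move=> hge; have he : (g1 (34 + 3 * t) == st) by have := hst2 t; lia.
  rewrite he /= cats0.
  eapply runs_leN; first apply: w_skip => //.
    split=> //; split=> //.
    move=> y; rewrite -[RHS]/(has (fun be' => tgt K NB uval l be' == y) (iota 0 be.+1)) hhas -hmk; case: (eqVneq t y) => [<-|_]; last by rewrite orbF.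
    by rewrite he.
  by [].
by lia.
Qed.

Lemma p_line_ok L st j l p g :
  line_inv L st j l p 0 (upd g 23 0) -> bounded b g -> l < 2 * m -> p < m ->
  size L + 2 * NB < 2 ^ b -> st < 2 ^ b ->
  runs p_line (State g [::]) (NB * (3 * w + 18) + 2)
    (good (L ++ line_cands n K m NB uval l p) st j).
Proof.
move=> hI hb0 hl hp hL hst.
have [_ _ _ _ _ _ _ _ _ _ _ NBE _ _ _] := P.
eapply runs_leN.
sq; first by lia.
eapply runs_le.
- eapply (w_while (N := 3 * w + 17) (k := NB) (I := fun k s => let: State g o := s in
    o = [::] /\ exists be, [/\ line_inv (L ++ cands l p be) st j l p be g, be <= NB & k = NB - be])).
  + by vm_compute.
  + by split=> //; exists 0; rewrite cats0 subn0.
  + by move=> ? ? ? [_ [be [/line_bounded]]].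
  + cb; move=> k1 g1 o [-> [be [hI1 hbe ->]]].
    have [[_ [_ [_ h9 _ _ _]] _ _ _] [_ _ h23 _] _] := hI1.
    ev; rewrite h23 h9; case: leqP => //= hlt _.
    eapply runs_le; first by apply: p_block_ok hI1 hl hp _ hL hst; lia.
      by [].
    move=> [g2 o2] [-> hI2]; exists (NB - be.+1); first by lia.
    by split=> //; exists be.+1; split=> //; lia.
- by apply: leqnn.
- cb; move=> [g1 o] [[k1 _ [-> [be [hI1 hbe _]]]]].
  have [hg [_ _ h23 _] _] := hI1; have [_ [_ [_ h9 _ _ _]] _ _ _] := hg.
  ev; rewrite h23 h9; case: leqP => //= hlt _.
  have hE : be = NB by lia.
  by rewrite hE in hg; exact: hg.
by lia.
Qed.

Lemma p_run_ok L st j g :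
  good L st j (State g [::]) -> j < 4 -> st.+1 < 2 ^ b -> size L + 2 * NB < 2 ^ b ->
  runs p_run (State g [::]) (NB * (3 * w + 18) + 12)
    (good (L ++ run_cands n K m NB uval v j) st.+1 j.+1).
Proof.
move=> hgood hj hst hL.
have [_ _ m_gt0 m_ge m_min m2n _ _ _ _ _ _ _ _ _] := P.
have mn : m <= n by rewrite leqNgt; apply/negP => /m_min; nia.
have hb := good_bounded hgood.
have [_ [[h0 h3 h4 h5] _] [h12 h13 h20] _ _] := hgood.
have [hgood1 hmk1] := good_stamp hgood hst.
have hj2 : j %/ 2 < 2 by rewrite ltn_divLR.
have hc : run_cell n v j < 2 * n.
  by rewrite /run_cell; case: (j %/ 2) hj2 => [|[|?]] //= _; rewrite ?mul0n ?mul1n; lia.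
eapply runs_leN.
sq; first by lia.
sq; first by rewrite h20 h0 h3 -/(run_cell n v j); lia.
rdm; rewrite h13 addn1 h20 h0 h3 -/(run_cell n v j).
have hg1 : good L st.+1 j (State (upd (upd g 13 st.+1) 26 (run_cell n v j)) [::]).
  by apply: good_var => //; lia.
have hb1 := good_bounded hg1.
set c := run_cell n v j in hc hg1 hb1 *.
pose Q1 := good (L ++ run_cands n K m NB uval v j) st.+1 j.
apply: (runs_seq (Q1 := Q1) (N1 := NB * (3 * w + 18) + 9) (N2 := 1)); last first.
  move=> [g2 o2]; rewrite /Q1 => hg2; have [ho2 _ [_ _ i20] _ _] := hg2; subst o2.
  have hb2 := good_bounded hg2.
  s1; first by lia.
  have [_ hglob [i12 i13 _] i4 i5] := hg2.
  split; [by []|by apply: glob_upd => //; lia|by split; rdm => //; rewrite i20 addn1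
    |by move=> i hi; rdm; apply: i4|by move=> y; rdm].
have hg15 : upd (upd g 13 st.+1) 26 c 5 = m by rdm.
have hg126 : upd (upd g 13 st.+1) 26 c 26 = c by rdm.
have hg120 : upd (upd g 13 st.+1) 26 c 20 = j by rdm.
have hmk : forall y, upd (upd g 13 st.+1) 26 c (34 + 3 * y) < st.+1.
  by move=> y; have := hmk1 y; rdm.
move: (upd (upd g 13 st.+1) 26 c) hg1 hb1 hg15 hg126 hg120 hmk => g1 hg1 hb1 h15 h126 h120 hmk.
rewrite addnS.
eapply w_if; [by vm_compute|by []| |]; ev; rewrite h126 h15; case: leqP => //= hcm _;
  rewrite /Q1 /run_cands -/c; last first.
  have -> : (c < m * m) = false by lia.
  eapply runs_leN; first apply: w_skip => //; first by rewrite cats0.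
  by lia.
have {hcm}hcm : c < m * m by lia.
rewrite hcm.
have [hl hp hcell _] := run_cellP m_gt0 n_gt0 m2n j hcm.
have hlhalf : (run_line m c j < m) = ~~ odd j by case: (run_cellP m_gt0 n_gt0 m2n j hcm).
have hdm : c %/ m < m by rewrite ltn_divLR.
have hmm : c %% m < m by rewrite ltn_mod.
pose Q2 s := let: State g o := s in o = [::] /\ [/\ bounded b g,
  line_inv L st.+1 j (run_line m c j) (run_pos m c j) 0 (upd g 23 0) & True].
eapply runs_leN.
apply: (runs_seq (Q1 := Q2) (N1 := 5)); last first.
  move=> [g2 o2] [-> [hb2 hI2 _]].
  by apply: p_line_ok.
have hcms : c %/ m * m <= c by apply: leq_trunc_div.
eapply (w_if (N := 4)); [by vm_compute|by []| |]; ev; rewrite h120 modn_sub modn2.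
- case hodd: (odd j) => //= _.
  eapply runs_leN.
  sq; first by rewrite h126 h15 modn_sub; lia.
  sq; first by lia.
  sq; first by rewrite h126 h15 modn_sub; lia.
  s1; first by rewrite h126 h15; lia.
  split=> //; split=> //.
  rdm; rewrite h126 h15 modn_sub.
  rewrite /run_line /run_pos hodd.
  split.
  + by do 5 (apply: good_var => //; last by lia).
  + split; rdm => // q.
    by rewrite /cell; case: ifP => h; [lia|rewrite addKn mulnC addnC mulnC].
  + by move=> y; rdm; have := hmk y; rewrite /=; lia.
  by [].
- case hodd: (odd j) => //= _.
  eapply runs_leN.
  sq; first by rewrite h126 h15; lia.
  sq; first by rewrite h126 h15 modn_sub; lia.
  sq; first by rewrite h126 h15; lia.
  s1; first by lia.
  split=> //; split=> //.
  rdm; rewrite h126 h15 modn_sub.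
  rewrite /run_line /run_pos hodd.
  split.
  + by do 5 (apply: good_var => //; last by lia).
  + split; rdm => // q.
    by rewrite /cell hdm mul1n.
  + by move=> y; rdm; have := hmk y; rewrite /=; lia.
  by [].
by lia.
by lia.
Qed.

Lemma p_runs_ok L st g :
  good L st 0 (State g [::]) -> st + 4 < 2 ^ b -> size L + 8 * NB < 2 ^ b ->
  runs p_runs (State g [::]) (4 * (NB * (3 * w + 18) + 13) + 1)
    (good (L ++ hcands n K m NB uval v) (st + 4) 4).
Proof.
move=> hgood hst hL.
pose T j := L ++ flatten [seq run_cands n K m NB uval v j' | j' <- iota 0 j].
have hrun j : size (run_cands n K m NB uval v j) <= 2 * NB.
  by rewrite /run_cands; case: ifP => // _; apply: size_cands.
have hT j : j <= 4 -> size (T j) <= size L + 2 * j * NB.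
  rewrite /T size_cat leq_add2l => _; elim: j => // j IH.
  rewrite -[j.+1]addn1 iotaD map_cat flatten_cat size_cat add0n /= cats0.
  have := hrun j; lia.
eapply runs_le.
- eapply (w_while (N := NB * (3 * w + 18) + 12) (k := 4) (I := fun k s =>
    exists j, [/\ good (T j) (st + j) j s, j <= 4 & k = 4 - j])).
  + by vm_compute.
  + by exists 0; rewrite /T cats0 addn0.
  + by move=> ? ? ? [j [/good_bounded]].
  + move=> k1 g1 o [j [hg hj ->]].
    have [ho _ [_ _ h20] _ _] := hg; subst o.
    ev; rewrite h20; case: leqP => //= hlt _.
    have hTj := hT _ hj.
    eapply runs_le; first apply: p_run_ok hg _ _ _; try lia.
      have : j * NB <= 3 * NB by rewrite leq_mul2r; apply/orP; right; lia.
      by lia.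
    move=> [g2 o2] hg2; exists (4 - j.+1); first by lia.
    exists j.+1; split=> //; last by lia.
    by rewrite /T -[j.+1]addn1 iotaD map_cat flatten_cat /= cats0 add0n catA !addn1 addnS.
- by lia.
- move=> [g1 o] [[k1 _ [j [hg hj _]]]].
  have [ho _ [_ _ h20] _ _] := hg.
  ev; rewrite h20; case: leqP => //= hlt _.
  have hj4 : j = 4 by lia.
  by rewrite hj4 in hg.
Qed.

Lemma p_emit_ok L st j g :
  good L st j (State g [::]) -> st.+1 < 2 ^ b ->
  runs p_emit (State g [::]) (6 * size L + 4)
    (fun s => uniq (out s) /\ forall y, (y \in out s) = (y \in L) && (y != v)).
Proof.
move=> hgood hst.
have hb := good_bounded hgood.
have [_ [[h0 h3 _ _] _] [h12 h13 _] h4 h5] := hgood.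
eapply runs_leN.
sq; first by lia.
sq; first by rewrite h13; lia.
sq; first by lia.
rdm; rewrite h13 h3 addn1.
eapply runs_le.
- eapply (w_while (N := 5) (k := size L) (I := fun k s => let: State g o := s in
    exists i, [/\ bounded b g, i <= size L, k = size L - i & g 17 = i] /\
      [/\ g 12 = size L, g 13 = st.+1, forall i, i < size L -> g (32 + 3 * i) = nth 0 L i,
          forall y, g (34 + 3 * y) <= st.+1 &
          forall y, (g (34 + 3 * y) == st.+1) = (y == v) || (y \in take i L)] /\
      [/\ uniq o & forall y, (y \in o) = (y \in take i L) && (y != v)])).
  + by vm_compute.
  + exists 0; split; [|split]; split; rdm; rewrite ?subn0 ?take0 //.
    * by do 3! (apply: bounded_upd; last by lia).
    * by move=> i hi; rdm; apply: h4.
    * move=> y; case: (eqVneq y v) => [->|hy]; first by rdm.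
      by rdm; rewrite leqW.
    * move=> y; case: (eqVneq y v) => [->|hy]; first by rdm; rewrite eqxx.
      by rdm; have := h5 y; rewrite in_nil; lia.
  + by move=> ? ? ? [i [[]]].
  + cb; move=> k1 {hgood h12 h13 h0 h3 h4 h5 hb}g o [i [[hb hi -> h17] [[h12 h13 harr hle hmk] [hu hmem]]]].
    ev; rewrite h17 h12; case: leqP => //= hlt _.
    rewrite addn1 in hlt.
    set z := nth 0 L i.
    have hz : g (32 + 3 * i) = z by rewrite harr.
    have hzb : z < 2 ^ b by rewrite -hz.
    have ht : take i.+1 L = rcons (take i L) z by rewrite (take_nth 0).
    eapply runs_leN.
    sq; first by rewrite h17 hz.
    rewrite h17 hz.
    pose Q1 s := let: State g o := s in
      [/\ bounded b g, g 17 = i & g 12 = size L] /\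
      [/\ g 13 = st.+1, forall i, i < size L -> g (32 + 3 * i) = nth 0 L i,
          forall y, g (34 + 3 * y) <= st.+1 &
          forall y, (g (34 + 3 * y) == st.+1) = (y == v) || (y \in take i.+1 L)] /\
      [/\ uniq o & forall y, (y \in o) = (y \in take i.+1 L) && (y != v)].
    have hb1 : bounded b (upd g 18 z) by apply: bounded_upd.
    apply: (runs_seq (Q1 := Q1) (N1 := 3) (N2 := 1)); last first.
      cb; move=> [g2 o2] [[i1 i2 i3] [[i4 i5 i6 i7] [i8 i9]]].
      have hsz : size L < 2 ^ b by rewrite -i3.
      s1; first by lia.
      exists (size L - i.+1); first by lia.
      exists i.+1; split; [|split]; split; rdm => //; rewrite ?i2 ?addn1 //;
        first [by move=> i' hi'; rdm; apply: i5|by move=> y; rdm|by move=> y; rdm; apply: i7].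
    eapply (w_if (N := 2)); [by vm_compute|by []| |]; ev; rdm; rewrite h13 => hc.
    * have hc2 : (g (34 + 3 * z) == st.+1) = false by apply/eqP; lia.
      have := hmk z; rewrite hc2 => /esym /negbT; rewrite negb_or => /andP[hzv hzn].
      eapply runs_leN.
      sq; first by rewrite h13; lia.
      rdm; rewrite h13.
      apply: w_emit; [by vm_compute|by do 2! (apply: bounded_upd; last by lia)|ev; rdm].
      split; [|split]; split; rdm => //;
        try first [by do 2! (apply: bounded_upd; last by lia)|by move=> i' hi'; rdm; apply: harr
                  |by move=> y; case: (eqVneq y z) => [->|hy]; rdm].
      -- move=> y; rewrite ht mem_rcons inE.
         case: (eqVneq y z) => [->|hy]; first by rdm; rewrite eqxx orbT.
         by rdm; rewrite hmk.
      -- by rewrite rcons_uniq hu hmem (negbTE hzn).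
      -- move=> y; rewrite mem_rcons inE ht mem_rcons inE hmem.
         by case: (eqVneq y z) => [->|].
      by [].
    * have hc2 : (g (34 + 3 * z) == st.+1) by have := hle z; lia.
      have := hmk z; rewrite hc2 => /esym hzv.
      eapply runs_leN; first apply: w_skip => //.
        split; [|split]; split; rdm => //;
          try first [by move=> i' hi'; rdm; apply: harr|by move=> y; rdm; apply: hle].
        -- move=> y; rdm; rewrite ht mem_rcons inE hmk.
           by case: (eqVneq y z) => [->|] //=; rewrite orbT hzv.
        -- move=> y; rewrite ht mem_rcons inE hmem.
           case: (eqVneq y z) => [->|] //=.
           by move: hzv; case: (z == v); case: (z \in _).
      by [].
    by [].
- by apply: leqnn.
- cb; move=> [g1 o] [[k1 _ [i [[hb1 hi _ h17] [[h12' h13' _ _ _] [hu hmem]]]]]].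
  ev; rewrite h17 h12'; case: leqP => //= hlt _.
  have hE : i = size L by lia.
  by rewrite hE take_size in hmem; split.
by lia.
Qed.

(** The term [2 * m] comes from the linear search for the square root of n, which is affordable
    because m itself has order sqrt n. *)
Definition filter_budget : nat :=
  (40 + 2 * kap + 2 * m + 3 * mu + 3 * w) + ((1 + 3 * d) + ((14 + minn n M * (9 * d + 5)) +
  ((14 + minn n M * (9 * d + 5)) + ((4 * (NB * (3 * w + 18) + 13) + 1) +
  (6 * (d + 2 + 8 * NB) + 4))))).

Lemma size_hcands : size (hcands n K m NB uval v) <= 8 * NB.
Proof.
have h j : size (run_cands n K m NB uval v j) <= 2 * NB.
  by rewrite /run_cands; case: ifP => // _; apply: size_cands.
rewrite /hcands /= !size_cat /= addn0.
by move: (h 0) (h 1) (h 2) (h 3); lia.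
Qed.

Lemma filter_program_ok :
  runs filter_program (State (nth 0 [:: n; d; k; v]) [::]) filter_budget (fun s =>
    uniq (out s) /\ forall y, (y \in out s) =
      [|| y \in nb v, linked v && (y == v.+1 %% n),
          linked ((v + (n - 1)) %% n) && (y == (v + (n - 1)) %% n) |
          y \in hcands n K m NB uval v] && (y != v)).
Proof.
have hNB : NB <= n.+1.
  have [_ _ m_gt0 m_ge m_min m2n _ _ _ _ _ NBE _ _ _] := P.
  have mn : m <= n by rewrite leqNgt; apply/negP => /m_min; nia.
  by rewrite NBE addn1 ltnS (leq_trans (leq_div _ _)).
have hszn := nb_size v_lt.
eapply runs_seq; first exact: p_setup_ok.
move=> [g o] [-> hg h0].
eapply runs_seq.
  apply: p_cand_nbrs_ok; split=> //; first by split; apply: h0.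
  by move=> y; rewrite h0.
move=> {h0 hg}[g1 o1] hg1.
have [ho _ _ _ _] := hg1; subst o1.
eapply runs_seq; first by apply: p_link_next_ok hg1 _ _; lia.
set L1 := if linked v then _ else _.
have hL1 : size L1 <= d + 1 by rewrite /L1; case: ifP; rewrite ?size_rcons; lia.
have hm1 y : (y \in L1) = (y \in nb v) || linked v && (y == v.+1 %% n).
  by rewrite /L1; case: ifP; rewrite ?mem_rcons ?inE ?orbF // orbC.
move=> {hg1}[g2 o2] hg2.
have [ho _ _ _ _] := hg2; subst o2.
move: L1 hL1 hm1 hg2 => L1 hL1 hm1 hg2.
eapply runs_seq; first by apply: p_link_prev_ok hg2 _ _; lia.
set L2 := if _ then _ else _.
have hL2 : size L2 <= d + 2 by rewrite /L2; case: ifP; rewrite ?size_rcons; lia.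
have hm2 y : (y \in L2) = (y \in L1) ||
  linked ((v + (n - 1)) %% n) && (y == (v + (n - 1)) %% n).
  by rewrite /L2; case: ifP; rewrite ?mem_rcons ?inE ?orbF // orbC.
move=> {hg2}[g3 o3] hg3.
have [ho _ _ _ _] := hg3; subst o3.
move: L2 hL2 hm2 hg3 => L2 hL2 hm2 hg3.
eapply runs_seq; first by apply: p_runs_ok hg3 _ _; lia.
move=> {hg3}[g4 o4] hg4.
have [ho _ _ _ _] := hg4; subst o4.
have hsz := size_hcands.
eapply runs_le; first by apply: p_emit_ok hg4 _; lia.
  by rewrite size_cat; lia.
move=> s [hu hmem]; split=> // y.
by rewrite hmem mem_cat hm2 hm1 -!orbA.
Qed.

End Verify.

End FilterProgram.

(** * Cuts and reachability *)

(** Counting by encoding. A relation between codes and objects, in which each object has a code and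
    a code fits at most one object of A, is easier to supply than an injection. *)
Lemma card_code (T C : finType) (A : {set T}) (D : {set C}) (rho : C -> T -> Prop) :
  (forall y, y \in A -> exists2 c, c \in D & rho c y) ->
  (forall c y y', y \in A -> y' \in A -> rho c y -> rho c y' -> y = y') ->
  #|A| <= #|D|.
Proof.
move=> hex hfun.
have [->|[y0 y0A]] := set_0Vmem A; first by rewrite cards0.
have [c0 _ _] := hex _ y0A.
pose f y := odflt c0 [pick c in D | `[< rho c y >]].
have fP y : y \in A -> f y \in D /\ rho (f y) y.
  move=> /hex[c cD hc]; rewrite /f; case: pickP => [c' /andP[? /asboolP ?] //|].
  by move=> /(_ c); rewrite /= cD; move/asboolP.
rewrite -(card_in_imset (f := f) (D := ssrbool.mem A)); last first.
  move=> y y' yA yA' e; have [_ h1] := fP y yA; have [_ h2] := fP y' yA'.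
  by rewrite -e in h2; apply: hfun h1 h2.
by apply: subset_leq_card; apply/fintype.subsetP => c /imsetP[y yA ->]; case: (fP y yA).
Qed.

Section Cuts.
Variable V : finType.
Implicit Types (e : rel V) (G : sgraph V) (S : {set V}).

Definition cut e S : {set V * V} := [set p | [&& p.1 \in S, p.2 \notin S & e p.1 p.2]].

(** The end in S orients each boundary edge, so unordered edges and ordered pairs are equally
    many. *)
Lemma card_edges_between G S : #|edges_between G S (~: S)| = #|cut G S|.
Proof.
have -> : edges_between G S (~: S) = [set [set p.1; p.2] | p in cut G S].
  apply/setP => f; apply/imsetP/imsetP => -[p hp ->]; exists p => //; move: hp.
    by rewrite !inE /= -andbA.
  by rewrite !inE /= -andbA.
rewrite card_in_imset // => -[x y] [x' y']; rewrite !inE /= => /and3P[xS yS _] /and3P[xS' yS' _] h.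
have hx : x \in [set x'; y'] by rewrite -h !inE eqxx.
have hy : y \in [set x'; y'] by rewrite -h !inE eqxx orbT.
have ex : x = x'.
  by move: hx; rewrite !inE => /orP[/eqP //|/eqP e]; rewrite e (negbTE yS') in xS.
have ey : y = y'.
  by move: hy; rewrite !inE => /orP[/eqP e|/eqP //]; rewrite e xS' in yS.
by rewrite ex ey.
Qed.

Lemma outer_boundary e S :
  #|[set y | (y \notin S) && [exists x in S, e x y]]| <= #|cut e S|.
Proof.
apply: (@card_code _ _ _ _ (fun p y => p.2 = y)).
  move=> y; rewrite inE => /andP[yS /exists_inP[x xS h]].
  by exists (x, y); rewrite // inE xS yS.
by move=> p y y' _ _ <- <-.
Qed.

Lemma inner_boundary e S :
  #|[set x in S | [exists y, (y \notin S) && e x y]]| <= #|cut e S|.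
Proof.
apply: (@card_code _ _ _ _ (fun p y => p.1 = y)).
  move=> x; rewrite inE => /andP[xS /existsP[y /andP[yS h]]].
  by exists (x, y); rewrite // inE xS yS.
by move=> p y y' _ _ <- <-.
Qed.

Lemma sum_fibres (A B : {set V}) (f : V -> V) :
  \sum_(x in A) #|[set y in B | f y == x]| <= #|B|.
Proof.
apply: leq_trans (_ : #|[set y in B | f y \in A]| <= _); last first.
  by apply: subset_leq_card; apply/fintype.subsetP => y; rewrite inE => /andP[].
rewrite -sum1_card [X in _ <= X](partition_big f (fun x => x \in A)) /=; last by move=> y; rewrite inE => /andP[].
apply: leq_sum => x xA; rewrite -sum1_card; apply: eq_leq; apply: eq_bigl => y.
by rewrite !inE; case: eqP => [->|]; rewrite ?xA ?andbT ?andbF.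
Qed.

Definition reach e (O R : {set V}) : {set V} :=
  [set y | [exists x in R, connect [rel a c | [&& e a c, a \notin O & c \notin O]] x y]].

(* A set S with few boundary edges is the part reachable, off its outer boundary
   O, from the inner boundary together with one vertex of each component of S
   that has no boundary; such components have at least M vertices. *)
Lemma reach_encoding e S M :
  symmetric e -> 0 < M -> S != set0 ->
  (forall C : {set V}, C != set0 -> C \subset S -> cut e C = set0 -> M <= #|C|) ->
  exists O R : {set V}, [/\ #|O| <= #|cut e S|, #|R| <= #|cut e S| + #|S| %/ M,
    0 < #|R| & S = reach e O R].
Proof.
move=> esym M0 S0 hM.
pose O := [set y | (y \notin S) && [exists x in S, e x y]].
pose B := [set x in S | [exists y, (y \notin S) && e x y]].
pose eO := [rel a c | [&& e a c, a \notin O & c \notin O]].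
have eOsym : connect_sym eO.
  by apply: sym_connect_sym => a c /=; rewrite esym; case: (e c a) => //=; rewrite andbC.
have SO x : x \in S -> x \notin O by move=> xS; rewrite inE xS.
(* A step out of S would enter the outer boundary O, where [eO] has no edges. *)
have stepS x y : x \in S -> eO x y -> y \in S.
  move=> xS /and3P[h _]; rewrite inE negb_and negbK => /orP[//|/exists_inP[]].
  by exists x.
have connS x y : x \in S -> connect eO x y -> y \in S.
  move=> xS /connectP[p hp ->]; elim: p x xS hp => //= z p IH x xS /andP[h1 h2].
  by apply: IH h2; apply: stepS h1.
(* One root for each [eO]-class of S that contains no inner boundary vertex. *)
pose R2 := [set x in S | (fingraph.root eO x == x) && [forall y in B, ~~ connect eO x y]].
pose cls x := [set y in S | fingraph.root eO y == x].
have hcls x : x \in R2 -> M <= #|cls x|.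
  rewrite inE => /andP[xS /andP[/eqP hr /forall_inP hB]].
  have clsE y : y \in cls x -> y \in S /\ connect eO x y.
    rewrite inE => /andP[yS /eqP hy]; split=> //.
    by rewrite -hy eOsym; apply: connect_root.
  apply: hM.
  - by apply/set0Pn; exists x; rewrite inE xS hr eqxx.
  - by apply/fintype.subsetP => y /clsE[].
  (* No edge of [e] leaves such a class: an end z in S would lie in the same class, and an end z
     outside S would make y an inner boundary vertex. *)
  - apply/setP => -[y z]; rewrite [RHS]inE; apply/negP; rewrite inE /= => /and3P[hy hz hyz].
    have [yS xy] := clsE _ hy.
    case: (boolP (z \in S)) => zS.
      case/negP: hz; rewrite inE zS /=; move: hy; rewrite inE => /andP[_ /eqP <-].
      apply/eqP/(fingraph.rootP eOsym); rewrite eOsym; apply: connect1.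
      by rewrite /= hyz !SO.
    have yB : y \in B by rewrite inE yS; apply/existsP; exists z; rewrite zS.
    by have := hB _ yB; rewrite xy.
exists O, (B :|: R2); split.
- exact: outer_boundary.
- apply: leq_trans (_ : #|B| + #|R2| <= _); first by rewrite cardsU leq_subr.
  apply: leq_add; first exact: inner_boundary.
  (* The classes are disjoint subsets of S with at least M elements each. *)
  rewrite leq_divRL //; apply: leq_trans (sum_fibres R2 S (fingraph.root eO)).
  by rewrite -sum_nat_const; apply: leq_sum => x /hcls.
- have [x xS] := set0Pn _ S0.
  rewrite card_gt0; apply/set0Pn.
  case: (boolP [exists y in B, connect eO (fingraph.root eO x) y]) => [/exists_inP[y yB _]|].
    by exists y; rewrite inE yB.
  rewrite negb_exists_in => h; exists (fingraph.root eO x); rewrite inE; apply/orP; right.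
  by rewrite inE h (root_root eOsym) eqxx (connS _ _ xS (connect_root eO x)).
- apply/setP => y; rewrite [RHS]inE; apply/idP/exists_inP.
    move=> yS.
    case: (boolP [exists z in B, connect eO y z]) => [/exists_inP[z zB yz]|].
      by exists z; [rewrite inE zB|rewrite -[connect _ _ _]/(connect eO z y) eOsym].
    rewrite negb_exists_in => /forall_inP h; exists (fingraph.root eO y); last first.
      by rewrite -[connect _ _ _]/(connect eO (fingraph.root eO y) y) eOsym connect_root.
    rewrite inE; apply/orP; right.
    rewrite inE (root_root eOsym) eqxx (connS _ _ yS (connect_root eO y)) /=.
    apply/forall_inP => z zB; apply/negP => hz; case/negP: (h z zB).
    exact: connect_trans (connect_root eO y) hz.
  case=> x; rewrite inE => /orP[]; rewrite inE => /andP[xS _] hxy; exact: connS xS hxy.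
Qed.

End Cuts.

(** * The filtered graph *)

(** The codes are lists of length j in which [None] serves as padding. *)
Lemma card_small_sets (V : finType) j :
  #|[set O : {set V} | #|O| <= j]| <= (#|V|.+1) ^ j.
Proof.
have -> : (#|V|.+1) ^ j = #|[set: j.-tuple (option V)]|.
  by rewrite cardsT card_tuple card_option.
apply: (@card_code _ _ _ _ (fun t O => O = [set x | Some x \in tval t])); last first.
  by move=> t O O' _ _ -> ->.
move=> O; rewrite inE => hO.
exists [tuple nth None (map Some (enum O)) i | i < j]; first by rewrite inE.
apply/setP => x; rewrite inE; apply/idP/tnthP.
  move=> xO; have xe : x \in enum O by rewrite mem_enum.
  have hi : index x (enum O) < j.
    by apply: leq_trans hO; rewrite cardE index_mem.
  exists (Ordinal hi); rewrite tnth_mktuple /= (nth_map x) ?index_mem //.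
  by rewrite nth_index.
case=> i; rewrite tnth_mktuple => h.
case: (ltnP i (size (enum O))) => hi; last by rewrite nth_default ?size_map in h.
by move: h; rewrite (nth_map x) // => -[->]; rewrite -mem_enum mem_nth.
Qed.

Lemma card_reach_family (V : finType) (e : rel V) j1 j2 :
  #|[set S | [exists O : {set V}, exists R : {set V},
      [&& #|O| <= j1, #|R| <= j2 & S == reach e O R]]]| <= (#|V|.+1) ^ (j1 + j2).
Proof.
rewrite expnD.
apply: leq_trans (leq_mul (card_small_sets V j1) (card_small_sets V j2)).
rewrite -cardsX.
apply: (@card_code _ _ _ _ (fun p S => S = reach e p.1 p.2)); last first.
  by move=> p S S' _ _ -> ->.
move=> S; rewrite inE => /existsP[O /existsP[R /and3P[hO hR /eqP ->]]].
by exists (O, R); rewrite // !inE hO hR.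
Qed.

Section FilterGraph.
Variables (n : nat) (G : sgraph 'I_n) (K m NB : nat) (u : nat -> nat) (M : nat) (allf : bool).

Definition comp (x : 'I_n) : {set 'I_n} := [set y | connect G x y].

(* Without allf, only the largest vertex of a small component is linked; this
   still connects the graph. *)
Definition link (x : 'I_n) : bool :=
  (#|comp x| < M) && (allf || [forall y in comp x, y <= x]).

(** The part of the filtered graph that is fixed before any chord is drawn. The union bound uses
    boundaries in this relation, so its family of sets does not depend on the seed. *)
Definition pre_adj (x y : 'I_n) : bool :=
  [|| G x y, link x && (y == ordS x) | link y && (x == ordS y)].

Definition line_adj (x y : 'I_n) : bool := hedge n K m NB u x y || hedge n K m NB u y x.

Definition filter_adj (x y : 'I_n) : bool := (x != y) && (pre_adj x y || line_adj x y).

Lemma pre_adj_sym : symmetric pre_adj.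
Proof. by move=> x y; rewrite /pre_adj adj_sym [_ && _ || _]orbC. Qed.

Lemma filter_adj_sym : symmetric filter_adj.
Proof.
move=> x y; rewrite /filter_adj eq_sym pre_adj_sym /line_adj.
by rewrite [hedge _ _ _ _ _ x y || _]orbC.
Qed.

Lemma filter_adj_irrefl : irreflexive filter_adj.
Proof. by move=> x; rewrite /filter_adj eqxx. Qed.

Definition filter_graph : sgraph 'I_n := SGraph filter_adj_sym filter_adj_irrefl.

Lemma comp_sym : connect_sym G.
Proof. exact: sym_connect_sym (adj_sym G). Qed.

Lemma mem_comp x : x \in comp x. Proof. by rewrite inE connect0. Qed.

Lemma comp_eq x y : y \in comp x -> comp y = comp x.
Proof.
rewrite inE => h; apply/setP => z; rewrite !inE.
by rewrite (same_connect comp_sym h).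
Qed.

Lemma comp_closed x y z : y \in comp x -> G y z -> z \in comp x.
Proof. by rewrite !inE => h1 h2; apply: connect_trans h1 (connect1 h2). Qed.

Lemma comp_sub (S : {set 'I_n}) x :
  (forall y z, y \in S -> G y z -> z \in S) -> x \in S -> comp x \subset S.
Proof.
move=> hS xS; apply/fintype.subsetP => y; rewrite inE => /connectP[p hp ->].
by elim: p x xS hp => //= z p IH x xS /andP[h1 h2]; apply: IH h2; apply: hS h1.
Qed.

Hypothesis K_gt0 : 0 < K.
Hypothesis m_gt0 : 0 < m.
Hypothesis m2n : m * m <= 2 * n.

(** Four lines and two roles. On a given line, x is selected by at most one block, since the
    position determines the block, and is the target of at most one accepted block, by [fresh]. *)
Lemma card_line_nbhd x : #|[set y | line_adj x y]| <= 8.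
Proof.
have n0 : 0 < n by case: n x => [[]|].
have -> : 8 = #|[set: 'I_4 * bool]| by rewrite cardsT card_prod card_ord card_bool.
pose l (j : 'I_4) := run_line m (run_cell n x j) j.
pose p (j : 'I_4) := run_pos m (run_cell n x j) j.
apply: (@card_code _ _ _ _ (fun c y => exists be, accepted K m NB u (l c.1) be /\
   if c.2 then sel K NB u (l c.1) be = p c.1 /\ val y = cell m (l c.1) (tgt K NB u (l c.1) be) %% n
   else tgt K NB u (l c.1) be = p c.1 /\ val y = cell m (l c.1) (sel K NB u (l c.1) be) %% n)).
  move=> y; rewrite inE /line_adj -(hcandsP K NB u m_gt0 n0 m2n _ (ltn_ord x)).
  case/flatten_mapP => j; rewrite mem_iota /= add0n => hj; rewrite /run_cands.
  case: ifP => // hc /line_candsP[be hbe [ha h]].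
  case: h => -[h1 h2].
    by exists (Ordinal hj, true); rewrite ?inE //; exists be.
  by exists (Ordinal hj, false); rewrite ?inE //; exists be.
move=> [j []] y y' _ _ /= [be [ha [h1 h2]]] [be' [ha' [h1' h2']]]; apply: val_inj; rewrite /= h2 h2'.
  have hb be0 : sel K NB u (l j) be0 %/ K = be0.
    by rewrite /sel divnMDl // divn_small ?addn0 // ltn_mod.
  by rewrite -(hb be) -(hb be') h1 h1'.
suff -> : be = be' by [].
wlog hlt : be be' ha h1 ha' h1' {h2 h2'} / be < be'.
  by move=> H; case: (ltngtP be be') => // h; [apply: H|apply/esym; apply: H].
case/and3P: ha' => /allP /(_ be); rewrite mem_iota /= add0n => /(_ hlt).
by rewrite h1 h1' eqxx.
Qed.

Lemma filter_max_degree : max_degree filter_graph <= max_degree G + 10.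
Proof.
apply/bigmax_leqP => x _.
have hG : #|nbhd G x| <= max_degree G by apply: leq_bigmax.
apply: leq_trans (_ : #|nbhd G x| + (#|[set ordS x; ord_pred x]| + #|[set y | line_adj x y]|) <= _).
  apply: leq_trans (_ : #|nbhd G x :|: ([set ordS x; ord_pred x] :|: [set y | line_adj x y])| <= _).
    apply: subset_leq_card; apply/fintype.subsetP => y; rewrite !inE /= /filter_adj /pre_adj.
    case/andP => _ /orP[/or3P[-> //|/andP[_ ->]|/andP[_ /eqP ->]]|->]; rewrite ?orbT //.
    by rewrite ordSK eqxx !orbT.
  apply: leq_trans (_ : _ <= #|nbhd G x| + #|[set ordS x; ord_pred x] :|: [set y | line_adj x y]|) _.
    by rewrite cardsU leq_subr.
  by rewrite leq_add2l cardsU leq_subr.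
have h2 : #|[set ordS x; ord_pred x]| <= 2 by rewrite cards2; case: eqP.
by have := card_line_nbhd x; lia.
Qed.

Lemma filter_edge_diff :
  #|edge_diff G filter_graph| <= #|[set x | link x]| + 2 * m * NB.
Proof.
pose A := [set [set x; ordS x] | x in [set x | link x]].
pose f (q : 'I_(2 * m) * 'I_NB) :=
  [set x : 'I_n | val x == cell m q.1 (sel K NB u q.1 q.2) %% n] :|:
  [set x : 'I_n | val x == cell m q.1 (tgt K NB u q.1 q.2) %% n].
pose B := [set f q | q in [set: 'I_(2 * m) * 'I_NB]].
have hB : #|B| <= 2 * m * NB.
  by apply: leq_trans (leq_imset_card _ _) _; rewrite cardsT card_prod !card_ord.
apply: leq_trans (_ : #|A| + #|B| <= _); last by rewrite leq_add // leq_imset_card.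
apply: leq_trans (_ : #|A :|: B| <= _); last by rewrite cardsU leq_subr.
have hmem (H : sgraph 'I_n) g : (g \in edges H) -> exists x y, H x y /\ g = [set x; y].
  by case/imsetP => -[x y]; rewrite !inE /= => h ->; exists x, y.
have hmem2 (H : sgraph 'I_n) x y : H x y -> [set x; y] \in edges H.
  by move=> h; apply/imsetP; exists (x, y); rewrite ?inE.
have hsing (x : 'I_n) w : val x = w -> [set z : 'I_n | val z == w] = [set x].
  by move=> <-; apply/setP => z; rewrite !inE.
apply: subset_leq_card; apply/fintype.subsetP => g; rewrite in_setU !in_setD.
case/orP => /andP[h1].
  case/hmem => x [y [h2 e]]; case/negP: h1; rewrite e; apply: hmem2.
  rewrite /= /filter_adj /pre_adj h2 /= andbT; apply/eqP => exy.
  by rewrite exy adj_irrefl in h2.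
case/hmem => x [y [/andP[_ h2] e]].
have hl x' y' : hedge n K m NB u (val x') (val y') -> [set x'; y'] \in B.
  case/hedgeP => l [be [hl hbe ha hx hy]]; apply/imsetP; exists (Ordinal hl, Ordinal hbe) => //.
  by rewrite /f /= (hsing x') // (hsing y').
rewrite in_setU; case/orP: h2 => [/or3P[h2|/andP[h2 /eqP h3]|/andP[h2 /eqP h3]]|/orP[h2|h2]].
- by case/negP: h1; rewrite e; apply: hmem2.
- by apply/orP; left; apply/imsetP; exists x; rewrite ?inE // e h3.
- by apply/orP; left; apply/imsetP; exists y; rewrite ?inE // e h3 finset.setUC.
- by rewrite e hl ?orbT.
- by rewrite e finset.setUC hl ?orbT.
Qed.

(* An accepted proposal from S to its complement is determined by the edge that
   it creates, its direction and the cell of its source. *)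
Lemma crossing_le_cut (S : {set 'I_n}) :
  #|[set q : 'I_(2 * m) * 'I_NB | accepted K m NB u q.1 q.2 &&
     [exists x in S, exists y in ~: S, (val x == cell m q.1 (sel K NB u q.1 q.2) %% n) &&
       (val y == cell m q.1 (tgt K NB u q.1 q.2) %% n)]]| <= 4 * #|cut filter_graph S|.
Proof.
have -> : 4 * #|cut filter_graph S| = #|setX (cut filter_graph S) [set: bool * bool]|.
  by rewrite cardsX cardsT card_prod card_bool mulnC.
apply: (@card_code _ _ _ _ (fun (c : ('I_n * 'I_n) * (bool * bool)) (q : 'I_(2 * m) * 'I_NB) =>
  [/\ accepted K m NB u q.1 q.2,
    val c.1.1 = cell m q.1 (sel K NB u q.1 q.2) %% n,
    c.2.1 = (q.1 < m) & c.2.2 = (cell m q.1 (sel K NB u q.1 q.2) < n)])).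
  move=> q; rewrite inE => /andP[ha /existsP[x /andP[xS /existsP[y /andP[yS /andP[/eqP hx /eqP hy]]]]]].
  exists ((x, y), ((q.1 : nat) < m, cell m q.1 (sel K NB u q.1 q.2) < n)) => //.
  rewrite !inE /= xS; move: yS; rewrite inE => yS; rewrite yS /= andbT /filter_adj /line_adj.
  apply/andP; split; first by apply: contra yS => /eqP <-.
  apply/orP; right; apply/orP; left; apply/hedgeP.
  by exists q.1, q.2; split.
move=> [[x y] [c1 c2]] [l be] [l' be'] _ _ /= [ha hx -> ->] [ha' hx' hl hc].
have n0 : 0 < n by case: n x {hx hx'} => [[]|].
case/and3P: ha => _ hs _; case/and3P: ha' => _ hs' _.
have c_lt := cell_lt m_gt0 n0 m2n (ltn_ord l) hs.
have c_lt' := cell_lt m_gt0 n0 m2n (ltn_ord l') hs'.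
(* The vertex together with the bit telling whether the cell is below n gives back the cell, as
   there are at most 2 n cells. *)
have ec : cell m l (sel K NB u l be) = cell m l' (sel K NB u l' be').
  rewrite (divn_eq (cell m l _) n) (divn_eq (cell m l' _) n) -hx -hx'; congr (_ * _ + _).
  have q1 : cell m l (sel K NB u l be) %/ n < 2 by rewrite ltn_divLR //; lia.
  have q2 : cell m l' (sel K NB u l' be') %/ n < 2 by rewrite ltn_divLR //; lia.
  have e1 : (cell m l (sel K NB u l be) %/ n == 0) = (cell m l (sel K NB u l be) < n).
    by rewrite -leqn0 -ltnS ltn_divLR // mul1n.
  have e2 : (cell m l' (sel K NB u l' be') %/ n == 0) = (cell m l' (sel K NB u l' be') < n).
    by rewrite -leqn0 -ltnS ltn_divLR // mul1n.
  move: e1 e2; rewrite hc; lia.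
(* The cell and the direction of the line give back the line and the position, and the position
   gives back the block. *)
pose j : nat := ~~ (l < m).
have hj : (l < m) = ~~ odd j by rewrite /j; case: (l < m).
have hj' : (l' < m) = ~~ odd j by rewrite -hl.
have [r1 r2] := run_cell_uniq m_gt0 n0 m2n (ltn_ord l) hs hj.
have [r1' r2'] := run_cell_uniq m_gt0 n0 m2n (ltn_ord l') hs' hj'.
have el : val l = val l' by rewrite /= -r1 -r1' ec.
have es : sel K NB u l be = sel K NB u l' be' by rewrite -r2 -r2' ec.
have hb l0 be0 : sel K NB u l0 be0 %/ K = be0.
  by rewrite /sel divnMDl // divn_small ?addn0 // ltn_mod.
have eb : val be = val be' by rewrite /= -(hb l be) -(hb l' be') es.
by congr (_, _); apply: val_inj.
Qed.

End FilterGraph.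

(** * Links: closed sets, connectedness, number of links *)

Section LinkedSets.
Variables (n : nat) (G : sgraph 'I_n) (K m NB : nat) (u : nat -> nat) (M : nat).

Lemma iter_ordS k (x : 'I_n) : val (iter k (@ordS n) x) = (x + k) %% n.
Proof.
elim: k => [|k IH]; first by rewrite addn0 modn_small.
by rewrite iterS /= IH -[in RHS]addn1 addnA -addn1 modnDml.
Qed.

Lemma ordS_closed (C : {set 'I_n}) :
  C != set0 -> (forall x, x \in C -> ordS x \in C) -> C = [set: 'I_n].
Proof.
case/set0Pn => x xC hC; apply/setP => y; rewrite inE.
have -> : y = iter (y + (n - x)) (@ordS n) x.
  apply: val_inj; rewrite iter_ordS addnCA subnKC; last by apply: ltnW.
  by rewrite modnDr modn_small.
by elim: (y + (n - x)) => //= k IH; apply: hC.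
Qed.

(** If all components inside C were smaller than M, every vertex of C would be linked to its
    successor, and C would be closed under the cyclic shift, hence everything. *)
Lemma closed_large (C : {set 'I_n}) :
  C != set0 -> C != setT -> cut (pre_adj G M true) C = set0 -> M <= #|C|.
Proof.
move=> C0 CT hcut.
have hcl x y : x \in C -> pre_adj G M true x y -> y \in C.
  move=> xC h; apply/negPn/negP => yC.
  by move/setP: hcut => /(_ (x, y)); rewrite !inE /= xC yC h.
have hG x y : x \in C -> G x y -> y \in C.
  by move=> xC h; apply: hcl xC _; rewrite /pre_adj h.
case: (boolP [exists x in C, M <= #|comp G x|]) => [/exists_inP[x xC hx]|].
  by apply: leq_trans hx _; apply: subset_leq_card; apply: comp_sub.
rewrite negb_exists_in => /forall_inP h; case/negP: CT; apply/eqP; apply: ordS_closed => // x xC.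
by apply: (hcl _ _ xC); rewrite /pre_adj /link ltnNge (h _ xC) eqxx /= orbT.
Qed.

(** Take whichever of S and its complement misses the vertex n - 1. If it had no boundary, its
    largest vertex x would be the largest of its component, hence linked to x + 1, which lies
    outside. *)
Lemma filter_connected (S : {set 'I_n}) : n < M ->
  S != set0 -> S != setT -> 0 < #|cut (filter_graph G K m NB u M false) S|.
Proof.
move=> hM.
pose H := filter_graph G K m NB u M false.
have key (T : {set 'I_n}) (z : 'I_n) : val z = n.-1 -> z \notin T -> T != set0 -> cut H T != set0.
  move=> hz zT /set0Pn[x0 x0T]; apply/negP => /eqP hcut.
  have hcl x y : x \in T -> H x y -> y \in T.
    move=> xT h; apply/negPn/negP => yT.
    by move/setP: hcut => /(_ (x, y)); rewrite !inE /= xT yT /=; rewrite /= in h; rewrite h.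
  have [x xT hx] := arg_maxnP val x0T.
  have hG a c : a \in T -> G a c -> c \in T.
    move=> aT h; apply: hcl aT _; rewrite /= /filter_adj /pre_adj h /= andbT.
    by apply/eqP => e; rewrite e adj_irrefl in h.
  have hsub := comp_sub hG xT.
  have hxz : x < n.-1.
    rewrite ltn_neqAle -ltnS prednK ?ltn_ord ?andbT; last by case: n x {hx xT hsub x0 x0T hcl hcut hz zT hG} => [[]|].
    by apply: contra zT => /eqP e; have -> : z = x by apply: val_inj; rewrite hz -e.
  have hS : nat_of_ord (ordS x) = x.+1 by rewrite /= modn_small //; lia.
  have : ordS x \in T.
    apply: hcl xT _; rewrite /= /filter_adj /pre_adj.
    have -> /= : link G M false x.
      rewrite /link /=; apply/andP; split.
        by apply: leq_ltn_trans hM; rewrite -[X in _ <= X](card_ord n) max_card.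
      by apply/forall_inP => y /(fintype.subsetP hsub) /hx.
    rewrite eqxx !orbT /= andbT; apply/eqP => e.
    by have := congr1 (@nat_of_ord n) e; rewrite hS; lia.
  by move=> /hx h; have : nat_of_ord (ordS x) <= x := h; rewrite hS ltnn.
move=> S0 ST; rewrite card_gt0.
have [x0 x0S] := set0Pn _ S0.
have n0 : n.-1 < n by case: n x0 {x0S key H hM S S0 ST} => [[]|].
case: (boolP (Ordinal n0 \in S)) => hz; last by apply: key hz S0.
have : cut H (~: S) != set0.
  apply: (key _ (Ordinal n0)) => //; first by rewrite inE hz.
  by apply: contra ST => /eqP e; rewrite -[S]finset.setCK e finset.setC0.
case/set0Pn => -[x y]; rewrite !inE /= negbK => /and3P[h1 h2 h3].
apply/set0Pn; exists (y, x); rewrite !inE /= h2 h1 /=.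
by rewrite filter_adj_sym.
Qed.

Lemma card_linked_blocks (k c : nat) (P : {set {set 'I_n}}) (A : {set 'I_n}) :
  finset.partition P [set: 'I_n] -> #|P| <= k ->
  (forall T, T \in P -> #|[set x in A | pblock P x == T]| <= c) -> #|A| <= k * c.
Proof.
move=> /and3P[/eqP hcov htriv _] hk hc.
have -> : #|A| = \sum_(T in P) #|[set x in A | pblock P x == T]|.
  rewrite -sum1_card (partition_big (pblock P) (fun T => T \in P)) /=.
    by apply: eq_bigr => T _; rewrite -sum1_card; apply: eq_bigl => x; rewrite inE.
  by move=> x _; apply: pblock_mem; rewrite hcov inE.
apply: leq_trans (_ : \sum_(T in P) c <= _); first exact: leq_sum.
by rewrite sum_nat_const leq_mul2r hk orbT.
Qed.

Definition minority (P : {set {set 'I_n}}) : {set 'I_n} :=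
  [set x | 2 * #|comp G x :&: pblock P x| <= #|pblock P x|].

(** Outside the minority, a linked vertex lies in the component holding more than half of its
    cluster. With [allf], that component has fewer than M vertices, so the cluster has at most 2 M;
    otherwise only its largest vertex is linked. *)
Lemma card_link (allf : bool) (k : nat) (P : {set {set 'I_n}}) :
  finset.partition P [set: 'I_n] -> #|P| <= k ->
  #|[set x | link G M allf x]| <= #|minority P| + k * (if allf then 2 * M else 1).
Proof.
move=> hP hk.
apply: leq_trans (_ : #|minority P| + #|[set x | link G M allf x] :\: minority P| <= _).
  rewrite -(cardsID (minority P) [set x | link G M allf x]) leq_add2r.
  by apply: subset_leq_card; apply: subsetIr.
rewrite leq_add2l; apply: (card_linked_blocks hP hk) => T TP.
case: allf.
  have [->|[x]] := set_0Vmem [set x in [set x0 | link G M true x0] :\: minority P | pblock P x == T].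
    by rewrite cards0.
  rewrite !inE -ltnNge => /andP[/andP[h1 /andP[h2 _]] /eqP hT].
  apply: leq_trans (_ : #|T| <= _).
    apply: subset_leq_card; apply/fintype.subsetP => y; rewrite !inE => /andP[_ /eqP <-].
    by rewrite mem_pblock; case/and3P: hP => /eqP -> _ _; rewrite inE.
  rewrite hT in h1; have := subset_leq_card (subsetIl (comp G x) T); lia.
apply/card_le1_eqP => x y.
rewrite !inE -!ltnNge /= => /andP[/andP[h1 /andP[_ /forall_inP h2]] /eqP hT].
move=> /andP[/andP[h1' /andP[_ /forall_inP h2']] /eqP hT'].
rewrite hT in h1; rewrite hT' in h1'.
(* Two components that each hold more than half of T must intersect. *)
have hcomp : comp G x = comp G y.
  have : (comp G x :&: T) :&: (comp G y :&: T) != set0.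
    apply/negP => /eqP h0.
    have hU : #|comp G x :&: T| + #|comp G y :&: T| <= #|T|.
      rewrite -cardsUI h0 cards0 addn0; apply: subset_leq_card.
      by rewrite finset.subUset !finset.subsetIr.
    have a1 : #|T| < 2 * #|comp G x :&: T| by [].
    have a2 : #|T| < 2 * #|comp G y :&: T| by [].
    by move: (#|comp G x :&: T|) (#|comp G y :&: T|) (#|T|) hU a1 a2 => p q r; lia.
  case/set0Pn => z; rewrite !inE => /andP[/andP[hx _] /andP[hy _]].
  by rewrite -(@comp_eq _ G x z) ?inE // -(@comp_eq _ G y z) ?inE.
apply: val_inj; apply/eqP; rewrite eqn_leq h2' /=; last by rewrite -hcomp mem_comp.
by rewrite h2 // hcomp mem_comp.
Qed.

End LinkedSets.

(** * Conductance of the whole vertex set; edges lost by minority components *)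

Section Conductance.
Local Open Scope ring_scope.
Variables (R : realType) (d : nat).
Hypothesis d_gt0 : (0 < d)%N.

Lemma card_induced (V : finType) (T : {set V}) : #|{: {x : V | x \in T}}| = #|T|.
Proof. by rewrite card_sig; apply: eq_card => x; rewrite inE. Qed.

Lemma clusterable_whole (n k : nat) (H : sgraph 'I_n) (tau : R) :
  (0 < n)%N -> (0 < k)%N -> tau <= 1 ->
  (forall S : {set 'I_n}, S != finset.set0 -> (2 * #|S| <= n)%N ->
     tau * (d * #|S|)%:R <= #|cut H S|%:R) ->
  clusterable d H k tau 1.
Proof.
move=> n0 k0 tau1 hcut; exists [set finset.setT]; split.
- apply/and3P; split.
  + by rewrite /cover finset.big_set1.
  + by apply/trivIsetP => A B; rewrite !inE => /eqP -> /eqP -> /negP.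
  + by rewrite !inE eq_sym -card_gt0 cardsT card_ord.
- by rewrite cards1.
move=> S; rewrite inE => /eqP ->; split.
  rewrite /set_conductance card_edges_between.
  have -> : cut H finset.setT = finset.set0 by apply/setP => p; rewrite !inE.
  by rewrite cards0 mul0r ler01.
rewrite /graph_conductance card_induced cardsT card_ord; case: leqP => // n1.
apply: lb_le_inf.
  pose x : {x : 'I_n | x \in [set: 'I_n]} := exist _ (Ordinal n0) (finset.in_setT _).
  exists (set_conductance R d (induced H finset.setT) [set x]); exists [set x] => //.
  split; last by rewrite cards1 muln1.
  by apply/set0Pn; exists x; rewrite inE.
move=> _ [S' [S0 S2] <-]; rewrite /set_conductance card_edges_between.
pose S1 := [set val x | x in S'].
have hc : #|S1| = #|S'| by rewrite card_imset //; apply: val_inj.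
have S0' : (0 < #|S'|)%N by rewrite card_gt0.
rewrite ler_pdivlMr ?ltr0n ?muln_gt0 ?d_gt0 // -hc.
apply: le_trans (_ : #|cut H S1|%:R <= _).
  apply: hcut; first by rewrite -card_gt0 hc.
  by rewrite hc.
rewrite ler_nat; apply: (@card_code _ _ _ _ (fun c p => p = (val c.1, val c.2))); last first.
  by move=> c p p' _ _ -> ->.
case=> x y; rewrite inE /= => /and3P[/imsetP[x' x'S ->] hy h].
exists (x', exist _ y (finset.in_setT y)) => //; rewrite inE /= x'S h andbT /=.
by apply: contra hy => hy; apply/imsetP; eexists; first exact: hy.
Qed.

Lemma card_dep_pairs (V V' : finType) (Q : {set V}) (F : V -> {set V'}) :
  #|[set p : V * V' | (p.1 \in Q) && (p.2 \in F p.1)]| = (\sum_(z in Q) #|F z|)%N.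
Proof.
rewrite -sum1_card (eq_bigr (fun z => \sum_(y in F z) 1)%N); last by move=> z _; rewrite sum1_card.
rewrite pair_big_dep; apply: eq_bigl => -[x y]; by rewrite inE.
Qed.

Lemma cluster_boundary (V : finType) (G0 : sgraph V) (T Q : {set V}) (phi : R) :
  phi <= graph_conductance R d (induced G0 T) -> Q \subset T -> Q != finset.set0 ->
  (2 * #|Q| <= #|T|)%N ->
  phi * d%:R * #|Q|%:R <= (\sum_(z in Q) #|[set y in T :\: Q | G0 z y]|)%:R.
Proof.
move=> hphi /fintype.subsetP QT Q0 Q2.
have Qpos : (0 < #|Q|)%N by rewrite card_gt0.
pose S' := [set z : {x : V | x \in T} | val z \in Q].
have hS : #|S'| = #|Q|.
  rewrite -(card_imset (ssrbool.mem S') val_inj) /=; apply: eq_card => x.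
  apply/imsetP/idP => [[z] |xQ]; first by rewrite inE => h ->.
  by exists (exist _ x (QT _ xQ)); rewrite ?inE.
have hcut : (#|cut (induced G0 T) S'| <= \sum_(z in Q) #|[set y in T :\: Q | G0 z y]|)%N.
  rewrite -card_dep_pairs.
  apply: (@card_code _ _ _ _ (fun c p => c = (val p.1, val p.2))); last first.
    move=> c [x y] [x' y'] _ _ -> /= [e1 e2]; congr (_, _); exact: val_inj.
  move=> [x y]; rewrite !inE /= => /and3P[xQ yQ h]; exists (val x, val y) => //.
  by rewrite !inE /= xQ yQ h (valP y).
have : phi <= #|cut (induced G0 T) S'|%:R / (d * #|Q|)%:R.
  apply: le_trans hphi _; rewrite /graph_conductance card_induced.
  case: leqP => [h|_]; first by lia.
  rewrite -hS -card_edges_between; apply: ge_inf.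
    by exists 0 => _ [S _ <-]; rewrite /set_conductance divr_ge0.
  exists S' => //; split; last by rewrite hS.
  by rewrite -card_gt0 hS.
rewrite ler_pdivlMr ?ltr0n ?muln_gt0 ?d_gt0 // natrM mulrA => h.
by apply: le_trans h _; rewrite ler_nat.
Qed.

(* A component meeting a cluster T in a set Q of at most #|T| / 2 vertices has lost
   all the edges of G0 from Q to T :\: Q. *)
Lemma minority_bound (n : nat) (G0 G : sgraph 'I_n) (P : {set {set 'I_n}}) (phi : R) :
  finset.partition P [set: 'I_n] ->
  (forall S, S \in P -> phi <= graph_conductance R d (induced G0 S)) ->
  phi * d%:R * #|minority G P|%:R <= (2 * #|edge_diff G0 G|)%:R.
Proof.
move=> /and3P[/eqP hcov htriv _] hphi.
have hin x : x \in pblock P x by rewrite mem_pblock hcov inE.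
have hpb x : pblock P x \in P by rewrite pblock_mem // hcov inE.
pose Q x := comp G x :&: pblock P x.
pose e z := [set y in pblock P z :\: Q z | G0 z y].
pose B := minority G P.
have hQ x z : z \in Q x -> Q z = Q x /\ pblock P z = pblock P x.
  rewrite inE => /andP[h1 h2].
  have e2 : pblock P z = pblock P x by apply: (def_pblock htriv).
  by rewrite /Q e2 (comp_eq h1).
have hB x z : x \in B -> z \in Q x -> z \in B.
  move=> xB /hQ[h1 h2]; move: xB; rewrite !inE -!/(Q _) h1 h2; exact.
have hQB x : x \in B -> [set z in B | Q z == Q x] = Q x.
  move=> xB; apply/setP => z; rewrite inE; apply/andP/idP => [[_ /eqP <-]|hz].
    by rewrite inE hin mem_comp.
  by split; [apply: hB xB hz|case: (hQ _ _ hz) => ->].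
(* B is the disjoint union of the sets [Q x], and the conductance of the cluster is applied to each
   of them. *)
have h1 : phi * d%:R * #|B|%:R <= (\sum_(x in B) #|e x|)%:R.
  rewrite -sum1_card (partition_big Q (fun q => q \in Q @: B)) /=; last first.
    by move=> x xB; apply: imset_f.
  rewrite [in X in _ <= X](partition_big Q (fun q => q \in Q @: B)) /=; last first.
    by move=> x xB; apply: imset_f.
  rewrite !natr_sum mulr_sumr; apply: ler_sum => _ /imsetP[x xB ->].
  have hsel : (fun i => (i \in B) && (Q i == Q x)) =1 (fun i => i \in Q x).
    by move=> i; move/setP: (hQB _ xB) => /(_ i); rewrite inE => ->.
  rewrite (eq_bigl _ _ hsel) (eq_bigl _ _ hsel) sum1_card.
  have h := @cluster_boundary _ G0 (pblock P x) (Q x) phi (hphi _ (hpb x)).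
  apply: le_trans (h _ _ _) _.
  - exact: finset.subsetIr.
  - by apply/set0Pn; exists x; rewrite inE hin mem_comp.
  - by move: xB; rewrite inE.
  rewrite ler_nat; apply: leq_sum => z hz; apply: subset_leq_card.
  by apply/fintype.subsetP => y; rewrite /e; case: (hQ _ _ hz) => -> ->.
apply: le_trans h1 _; rewrite ler_nat -card_dep_pairs.
(* A lost edge may be counted at both of its ends; the bit in the code is its orientation. *)
have -> : (2 * #|edge_diff G0 G|)%N = #|setX (edge_diff G0 G) [set: bool]|.
  by rewrite cardsX cardsT card_bool mulnC.
apply: (@card_code _ _ _ _ (fun (c : {set 'I_n} * bool) (p : 'I_n * 'I_n) => c = ([set p.1; p.2], (p.1 < p.2)%N))); last first.
  move=> c [x y] [x' y'] _ _ -> /= [h2 h3].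
  have hx : x \in [set x'; y'] by rewrite -h2 !inE eqxx.
  have hy : y \in [set x'; y'] by rewrite -h2 !inE eqxx orbT.
  have hx' : x' \in [set x; y] by rewrite h2 !inE eqxx.
  have hy' : y' \in [set x; y] by rewrite h2 !inE eqxx orbT.
  move: hx hy hx' hy' h3; rewrite !inE => hx hy hx' hy' h3.
  case/orP: hx => /eqP ex; case/orP: hy => /eqP ey; subst x y => //.
  - by move: hy'; rewrite orbb => /eqP ->.
  - by case: (ltngtP x' y') h3 => // /val_inj ->.
  - by move: hx'; rewrite orbb => /eqP ->.
move=> [x y]; rewrite !inE /= => /andP[_ /andP[/andP[hy hyP] h]].
exists ([set x; y], (x < y)%N) => //; rewrite !inE andbT; apply/orP; left.
have hE (H : sgraph 'I_n) a c : H a c -> [set a; c] \in edges H.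
  by move=> hh; apply/imsetP; exists (a, c); rewrite ?inE.
rewrite [_ \in edges G0]hE // andbT /=; apply/negP => /imsetP[[a c]]; rewrite !inE /= => hac hS.
have hGxy : G x y.
  have hx : x \in [set a; c] by rewrite -hS !inE eqxx.
  have hy2 : y \in [set a; c] by rewrite -hS !inE eqxx orbT.
  have ha : a \in [set x; y] by rewrite hS !inE eqxx.
  have hc : c \in [set x; y] by rewrite hS !inE eqxx orbT.
  move: hx hy2 ha hc; rewrite !inE => hx hy2 ha hc.
  case/orP: hx => /eqP ex; case/orP: hy2 => /eqP ey; subst x y => //.
  - by move: hac hc; rewrite orbb => hac /eqP e2; rewrite e2 adj_irrefl in hac.
  - by rewrite adj_sym.
  - by move: hac ha; rewrite orbb => hac /eqP e2; rewrite e2 adj_irrefl in hac.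
by case/negP: hy; rewrite hyP andbT connect1.
Qed.

End Conductance.

(** * Random seeds *)

Definition seed_val (w : nat) (r : seq bool) (B : nat) : nat :=
  foldl (fun a i => 2 * a + nth false r (B * w + i))%N 0%N (iota 0 w).

Section SeedSums.
Local Open Scope ring_scope.
Variable R : realType.

(** Sum over all seeds of length L. The recursion on the first bit makes splitting a seed into words
    an easy induction; [seed_sum_tuple] relates it to sums over tuples. *)
Fixpoint seed_sum (L : nat) (F : seq bool -> R) : R :=
  if L is L'.+1 then
    seed_sum L' (fun r => F (false :: r)) + seed_sum L' (fun r => F (true :: r))
  else F [::].

Lemma seed_sum_ext L F F' :
  (forall r, size r = L -> F r = F' r) -> seed_sum L F = seed_sum L F'.
Proof.
elim: L F F' => [|L IH] F F' h /=; first exact: h.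
by congr (_ + _); apply: IH => r hr; apply: h; rewrite /= hr.
Qed.

Lemma seed_sum_le L F F' :
  (forall r, size r = L -> F r <= F' r) -> seed_sum L F <= seed_sum L F'.
Proof.
elim: L F F' => [|L IH] F F' h /=; first exact: h.
by apply: lerD; apply: IH => r hr; apply: h; rewrite /= hr.
Qed.

Lemma seed_sumZ L F c : seed_sum L (fun r => c * F r) = c * seed_sum L F.
Proof. by elim: L F => //= L IH F; rewrite !IH mulrDr. Qed.

Lemma seed_sum_cat L1 L2 F :
  seed_sum (L1 + L2) F = seed_sum L1 (fun r1 => seed_sum L2 (fun r2 => F (r1 ++ r2))).
Proof. by elim: L1 F => //= L1 IH F; rewrite !IH. Qed.

Lemma seed_sum_const L (c : R) : seed_sum L (fun => c) = (2 ^ L)%:R * c.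
Proof. by elim: L => [|L IH] /=; rewrite ?mul1r // IH expnS natrM; ring. Qed.

Lemma seed_sum_tuple L F : seed_sum L F = \sum_(r : L.-tuple bool) F (tval r).
Proof.
elim: L F => [|L IH] F /=.
  by rewrite (big_pred1 [tuple]) // => r; apply/esym/eqP; rewrite tuple0.
pose h (p : bool * L.-tuple bool) : L.+1.-tuple bool := [tuple of p.1 :: p.2].
pose h' (t : L.+1.-tuple bool) := (thead t, [tuple of behead t]).
rewrite (reindex h) /=; last first.
  exists h'; first by move=> [c t] _; rewrite /h' /h theadE; congr (_, _); apply: val_inj.
  by move=> t _; rewrite /h /h' /= [RHS]tuple_eta.
rewrite -(pair_big xpredT xpredT (fun c t => F (tval (h (c, t))))) /= big_bool !IH addrC.
by [].
Qed.

Definition bval (r : seq bool) : nat := foldl (fun a (c : bool) => 2 * a + c)%N 0%N r.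

Lemma bval_acc r a : foldl (fun a (c : bool) => 2 * a + c)%N a r = (a * 2 ^ size r + bval r)%N.
Proof.
rewrite /bval; elim: r a => [|c r IH] a /=; first by rewrite muln1 addn0.
by rewrite IH [in RHS]IH expnS; lia.
Qed.

Lemma seed_sum_bval w (f : nat -> R) :
  seed_sum w (fun r => f (bval r)) = \sum_(0 <= x < 2 ^ w) f x.
Proof.
elim: w f => [|w IH] f; first by rewrite /= big_nat1.
have h0 : seed_sum w (fun r => f (bval (false :: r))) = \sum_(0 <= x < 2 ^ w) f x.
  by rewrite -IH; apply: seed_sum_ext => r _; congr f; rewrite /bval /=.
have h1 : seed_sum w (fun r => f (bval (true :: r))) = \sum_(0 <= x < 2 ^ w) f (2 ^ w + x)%N.
  rewrite -(IH (fun x => f (2 ^ w + x)%N)); apply: seed_sum_ext => r hr; congr f.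
  by rewrite {1}/bval /= bval_acc hr mul1n.
rewrite [LHS]/= h0 h1 expnS mul2n -addnn [RHS](@big_cat_nat _ _ _ (2 ^ w)%N) ?leq_addr //=; congr (_ + _).
have -> : \sum_(2 ^ w <= i < 2 ^ w + 2 ^ w) f i = \sum_(0 <= i < 2 ^ w) f (i + 2 ^ w)%N.
  by rewrite -{1}[(2 ^ w)%N]add0n big_addn addnK.
by apply: eq_bigr => x _; rewrite addnC.
Qed.

Lemma seed_valE w r B : seed_val w r B = bval (mkseq (fun i => nth false r (B * w + i)) w).
Proof.
rewrite /seed_val /bval /mkseq; have h s : forall a,
    foldl (fun a i => 2 * a + nth false r (B * w + i))%N a s =
    foldl (fun a (c : bool) => 2 * a + c)%N a [seq nth false r (B * w + i) | i <- s].
  by elim: s => //= i s IH a; rewrite IH.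
exact: h.
Qed.

Lemma seed_val_catl w r1 r2 N B : size r1 = (N * w)%N -> (B < N)%N ->
  seed_val w (r1 ++ r2) B = seed_val w r1 B.
Proof.
move=> h1 hB; rewrite !seed_valE; congr bval; apply/eq_in_map => i.
rewrite mem_iota add0n => /andP[_ hi]; rewrite nth_cat h1.
have -> : (B * w + i < N * w)%N; last by [].
by have : (B.+1 * w <= N * w)%N; [rewrite leq_mul2r hB orbT|rewrite mulSn; lia].
Qed.

Lemma seed_val_catr w r1 r2 N : size r1 = (N * w)%N -> size r2 = w ->
  seed_val w (r1 ++ r2) N = bval r2.
Proof.
move=> h1 h2; rewrite seed_valE; congr bval.
rewrite -[RHS](mkseq_nth false) h2; apply/eq_in_map => i _.
by rewrite nth_cat h1 ltnNge leq_addr /= addKn.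
Qed.

(** * Exposing the random words one at a time *)

Section Exposure.
Variables (w : nat) (X : nat -> (nat -> nat) -> bool) (h : nat -> nat).
Hypothesis X_adapted : forall b f g, (forall i, (i <= b)%N -> f i = g i) -> X b f = X b g.
Hypothesis X_often : forall b (f : nat -> nat),
  (h b <= \sum_(0 <= x < 2 ^ w) X b (fun i => if i == b then x else f i))%N.

Definition discount (b : bool) : R := if b then 2^-1 else 1.

(* Conditionally on the previous blocks, block b has a hit with probability at
   least h b / 2 ^ w. *)
Lemma exposure N :
  seed_sum (N * w) (fun r => \prod_(b < N) discount (X b (seed_val w r)))
    <= \prod_(b < N) ((2 ^ w)%:R - (h b)%:R / 2).
Proof.
have h_le b : (h b <= 2 ^ w)%N.
  apply: leq_trans (X_often b (fun=> 0%N)) _.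
  apply: leq_trans (_ : \sum_(0 <= x < 2 ^ w) 1 <= _)%N; first by apply: leq_sum => x _; case: (X _ _).
  by rewrite sum_nat_const_nat subn0 muln1.
have fac_ge0 b : 0 <= (2 ^ w)%:R - (h b)%:R / 2 :> R.
  have := h_le b; rewrite -(ler_nat R) => h1.
  have : 0 <= (h b)%:R :> R by []. lra.
elim: N => [|N IH]; first by rewrite mul0n /= !big_ord0.
rewrite mulSn addnC seed_sum_cat big_ord_recr /=.
apply: le_trans (_ : seed_sum (N * w) (fun r => ((2 ^ w)%:R - (h N)%:R / 2) *
    \prod_(b < N) discount (X b (seed_val w r))) <= _); last first.
  by rewrite seed_sumZ mulrC ler_wpM2r.
apply: seed_sum_le => r1 hr1.
(* By [X_adapted], the first N words fix all factors but the last, so only the last word is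
   averaged. *)
rewrite (seed_sum_ext (F' := fun r2 => \prod_(b < N) discount (X b (seed_val w r1)) *
   discount (X N (fun i => if i == N then bval r2 else seed_val w r1 i)))); last first.
  move=> r2 hr2; rewrite big_ord_recr /=; congr (_ * _).
    apply: eq_bigr => b _; congr discount; apply: X_adapted => i hi.
    by apply: (seed_val_catl _ hr1); apply: leq_ltn_trans hi (ltn_ord b).
  congr discount; apply: X_adapted => i; rewrite leq_eqVlt; case: eqP => [->|_] /= hi.
    by rewrite (seed_val_catr hr1 hr2).
  exact: seed_val_catl hr1 hi.
rewrite seed_sumZ mulrC ler_wpM2r //.
  by apply: prodr_ge0 => b _; rewrite /discount; case: ifP; rewrite ?invr_ge0.
rewrite (seed_sum_bval w (fun x => discount (X N (fun i => if i == N then x else seed_val w r1 i)))).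
have hd c : discount c = 1 - c%:R / 2 by case: c; rewrite /discount /=; lra.
under eq_bigr => x _ do rewrite hd.
rewrite big_split /= sumrN -mulr_suml -natr_sum sumr_const_nat subn0 lerD2l lerN2.
by rewrite ler_wpM2r ?invr_ge0 // ler_nat X_often.
Qed.

(* Markov's inequality for 2 ^- (number of hits). *)
Lemma exposure_tail N L t : (N * w <= L)%N ->
  #|[set r : L.-tuple bool | \sum_(b < N) X b (seed_val w (tval r)) <= t]%N|%:R / (2 ^ L)%:R
   <= 2 ^+ t * expR (- (\sum_(b < N) h b)%:R / (2 * (2 ^ w)%:R)) :> R.
Proof.
move=> hL.
rewrite ler_pdivrMr ?ltr0n ?expn_gt0 //.
pose D r := \prod_(b < N) discount (X b (seed_val w r)).
have hD (r : seq bool) : D r = (2^-1) ^+ (\sum_(b < N) X b (seed_val w r))%N.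
  rewrite -[(\sum_(b < N) _)%N]/(\sum_(b < N) X b (seed_val w r))%N.
  rewrite expr_sum; apply: eq_bigr => b _; rewrite /discount.
  by case: (X b _); rewrite ?expr1 ?expr0.
have h1 : #|[set r : L.-tuple bool | \sum_(b < N) X b (seed_val w (tval r)) <= t]%N|%:R
   <= 2 ^+ t * seed_sum L D.
  rewrite seed_sum_tuple mulr_sumr -sum1_card natr_sum big_mkcond /=.
  apply: ler_sum => r _; rewrite inE; case: leqP => [hr|_].
    by rewrite hD exprVn ler_pdivlMr ?exprn_gt0 // mul1r ler_eXn2l // ltr1n.
  by rewrite hD mulr_ge0 // exprn_ge0 // invr_ge0.
apply: le_trans h1 _; rewrite -mulrA ler_wpM2l ?exprn_ge0 //.
(* The bits after the first N words multiply the sum by a power of two. *)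
rewrite -(subnKC hL) seed_sum_cat.
rewrite (seed_sum_ext (F' := fun r1 => (2 ^ (L - N * w))%:R * D r1)); last first.
  move=> r1 hr1; rewrite -seed_sum_const; apply: seed_sum_ext => r2 _.
  apply: eq_bigr => b _; congr discount; apply: X_adapted => i hi.
  by apply: (seed_val_catl _ hr1); apply: leq_ltn_trans hi (ltn_ord b).
rewrite seed_sumZ expnD natrM [leRHS]mulrA [leRHS]mulrC ler_wpM2l // [leRHS]mulrC.
apply: le_trans (exposure N) _.
have hw : 0 < (2 ^ w)%:R :> R by rewrite ltr0n expn_gt0.
have -> : (2 ^ (N * w))%:R = \prod_(b < N) (2 ^ w)%:R :> R.
  by rewrite prodr_const card_ord -natrX -expnM mulnC.
have -> : expR (- (\sum_(b < N) h b)%:R / (2 * (2 ^ w)%:R)) =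
    \prod_(b < N) expR (- (h b)%:R / (2 * (2 ^ w)%:R)) :> R.
  by rewrite -expR_sum natr_sum -sumrN mulr_suml.
rewrite -big_split /=; apply: ler_prod => b _.
have h_le : (h b <= 2 ^ w)%N.
  apply: leq_trans (X_often b (fun=> 0%N)) _.
  apply: leq_trans (_ : \sum_(0 <= x < 2 ^ w) 1 <= _)%N; first by apply: leq_sum => x _; case: (X _ _).
  by rewrite sum_nat_const_nat subn0 muln1.
rewrite -(ler_nat R) in h_le.
have hb0 : 0 <= (h b)%:R :> R by [].
apply/andP; split; first lra.
(* Uses 1 - x <= exp (- x) with x = h b / (2 * 2 ^ w). *)
apply: le_trans (_ : (2 ^ w)%:R * (1 + - (h b)%:R / (2 * (2 ^ w)%:R)) <= _).
  by rewrite le_eqVlt; apply/orP; left; apply/eqP; field; rewrite gt_eqF.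
by rewrite ler_wpM2l ?expR_ge1Dx // ltW.
Qed.

End Exposure.

End SeedSums.

(** * Chords crossing a cut *)

Section Crossing.
Variables (n K m W NB w : nat) (inS : pred nat).
Hypothesis K_gt0 : 0 < K.
Hypothesis m_gt0 : 0 < m.
Hypothesis W_ge : m <= W.
Hypothesis wE : 2 ^ w = K * W.
Hypothesis NBE : NB = m %/ K + 1.

Definition cell_in l q := inS (cell m l q %% n).

Definition crosses (f : nat -> nat) l be :=
  [&& accepted K m NB f l be, cell_in l (sel K NB f l be) & ~~ cell_in l (tgt K NB f l be)].

Definition block_weight l be := #|[set s : 'I_K | (be * K + s < m) && cell_in l (be * K + s)]|.
Definition line_in l := #|[set q : 'I_m | cell_in l q]|.
Definition line_out l := #|[set q : 'I_m | ~~ cell_in l q]|.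

Definition hits b f := crosses f (b %/ NB) (b %% NB).
(** Lower bound for the number of words that make block b cross the cut: selectable positions inside
    S, times targets outside S, less the at most m / K targets already taken by earlier blocks of
    the line. *)
Definition hit_weight b := block_weight (b %/ NB) (b %% NB) * (line_out (b %/ NB) - m %/ K).

Lemma NB_gt0 : 0 < NB. Proof. by rewrite NBE addn1. Qed.

(** Freshness looks only at earlier blocks of the same line, and these precede b in the numbering of
    the words. *)
Lemma hits_adapted b f g : (forall i, i <= b -> f i = g i) -> hits b f = hits b g.
Proof.
move=> h; rewrite /hits; have hb := divn_eq b NB.
set l := b %/ NB in hb *; set be := b %% NB in hb *.
have ht be' : be' <= be -> tgt K NB f l be' = tgt K NB g l be'.
  by move=> hbe; rewrite /tgt h //; lia.
have hs : sel K NB f l be = sel K NB g l be by rewrite /sel h //; lia.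
rewrite /crosses /accepted hs ht //; congr [&& (_ && _), _ & _].
apply: eq_in_all => be'; rewrite mem_iota add0n => /andP[_ hbe].
by rewrite !ht // ltnW.
Qed.

(** For s < K, the word t * K + s selects the s-th position of the block and aims at t. Distinct
    pairs (s, t) give distinct words, all below K * W because m <= W. *)
Lemma hits_often b (f : nat -> nat) :
  hit_weight b <= \sum_(0 <= x < 2 ^ w) hits b (fun i => if i == b then x else f i).
Proof.
rewrite /hit_weight /hits; have hb := divn_eq b NB.
have hbe : b %% NB <= m %/ K by have := ltn_pmod b NB_gt0; rewrite {2}NBE addn1 ltnS.
set l := b %/ NB in hb *; set be := b %% NB in hb hbe *.
pose g x i := if i == b then x else f i.
have -> : \sum_(0 <= x < 2 ^ w) crosses (fun i => if i == b then x else f i) l be =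
    #|[set x : 'I_(2 ^ w) | crosses (g x) l be]|.
  rewrite big_mkord -sum1_card [RHS]big_mkcond /=; apply: eq_bigr => x _.
  by rewrite inE -/(g x); case: (crosses _ _ _).
pose taken := [set t : 'I_m | has (fun be' => f (l * NB + be') %/ K == t) (iota 0 be)].
have htaken : #|taken| <= be.
  rewrite -[X in _ <= X](card_ord be) -cardsT.
  apply: (@card_code _ _ _ _ (fun (c : 'I_be) (t : 'I_m) => f (l * NB + c) %/ K = t)).
    move=> t; rewrite inE => /hasP[be']; rewrite mem_iota add0n => /andP[_ h] /eqP e.
    by exists (Ordinal h).
  by move=> c t t' _ _ h1 h2; apply: val_inj; rewrite /= -h1 -h2.
pose A := [set s : 'I_K | (be * K + s < m) && cell_in l (be * K + s)].
pose T := [set q : 'I_m | ~~ cell_in l q] :\: taken.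
apply: leq_trans (_ : #|setX A T| <= _).
  rewrite cardsX leq_mul // /T cardsD leq_sub2l //.
  apply: leq_trans hbe; apply: leq_trans htaken.
  by apply: subset_leq_card; apply: finset.subsetIr.
apply: (@card_code _ _ _ _ (fun (x : 'I_(2 ^ w)) (p : 'I_K * 'I_m) => val x = p.2 * K + p.1)).
  move=> [s t]; rewrite !inE /= => /andP[/andP[hs1 hs2] /andP[ht1 ht2]].
  have hx : t * K + s < 2 ^ w.
    rewrite wE [K * W]mulnC; apply: leq_trans (_ : t.+1 * K <= _).
      by rewrite mulSn addnC ltn_add2r.
    by rewrite leq_mul2r (leq_trans (ltn_ord t) W_ge) orbT.
  exists (Ordinal hx) => //; rewrite inE /=.
  have hgb : g (t * K + s) (l * NB + be) = t * K + s by rewrite /g -hb eqxx.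
  have ht : tgt K NB (g (t * K + s)) l be = t.
    by rewrite /tgt hgb divnMDl // divn_small ?addn0.
  have hs : sel K NB (g (t * K + s)) l be = be * K + s.
    by rewrite /sel hgb modnMDl modn_small.
  rewrite /crosses /accepted ht hs hs1 hs2 ht2 ltn_ord !andbT /= /fresh ht.
  apply/allP => be' hbe'; apply: contra ht1 => /eqP e; apply/hasP; exists be' => //.
  move: hbe'; rewrite mem_iota add0n => /andP[_ hlt].
  apply/eqP; rewrite -e /tgt /g; case: eqP => //; lia.
move=> x [s t] [s' t'] _ _ /= h1 h2; rewrite h1 in h2.
have et : val t = val t'.
  have := congr1 (fun z => z %/ K) h2.
  by rewrite !divnMDl // !divn_small ?addn0.
have es : val s = val s'.
  have := congr1 (fun z => z %% K) h2.
  by rewrite !modnMDl !modn_small.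
by congr (_, _); apply: val_inj.
Qed.

Lemma sum_blocks (F : nat -> nat -> nat) N :
  \sum_(b < N * NB) F (b %/ NB) (b %% NB) = \sum_(l < N) \sum_(be < NB) F l be.
Proof.
rewrite -(big_mkord xpredT (fun b => F (b %/ NB) (b %% NB))).
elim: N => [|N IH]; first by rewrite mul0n big_geq // big_ord0.
rewrite big_ord_recr /= -{}IH mulSn addnC (@big_cat_nat _ _ _ (N * NB)) ?leq_addr //=.
congr (_ + _); rewrite -{1}[N * NB]add0n big_addn addKn big_mkord.
by apply: eq_bigr => be _; rewrite addnC divnMDl ?NB_gt0 // modnMDl divn_small ?addn0 ?modn_small.
Qed.

Lemma line_in_blocks l : line_in l <= \sum_(be < NB) block_weight l be.
Proof.
rewrite /line_in /block_weight.
have -> : \sum_(be < NB) #|[set s : 'I_K | (be * K + s < m) && cell_in l (be * K + s)]| =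
   #|[set p : 'I_NB * 'I_K | (p.1 * K + p.2 < m) && cell_in l (p.1 * K + p.2)]|.
  under eq_bigr => be _ do rewrite -sum1_card.
  rewrite pair_big_dep -sum1_card; apply: eq_bigl => -[be s]; by rewrite !inE.
apply: (@card_code _ _ _ _ (fun (p : 'I_NB * 'I_K) (q : 'I_m) => val q = p.1 * K + p.2)).
  move=> q; rewrite inE => hq.
  have h1 : q %/ K < NB by rewrite NBE addn1 ltnS leq_div2r // ltnW.
  have h2 : q %% K < K by rewrite ltn_mod.
  by exists (Ordinal h1, Ordinal h2); rewrite ?inE /= -divn_eq // ltn_ord.
by move=> p q q' _ _ h1 h2; apply: val_inj; rewrite h1 h2.
Qed.

Definition grid_in := #|[set p : 'I_m * 'I_m | inS ((p.1 * m + p.2) %% n)]|.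
Definition grid_out := #|[set p : 'I_m * 'I_m | ~~ inS ((p.1 * m + p.2) %% n)]|.

(* The canonical path from (i, j) to (i', j') turns at (i, j'). *)
Lemma grid_isoperimetry :
  grid_in * grid_out <= m * \sum_(l < 2 * m) line_in l * line_out l.
Proof.
pose c (i j : nat) := inS ((i * m + j) %% n).
have hrow (l : 'I_(2 * m)) (q : 'I_m) : l < m -> cell_in l q = c l q.
  by move=> hl; rewrite /cell_in /cell hl.
have -> : \sum_(l < 2 * m) line_in l * line_out l =
   #|[set p : 'I_(2 * m) * ('I_m * 'I_m) | cell_in p.1 p.2.1 && ~~ cell_in p.1 p.2.2]|.
  under eq_bigr => l _ do rewrite /line_in /line_out -cardsX -sum1_card.
  rewrite pair_big_dep -sum1_card; apply: eq_bigl => -[l [q q']]; by rewrite !inE.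
rewrite /grid_in /grid_out -!cardsX.
rewrite -[X in X * _](card_ord m) -cardsT -cardsX.
apply: (@card_code _ _ _ _
  (fun (x : 'I_m * ('I_(2 * m) * ('I_m * 'I_m))) (p : ('I_m * 'I_m) * ('I_m * 'I_m)) =>
   let: (e, (l, (q, q'))) := x in let: ((i, j), (i', j')) := p in
   if l < m then [/\ i' = e, val i = l, j = q & j' = q']
   else [/\ j = e, val j' = l - m, i = q & i' = q'])).
  move=> [[i j] [i' j']]; rewrite !inE /= => /andP[h1 h2].
  (* If the corner (i, j') is in S, column j' separates its ends, otherwise row i does. The
     coordinate of the other leg that the line does not record becomes the factor m. *)
  case: (boolP (c i j')) => hm.
    have hl : m + j' < 2 * m by rewrite mul2n -addnn ltn_add2l.
    exists (j, (Ordinal hl, (i, i'))).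
      rewrite !inE /= /cell_in /cell /= ltnNge leq_addr /= addKn.
      by rewrite -!/(c _ _) hm h2.
    by rewrite /= ltnNge leq_addr /= addKn.
  have hl : i < 2 * m by apply: leq_trans (ltn_ord i) _; rewrite leq_pmull.
  exists (i', (Ordinal hl, (j, j'))).
    by rewrite !inE /= /cell_in /cell /= ltn_ord h1; exact: hm.
  by rewrite /= ltn_ord.
move=> [e [l [q q']]] [[i j] [i' j']] [[a b] [a' b']] _ _ /=.
case: ifP => _ [h1 h2 h3 h4] [k1 k2 k3 k4].
  by have : i = a by [apply: val_inj; rewrite /= h2 -k2]; subst => ->.
by have : j' = b' by [apply: val_inj; rewrite /= h2 -k2]; subst => ->.
Qed.

Lemma sum_line_in : \sum_(l < 2 * m) line_in l <= 2 * grid_in.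
Proof.
have -> : \sum_(l < 2 * m) line_in l = #|[set p : 'I_(2 * m) * 'I_m | cell_in p.1 p.2]|.
  under eq_bigr => l _ do rewrite /line_in -sum1_card.
  rewrite pair_big_dep -sum1_card; apply: eq_bigl => -[l q]; by rewrite !inE.
have -> : 2 * grid_in = #|setX [set: bool] [set p : 'I_m * 'I_m | inS ((p.1 * m + p.2) %% n)]|.
  by rewrite cardsX cardsT card_bool.
apply: (@card_code _ _ _ _ (fun (x : bool * ('I_m * 'I_m)) (p : 'I_(2 * m) * 'I_m) =>
   x.1 = (p.1 < m) /\ if x.1 then val p.1 = x.2.1 /\ p.2 = x.2.2
                       else val p.1 = m + x.2.2 /\ p.2 = x.2.1)); last first.
  move=> [c [i j]] [l q] [l' q'] _ _ /= [-> h] [_ h'].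
  by case: ifP h h' => _ [h1 ->] [h2 ->]; congr (_, _); apply: val_inj; rewrite /= h1 h2.
move=> [l q]; rewrite inE /= /cell_in /cell; case: ifP => hl h.
  by exists (true, (Ordinal hl, q)); rewrite ?inE.
have hlm : l - m < m by have := ltn_ord l; lia.
exists (false, (q, Ordinal hlm)); rewrite ?inE //=.
by split=> //; split=> //; rewrite subnKC // leqNgt hl.
Qed.

(** Isoperimetry gives a total of at least m * grid_in / 4. The taken targets cost at most 2 (m / K)
    * grid_in, which is at most half of that since K >= 16. *)
Lemma total_weight : 16 <= K -> m * m <= 4 * grid_out ->
  grid_in * m <= 8 * \sum_(b < (2 * m) * NB) hit_weight b.
Proof.
move=> K16 hout.
rewrite (sum_blocks (fun l be => block_weight l be * (line_out l - m %/ K))).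
set D := \sum_(l < 2 * m) line_in l * line_out l.
have h1 : D <= \sum_(l < 2 * m) \sum_(be < NB) block_weight l be * (line_out l - m %/ K)
             + m %/ K * (2 * grid_in).
  apply: leq_trans (_ : \sum_(l < 2 * m) (line_in l * (line_out l - m %/ K) + m %/ K * line_in l) <= _).
    apply: leq_sum => l _; rewrite [m %/ K * _]mulnC -mulnDr leq_mul2l; apply/orP; right; lia.
  rewrite big_split /= -big_distrr /= leq_add //; last by rewrite leq_mul2l sum_line_in orbT.
  apply: leq_sum => l _; rewrite -big_distrl /= leq_mul2r line_in_blocks orbT //.
have h2 := grid_isoperimetry; rewrite -/D in h2.
have h3 : m %/ K * 16 <= m by apply: leq_trans (leq_trunc_div m K); rewrite leq_mul2l K16 orbT.
have h4 : m * grid_in <= 4 * D.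
  rewrite -(leq_pmul2l m_gt0); apply: leq_trans (_ : grid_in * (4 * grid_out) <= _); last by lia.
  by rewrite mulnA mulnC leq_mul2l hout orbT.
have h5 : m %/ K * 16 * grid_in <= m * grid_in by rewrite leq_mul2r h3 orbT.
move: h1 h4 h5; set H := \sum_(l < _) _; set gi := grid_in; set q := m %/ K; lia.
Qed.

End Crossing.

(** * Union bound over sparse cuts *)

Section UnionBound.
Variables (R : realType) (n : nat) (G : sgraph 'I_n) (K m W lg w NB M L : nat).
Hypothesis n_gt0 : 0 < n.
Hypothesis K_ge : 16 <= K.
Hypothesis m_gt0 : 0 < m.
Hypothesis m_ge : n <= m * m.
Hypothesis m2n : m * m <= 2 * n.
Hypothesis W_ge : m <= W.
Hypothesis W_le : W <= 2 * m.
Hypothesis wE : 2 ^ w = K * W.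
Hypothesis NBE : NB = m %/ K + 1.
Hypothesis lg_gt0 : 0 < lg.
Hypothesis lg_ge : n.+1 <= 2 ^ (2 * lg).
Hypothesis ME : M = 1024 * (K * lg).
Hypothesis L_ge : 2 * m * NB * w <= L.

Local Notation H r := (filter_graph G K m NB (seed_val w r) M true).
Local Notation pre := (pre_adj G M true).

Definition val_pred (S : {set 'I_n}) : pred nat := fun c => [exists x in S, val x == c].

Lemma val_predN S c : c < n -> ~~ val_pred S c -> exists2 y, y \in ~: S & val y = c.
Proof.
move=> hc h; exists (Ordinal hc) => //; rewrite inE; apply: contra h => h.
by apply/exists_inP; exists (Ordinal hc).
Qed.

Lemma card_le_grid (S : {set 'I_n}) (Q : pred nat) :
  (forall x, x \in S -> Q (val x)) ->
  #|S| <= #|[set p : 'I_m * 'I_m | Q ((p.1 * m + p.2) %% n)]|.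
Proof.
move=> hQ.
apply: (@card_code _ _ _ _ (fun (p : 'I_m * 'I_m) (x : 'I_n) => val x = p.1 * m + p.2)).
  move=> x xS.
  have h1 : x %/ m < m by rewrite ltn_divLR //; apply: leq_trans m_ge.
  have h2 : x %% m < m by rewrite ltn_mod.
  by exists (Ordinal h1, Ordinal h2); rewrite ?inE /= -divn_eq // modn_small // hQ.
by move=> p x y _ _ h1 h2; apply: val_inj; rewrite h1 h2.
Qed.

Lemma hits_le_cut (S : {set 'I_n}) (u : nat -> nat) :
  \sum_(b < 2 * m * NB) hits n K m NB (val_pred S) b u
    <= 4 * #|cut (filter_graph G K m NB u M true) S|.
Proof.
have K0 : 0 < K by lia.
have hc := @crossing_le_cut n G K m NB u M true K0 m_gt0 m2n S.
apply: leq_trans hc.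
rewrite (sum_blocks NBE (fun l be => crosses n K m NB (val_pred S) u l be : nat)).
have -> : \sum_(l < 2 * m) \sum_(be < NB) crosses n K m NB (val_pred S) u l be =
   #|[set q : 'I_(2 * m) * 'I_NB | crosses n K m NB (val_pred S) u q.1 q.2]|.
  rewrite pair_big /= -sum1_card [RHS]big_mkcond /=; apply: eq_bigr => q _.
  by rewrite inE; case: (crosses _ _ _ _ _ _ _ _).
apply: subset_leq_card; apply/fintype.subsetP => q; rewrite !inE => /and3P[-> h1 h2] /=.
case/exists_inP: h1 => x xS /eqP hx; apply/exists_inP; exists x => //.
have [y yS hy] := val_predN (ltn_pmod _ n_gt0) h2.
by apply/exists_inP; exists y => //; rewrite hx hy !eqxx.
Qed.

Lemma cut_pre_le (S : {set 'I_n}) (u : nat -> nat) :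
  #|cut pre S| <= #|cut (filter_graph G K m NB u M true) S|.
Proof.
apply: subset_leq_card; apply/fintype.subsetP => -[x y]; rewrite !inE /=.
case/and3P => xS yS h; rewrite xS yS /= /filter_adj h /= andbT.
by apply: contra yS => /eqP <-.
Qed.

Local Open Scope ring_scope.

(** The factor 4 is that of [hits_le_cut]: a cut of at most |S| / M edges admits at most four times
    as many hits. *)
Definition rare (S : {set 'I_n}) : {set L.-tuple bool} :=
  [set r : L.-tuple bool |
     (\sum_(b < 2 * m * NB) hits n K m NB (val_pred S) b (seed_val w (tval r)) <= 4 * (#|S| %/ M))%N].

(** The total weight is at least |S| * m / 8, and 2 ^ w = K * W <= 2 * K * m, so the exponent of
    [exposure_tail] is at least |S| / (32 * K). *)
Lemma prob_rare (S : {set 'I_n}) : (2 * #|S| <= n)%N ->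
  #|rare S|%:R / (2 ^ L)%:R <=
    2 ^+ (4 * (#|S| %/ M)) * expR (- #|S|%:R / (32 * K%:R)) :> R.
Proof.
move=> hS.
have K0 : (0 < K)%N by lia.
have hw : 0 < (2 ^ w)%:R :> R by rewrite ltr0n expn_gt0.
have hA := @hits_adapted n K m W NB w (val_pred S) K0 m_gt0 W_ge wE NBE.
have hO := @hits_often n K m W NB w (val_pred S) K0 m_gt0 W_ge wE NBE.
apply: le_trans (exposure_tail R hA hO (4 * (#|S| %/ M)) L_ge) _.
rewrite ler_wpM2l ?exprn_ge0 // ler_expR mulNr mulNr lerN2.
have hin : (#|S| <= grid_in n m (val_pred S))%N.
  by apply: card_le_grid => x xS; apply/exists_inP; exists x.
have hout : (m * m <= 4 * grid_out n m (val_pred S))%N.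
  have : (#|~: S| <= grid_out n m (val_pred S))%N.
    apply: (@card_le_grid _ (fun c => ~~ val_pred S c)) => x; rewrite inE => xS.
    by apply: contra xS => /exists_inP[y yS /eqP/val_inj <-].
  have := cardsC S; rewrite card_ord; lia.
have ht := total_weight K0 m_gt0 W_ge wE NBE K_ge hout.
set h := (\sum_(b < _) _)%N in ht *.
have hK : 0 < K%:R :> R by rewrite ltr0n.
rewrite ler_pdivrMr ?mulr_gt0 // mulrAC ler_pdivlMr ?mulr_gt0 //.
rewrite -!natrM ler_nat wE.
have h1 : (#|S| * m <= 8 * h)%N by apply: leq_trans ht; rewrite leq_mul2r hin orbT.
have h2 : (#|S| * (2 * (K * W)) <= #|S| * (4 * (K * m)))%N.
  by rewrite leq_mul2l; apply/orP; right; have := leq_mul (leqnn K) W_le; lia.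
apply: leq_trans h2 _.
have h3 : (#|S| * m * (4 * K) <= 8 * h * (4 * K))%N by rewrite leq_mul2r h1 orbT.
by move: h3; set s := #|S|; lia.
Qed.

(** A superset, independent of the seed, of the sets that can have a sparse cut for some seed. *)
Definition families : {set {set 'I_n}} :=
  [set S : {set 'I_n} | [&& (M <= #|S|)%N, (2 * #|S| <= n)%N &
    [exists O : {set 'I_n}, exists Q : {set 'I_n},
      [&& (#|O| <= #|S| %/ M)%N, (#|Q| <= 2 * (#|S| %/ M))%N & S == reach pre O Q]]]].

Lemma M_gt0 : (0 < M)%N.
Proof. by rewrite ME !muln_gt0 lg_gt0 andbT /=; lia. Qed.

Lemma sparse_in_families (r : L.-tuple bool) (S : {set 'I_n}) :
  S != finset.set0 -> (2 * #|S| <= n)%N -> (#|cut (H (tval r)) S| * M < #|S|)%N ->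
  S \in families /\ r \in rare S.
Proof.
move=> S0 S2 hcut.
have hj : (#|cut (H (tval r)) S| <= #|S| %/ M)%N by rewrite leq_divRL ?M_gt0 // ltnW.
have hjp : (#|cut pre S| <= #|S| %/ M)%N by apply: leq_trans (cut_pre_le _ _) hj.
have ST : S != finset.setT.
  apply/eqP => e; move: S2; rewrite e cardsT card_ord; lia.
have hcl (C : {set 'I_n}) : C != finset.set0 -> C \subset S -> cut pre C = finset.set0 -> (M <= #|C|)%N.
  move=> C0 CS; apply: closed_large C0 _; apply: contra ST => /eqP e.
  by rewrite -finset.subTset -e.
have [O [Q [hO hQ Q0 SE]]] := reach_encoding (pre_adj_sym G M true) M_gt0 S0 hcl.
have hQ2 : (#|Q| <= 2 * (#|S| %/ M))%N by apply: leq_trans hQ _; lia.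
split; last first.
  by rewrite inE; apply: leq_trans (hits_le_cut _ _) _; rewrite leq_mul2l hj orbT.
rewrite inE S2 /=; apply/andP; split.
  (* As Q is nonempty and has at most 2 (|S| / M) elements, |S| is at least M. *)
  have : (0 < #|S| %/ M)%N by move: Q0 hQ2; lia.
  by rewrite divn_gt0 // M_gt0.
apply/existsP; exists O; apply/existsP; exists Q.
by rewrite (leq_trans hO hjp) hQ2 -SE eqxx.
Qed.

Lemma expR1_ge2 : 2 <= expR 1 :> R.
Proof. by have := @expR_ge1Dx R 1; lra. Qed.

Lemma pow2_le_expR k : 2 ^+ k <= expR k%:R :> R.
Proof.
by rewrite -[k%:R]mulr1 expRM_natl lerXn2r ?nnegrE ?expR_ge0 // expR1_ge2.
Qed.

(** Put j = s / M, rounded down. The choice M = 1024 * K * lg makes s / (32 K) at least 32 * lg * j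
    and, as s >= M, at least 32 * lg. The number of sets and the power of 2 cost at most 6 * lg * j
    + 4 * j in the exponent, and the wanted (n + 1) ^ (-2) needs 4 * lg more. *)
Lemma family_level (s : nat) : (M <= s)%N ->
  (n.+1)%:R ^+ (3 * (s %/ M)) * (2 ^+ (4 * (s %/ M)) * expR (- s%:R / (32 * K%:R)))
    <= ((n.+1)%:R ^+ 2)^-1 :> R.
Proof.
move=> hs; set j := (s %/ M)%N.
have K0 : 0 < K%:R :> R by rewrite ltr0n; lia.
have hn : (n.+1)%:R <= 2 ^+ (2 * lg) :> R by rewrite -natrX ler_nat.
have h1 : (n.+1)%:R ^+ (3 * j) <= expR (6 * lg%:R * j%:R) :> R.
  apply: le_trans (_ : (2 ^+ (2 * lg)) ^+ (3 * j) <= _); first by rewrite lerXn2r ?nnegrE ?exprn_ge0 ?ler0n.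
  rewrite -exprM; apply: le_trans (pow2_le_expR _) _; rewrite ler_expR.
  rewrite le_eqVlt; apply/orP; left; apply/eqP; rewrite !natrM; ring.
have h2 : 2 ^+ (4 * j) <= expR (4 * j%:R) :> R.
  by apply: le_trans (pow2_le_expR _) _; rewrite ler_expR natrM.
have hMR : M%:R = 1024 * (K%:R * lg%:R) :> R by rewrite ME !natrM.
have hjs : 1024 * (K%:R * lg%:R) * j%:R <= s%:R :> R.
  have : (j * M <= s)%N := leq_trunc_div s M.
  by rewrite -(ler_nat R) natrM hMR mulrC.
have hMs : 1024 * (K%:R * lg%:R) <= s%:R :> R.
  by have := hs; rewrite -(ler_nat R) hMR.
have lg1 : 1 <= lg%:R :> R by rewrite ler1n.
have j0 : 0 <= j%:R :> R by [].
apply: le_trans (_ : expR (6 * lg%:R * j%:R) * (expR (4 * j%:R) * expR (- s%:R / (32 * K%:R))) <= _).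
  apply: ler_pM => //; first exact: exprn_ge0.
    by rewrite mulr_ge0 ?exprn_ge0 ?expR_ge0.
  by rewrite ler_wpM2r ?expR_ge0.
rewrite -!expRD.
apply: le_trans (_ : expR (- (4 * lg%:R)) <= _); last first.
  rewrite expRN lef_pV2 ?posrE ?expR_gt0 ?exprn_gt0 ?ltr0n //.
  apply: le_trans (_ : (2 ^+ (2 * lg)) ^+ 2 <= _); first by rewrite lerXn2r ?nnegrE ?exprn_ge0 ?ler0n.
  rewrite -exprM; apply: le_trans (pow2_le_expR _) _; rewrite ler_expR.
  by rewrite !natrM; lra.
rewrite ler_expR.
have -> : - s%:R / (32 * K%:R) = - (s%:R / K%:R) / 32 :> R by field; rewrite gt_eqF.
set q : R := s%:R / K%:R.
have hq1 : 1024 * lg%:R * j%:R <= q by rewrite ler_pdivlMr //; lra.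
have hq2 : 1024 * lg%:R <= q by rewrite ler_pdivlMr //; lra.
have hjl : j%:R <= lg%:R * j%:R :> R by rewrite ler_peMl.
lra.
Qed.

Lemma card_family_level s :
  (#|[set S in families | #|S| == s]| <= n.+1 ^ (3 * (s %/ M)))%N.
Proof.
have := card_reach_family pre (s %/ M) (2 * (s %/ M)).
rewrite card_ord -mulSn; apply: leq_trans; apply: subset_leq_card.
by apply/fintype.subsetP => S; rewrite !inE => /andP[/and3P[_ _ h] /eqP <-].
Qed.

(* A set with a sparse cut is rarely crossed by chords, and by [reach_encoding]
   there are few candidates of each size for such a set. *)
Lemma sparse_cut_prob :
  #|[set r : L.-tuple bool | [exists S : {set 'I_n},
      [&& S != finset.set0, (2 * #|S| <= n)%N & (#|cut (H (tval r)) S| * M < #|S|)%N]]]|%:R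
    / (2 ^ L)%:R <= n%:R^-1 :> R.
Proof.
set B := [set r | _].
have hB : (#|B| <= \sum_(S in families) #|rare S|)%N.
  rewrite -card_dep_pairs.
  apply: (@card_code _ _ _ _ (fun (p : {set 'I_n} * L.-tuple bool) r => p.2 = r)).
    move=> r; rewrite inE => /existsP[S /and3P[h1 h2 h3]].
    have [h4 h5] := sparse_in_families h1 h2 h3.
    by exists (S, r); rewrite // inE /= h4.
  by move=> p r r' _ _ <- <-.
have h2L : 0 < (2 ^ L)%:R :> R by rewrite ltr0n expn_gt0.
apply: le_trans (_ : \sum_(S in families) #|rare S|%:R / (2 ^ L)%:R <= _).
  by rewrite -mulr_suml ler_pM2r ?invr_gt0 // -natr_sum ler_nat.
pose f s : R := 2 ^+ (4 * (s %/ M)) * expR (- s%:R / (32 * K%:R)).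
apply: le_trans (_ : \sum_(S in families) f #|S| <= _).
  by apply: ler_sum => S; rewrite inE => /and3P[_ hS _]; apply: prob_rare.
(* Grouping by size gives n + 1 levels, each contributing at most (n + 1) ^ (-2). *)
rewrite (partition_big (fun S : {set 'I_n} => inord #|S| : 'I_n.+1) xpredT) //=.
apply: le_trans (_ : \sum_(s < n.+1) ((n.+1)%:R ^+ 2)^-1 <= _); last first.
  have n1 : (n.+1)%:R != 0 :> R by rewrite pnatr_eq0.
  rewrite sumr_const card_ord -[leLHS]mulr_natr.
  have -> : ((n.+1)%:R ^+ 2)^-1 * (n.+1)%:R = (n.+1)%:R^-1 :> R.
    by move: ((n.+1)%:R) n1 => x x0; field.
  by rewrite lef_pV2 ?posrE ?ltr0n // ler_nat.
apply: ler_sum => s _.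
have hs (S : {set 'I_n}) : (S \in families) && (inord #|S| == s) = (S \in [set S in families | #|S| == s]).
  rewrite [RHS]in_set; congr (_ && _); rewrite -val_eqE /= inordK // ltnS.
  by rewrite -[X in (_ <= X)%N](card_ord n) max_card.
rewrite (eq_bigl _ _ hs) (eq_bigr (fun=> f s)); last by move=> S; rewrite in_set => /andP[_ /eqP ->].
rewrite sumr_const -[leLHS]mulr_natl.
case: (leqP M s) => hM; last first.
  have -> : [set S in families | #|S| == s] = finset.set0.
    apply/setP => S; rewrite !inE; apply/negP => /andP[/and3P[h _ _] /eqP e].
    by rewrite e leqNgt hM in h.
  by rewrite cards0 mul0r invr_ge0 exprn_ge0.
apply: le_trans (family_level hM); rewrite /f ler_wpM2r ?mulr_ge0 ?exprn_ge0 ?expR_ge0 //.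
by rewrite -natrX ler_nat card_family_level.
Qed.

End UnionBound.

(** * Choice of the scales *)

Local Open Scope ring_scope.

(* K is about 16 / sqrt eps, m about sqrt n, W the power of two above m, and lg
   about log n / 2; w bits make up one random word. *)
Record scale_spec (R : realType) (n : nat) (eps : R) (K m W lg w NB kap mu : nat) : Prop := ScaleSpec {
  sc_K : K = (16 * 2 ^ kap)%N;
  sc_eps : forall i, (i <= kap)%N ->
    (256%:R <= ((16 * 2 ^ i) * (16 * 2 ^ i))%N%:R * eps) = (kap <= i)%N;
  sc_m0 : (0 < m)%N;
  sc_mge : (n <= m * m)%N;
  sc_mmin : forall i, (i < m)%N -> (i * i < n)%N;
  sc_m2n : (m * m <= 2 * n)%N;
  sc_W : W = (2 ^ mu)%N;
  sc_Wge : (m <= W)%N;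
  sc_Wmin : forall i, (i < mu)%N -> (2 ^ i < m)%N;
  sc_W2 : (W <= 2 * m)%N;
  sc_lg : lg = mu.+1;
  sc_lgge : (n.+1 <= 2 ^ (2 * lg))%N;
  sc_w : (2 ^ w)%N = (K * W)%N;
  sc_wE : w = (4 + kap + mu)%N;
  sc_NB : NB = (m %/ K + 1)%N;
  sc_Klo : 256%:R <= K%:R ^+ 2 * eps;
  sc_Khi : K%:R ^+ 2 * eps <= 1024 }.

Lemma scale_exists (R : realType) (n : nat) (eps : R) : (0 < n)%N -> 0 < eps <= 1 ->
  exists K m W lg w NB kap mu, scale_spec n eps K m W lg w NB kap mu.
Proof.
move=> n0 /andP[eps0 eps1].
pose Pk i := 256%:R <= ((16 * 2 ^ i) * (16 * 2 ^ i))%N%:R * eps.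
have exk : exists i, Pk i.
  (* Any i above 1 / eps will do, since (16 * 2 ^ i) ^ 2 >= 256 * i. *)
  exists (Num.bound eps^-1); rewrite /Pk.
  have h1 : eps^-1 < (Num.bound eps^-1)%:R by apply: archi_boundP; rewrite invr_ge0 ltW.
  move: (Num.bound eps^-1) h1 => i h1.
  have h2 : (256 * i <= (16 * 2 ^ i) * (16 * 2 ^ i))%N.
    have : (i < 2 ^ i)%N by rewrite ltn_expl.
    by move: (2 ^ i)%N => z; nia.
  apply: le_trans (_ : (256 * i)%N%:R * eps <= _); last by rewrite ler_pM2r // ler_nat.
  rewrite natrM -mulrA ler_peMr // -ler_pdivrMr // mul1r ltW //.
have [kap hkap kmin] := ex_minnP exk.
have exm : exists i, (n <= i * i)%N by exists n; rewrite leq_pmulr.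
have [m hm mmin] := ex_minnP exm.
have exw : exists i, (m <= 2 ^ i)%N by exists m; rewrite ltnW // ltn_expl.
have [mu hmu wmin] := ex_minnP exw.
have mmin2 i : (i < m)%N -> (i * i < n)%N.
  by move=> hi; rewrite ltnNge; apply/negP => /mmin; rewrite leqNgt hi.
have m0 : (0 < m)%N by case: m hm {mmin hmu wmin mmin2 exw} => //; rewrite leqNgt n0.
have wmin2 i : (i < mu)%N -> (2 ^ i < m)%N.
  by move=> hi; rewrite ltnNge; apply/negP => /wmin; rewrite leqNgt hi.
have m2n : (m * m <= 2 * n)%N.
  have := mmin2 m.-1; rewrite ltn_predL m0 => /(_ isT).
  by case: m m0 {hm mmin mmin2 hmu wmin wmin2 exw} => // m _ /=; nia.
exists (16 * 2 ^ kap)%N, m, (2 ^ mu)%N, mu.+1, (4 + kap + mu)%N, (m %/ (16 * 2 ^ kap) + 1)%N, kap, mu.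
split => //.
- by move=> i hi; apply/idP/idP => [/kmin //|h]; have -> : i = kap by apply/eqP; rewrite eqn_leq hi.
- case: mu hmu wmin wmin2 => [|mu] _ _ h; first by rewrite expn0; lia.
  by have := h mu (ltnSn _); rewrite expnS; lia.
- have h1 : (m * m <= 2 ^ (2 * mu))%N by rewrite mul2n -addnn expnD leq_mul.
  have -> : (2 * mu.+1 = 2 * mu + 2)%N by lia.
  by rewrite expnD; have := expn_gt0 2 (2 * mu); lia.
- by rewrite !expnD.
- by move: hkap; rewrite /Pk natrM expr2.
(* For kap = 0, K is 16 and eps <= 1 suffices; otherwise K / 2 fails the test, so K^2 * eps < 4 *
   256. *)
- case: kap hkap kmin => [|kap] _ kmin.
    rewrite expn0 muln1 expr2 -natrM; apply: le_trans (_ : (16 * 16)%N%:R * 1 <= _).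
      by rewrite ler_wpM2l.
    by rewrite mulr1 ler_nat.
  have : ~~ Pk kap by apply/negP => /kmin; rewrite ltnn.
  rewrite /Pk -ltNge => h; rewrite expnS.
  have -> : (16 * (2 * 2 ^ kap))%N%:R ^+ 2 * eps = 4 * ((16 * 2 ^ kap * (16 * 2 ^ kap))%N%:R * eps).
    by rewrite !natrM; ring.
  by move: h; lra.
Qed.

(** From 1 - x <= exp (- x) at x = 1 / 2. *)
Lemma ln2_ge (R : realType) : 2^-1 <= ln 2 :> R.
Proof.
rewrite -ler_expR lnK ?posrE //.
have h : 2^-1 <= expR (- 2^-1) :> R by have := @expR_ge1Dx R (- 2^-1); lra.
have hp := expR_gt0 (2^-1 : R).
rewrite expRN in h.
by rewrite -[expR _]invrK -[leRHS]invrK lef_pV2 ?posrE ?invr_gt0.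
Qed.

Lemma lg_le_ln (R : realType) n (eps : R) K m W lg w NB kap mu :
  (5 <= n)%N -> scale_spec n eps K m W lg w NB kap mu -> 1 <= ln n%:R :> R /\ lg%:R <= 4 * ln n%:R :> R.
Proof.
move=> n5 [_ _ _ _ _ m2n WE _ _ W2 lgE _ _ _ _ _ _].
have npos : 0 < n%:R :> R by rewrite ltr0n; lia.
have l2 := ln2_ge R.
have h4 : ln 4 = ln 2 *+ 2 :> R by rewrite -lnXn ?ltr0n //; congr ln; rewrite -natrX.
split.
  apply: le_trans (_ : ln 4 <= _); first by rewrite h4 mulr2n; lra.
  by rewrite ler_ln ?posrE // ler_nat; lia.
(* The left side is 4 * W^2 <= 16 * m^2 <= 32 * n, and n ^ 3 >= 125. Together with ln 2 >= 1 / 2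
   this gives lg <= 4 * ln n. *)
have hn : (2 ^ (2 * lg) <= n ^ 4)%N.
  rewrite lgE mulnS expnD mul2n -addnn expnD -WE.
  have : (W * W <= 4 * (m * m))%N by nia.
  have : (125 <= n ^ 3)%N by rewrite -[125%N]/(5 ^ 3)%N leq_exp2r.
  by rewrite expnS; move: (n ^ 3)%N => z; nia.
have : ln ((2 ^ (2 * lg))%N%:R) <= ln ((n ^ 4)%N%:R) :> R.
  by rewrite ler_ln ?posrE ?ltr0n ?expn_gt0 ?ler_nat //; lia.
rewrite !natrX !lnXn ?ltr0n //; last by lia.
rewrite -(mulr_natl (ln 2)) -(mulr_natl (ln n%:R)) natrM => h.
have : 0 <= lg%:R :> R by []. nra.
Qed.

(** * The program reports the neighbourhoods of the filtered graph *)

Section Answers.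
Variables (R : realType) (n d k : nat) (phi eps : R) (G : sgraph 'I_n) (A : 'I_n -> seq 'I_n).
Variables (K m W lg w NB kap mu : nat).
Hypothesis spec : scale_spec n eps K m W lg w NB kap mu.
Hypothesis n_gt0 : (0 < n)%N.
Hypothesis d_gt0 : (0 < d)%N.
Hypothesis G_deg : (max_degree G <= d)%N.
Hypothesis A_list : adjacency_list G A.

(* When lg > n * eps, the conductance asked for is below 1 / (d * n), and
   connecting the graph is enough. *)
Definition all_links : bool := lg%:R <= n%:R * eps.
(** The value n + 1 exceeds every component, so the search is never cut short and the largest vertex
    of each component is recognized. *)
Definition big_size : nat := (if all_links then 1024 * (K * lg) else n + 1)%N.
Definition word_bound : nat :=
  (K * W + big_size + 2 * m * NB * w + K + 100 + d + k + 40 * n)%N.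

Lemma filter_answers (r : seq bool) (v : 'I_n) :
  exists2 t, answers d k phi eps filter_program A r
      (filter_graph G K m NB (seed_val w r) big_size all_links) v t
    & (t <= filter_budget n d m w NB big_size kap mu * (time_unit * bits word_bound))%N.
Proof.
case: spec => KE epsK m0 mge mmin m2n WE Wge Wmin W2 lgE lgge wE wE2 NBE Klo Khi.
set O := filter_oracles phi eps A r.
pose nb x := if insub x is Some v then [seq val y | y <- A v] else [::].
pose linked x := if insub x is Some y then link G big_size all_links y else false.
have hbits := lt_bits word_bound.
have Asize (x : 'I_n) : (size (A x) <= d)%N.
  have [hu hm] := A_list x; apply: leq_trans G_deg.
  rewrite -(card_uniqP hu) (eq_card hm); exact: leq_bigmax.
have nbE (x : 'I_n) : nb x = [seq val y | y <- A x] by rewrite /nb valK.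
have nbr_bits x i : (bits (o_nbr O x i) <= bits word_bound)%N.
  apply: bits_mono; rewrite /= ; case: insubP => [u _ _|_] //.
  case: (ltnP i (size (A u))) => hi; last by rewrite nth_default ?size_map.
  by rewrite (nth_map v) //; apply: leq_trans (ltn_ord _) _; rewrite /word_bound; lia.
have P : filter_params O (bits word_bound) n d k K m W lg w NB big_size kap mu all_links by split.
have nbrE x i : (x < n)%N -> o_nbr O x i = nth 0%N [seq y.+1 | y <- nb x] i.
  by move=> hx; rewrite /= /nb; case: insubP => [u _ _|]; [rewrite -map_comp|rewrite hx].
have nb_lt x y : y \in nb x -> (y < n)%N.
  by rewrite /nb; case: insubP => [u _ _ /mapP[z _ ->]|_] //=; rewrite ltn_ord.
have nb_size x : (x < n)%N -> (size (nb x) <= d)%N.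
  by move=> hx; rewrite /nb; case: insubP => [u _ _|_] //; rewrite size_map.
have nbG (x y : 'I_n) : (val y \in nb x) = G x y.
  rewrite nbE mem_map; last exact: val_inj.
  by have [_ ->] := A_list x; rewrite inE.
have linkedE x (l : seq nat) : (x < n)%N -> uniq l -> x \in l -> {in l, forall y, (y < n)%N} ->
  (forall S : pred nat, S x -> (forall y z, S y -> z \in nb y -> S z) -> {in l, forall y, S y}) ->
  ((size l < big_size)%N -> {in l, forall y, {subset nb y <= l}}) ->
  linked x = (size l < big_size)%N && (all_links || all (fun y => (y <= x)%N) l).
  move=> hx hu xl hl hS hcl.
  pose x' := Ordinal hx.
  have -> : linked x = link G big_size all_links x'.
    by rewrite /linked (insubT (fun i => (i < n)%N) hx).
  rewrite /link.
  (* The minimality of l places it inside the component; if the search was not cut short, closure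
     under neighbours gives the converse. *)
  have lsub y : y \in l -> exists2 y' : 'I_n, y' \in comp G x' & val y' = y.
    pose S y := [exists y' in comp G x', val y' == y].
    move=> yl; have /exists_inP[y' h /eqP <-] : S y; last by exists y'.
    apply: (hS S _ _ _ yl).
      by apply/exists_inP; exists x'; rewrite ?mem_comp.
    move=> a c /exists_inP[a' ha /eqP <-] hc.
    have cn := nb_lt _ _ hc; apply/exists_inP; exists (Ordinal cn) => //.
    by apply: comp_closed ha _; rewrite -nbG.
  have hsz : (size l <= #|comp G x'|)%N.
    rewrite cardE -(size_map val); apply: uniq_leq_size => // y /lsub[y' h <-].
    by rewrite map_f // mem_enum.
  case: (ltnP (size l) big_size) => hlt /=; last by rewrite ltnNge (leq_trans hlt hsz).
  have csub (y : 'I_n) : y \in comp G x' -> val y \in l.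
    have hsub : comp G x' \subset [set y : 'I_n | val y \in l].
      apply: comp_sub; last by rewrite inE.
      move=> a c; rewrite !inE => ha hac; apply: hcl hlt _ ha _ _.
      by rewrite nbG.
    by move=> /(fintype.subsetP hsub); rewrite inE.
  have -> : #|comp G x'| = size l.
    apply/eqP; rewrite eqn_leq hsz andbT cardE -(size_map val).
    apply: uniq_leq_size; first by rewrite map_inj_uniq ?enum_uniq //; apply: val_inj.
    by move=> y /mapP[y']; rewrite mem_enum => /csub h ->.
  rewrite hlt /=; congr (_ || _); apply/forall_inP/allP => h y.
    by move=> /lsub[y' /h hy <-].
  by move=> /csub/h.
have hbig : (100 + d + k + 40 * n < 2 ^ bits word_bound)%N.
  by apply: leq_ltn_trans hbits; rewrite /word_bound; lia.
have [t [s [hexec ht [huniq hmem]]]] :=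
  filter_program_ok (bits_gt0 _) nbr_bits n_gt0 (ltn_ord v) P hbig nbrE nb_lt nb_size linkedE.
exists t => //; exists (out s); first by exists s.
apply: uniq_perm => //; first by rewrite map_inj_uniq ?enum_uniq //; apply: val_inj.
move=> y; rewrite hmem.
case: (ltnP y n) => hy; last first.
  apply/idP/idP.
    case/andP => h _; exfalso; have : (y < n)%N; last by rewrite ltnNge hy.
    case/or4P: h => [/nb_lt //|/andP[_ /eqP ->]|/andP[_ /eqP ->]|]; rewrite ?ltn_mod //.
    by rewrite (hcandsP K NB _ m0 n_gt0 m2n) // => /orP[]/hedgeP[l [be [_ _ _ h1 h2]]];
      [rewrite h2|rewrite h1]; rewrite ltn_mod.
  by case/mapP => z _ e; move: hy; rewrite e leqNgt ltn_ord.
have -> : y = val (Ordinal hy) by []. move: (Ordinal hy) => {hy}z.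
rewrite mem_map; last exact: val_inj.
rewrite mem_enum inE /= /filter_adj /pre_adj andbC -nbG.
have hvE : linked v = link G big_size all_links v by rewrite /linked valK.
have hnext : (v.+1 %% n)%N = val (ordS v) by [].
have hprev : ((v + (n - 1)) %% n)%N = val (ord_pred v).
  by rewrite /= addnBA // subn1.
have hpE : linked ((v + (n - 1)) %% n)%N = link G big_size all_links (ord_pred v).
  by rewrite hprev /linked valK.
(* The program tests the link arriving at v from its predecessor, whereas [pre_adj] lets v be the
   successor of z. *)
have h3 : link G big_size all_links (ord_pred v) && (z == ord_pred v) =
   link G big_size all_links z && (v == ordS z).
  case: (eqVneq z (ord_pred v)) => [->|hne]; first by rewrite ord_predK eqxx.
  rewrite andbF; case: eqP => [e|]; last by rewrite andbF.
  by case/eqP: hne; rewrite e ordSK.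
rewrite hpE hvE hprev hnext !val_eqE h3 (hcandsP K NB _ m0 n_gt0 m2n) //.
by rewrite [v == z]eq_sym /line_adj -!orbA.
Qed.

End Answers.

(** * Real estimates *)

Section Estimates.
Variables (R : realType) (n d k : nat) (phi eps : R).
Variables (K m W lg w NB kap mu : nat).
Hypothesis spec : scale_spec n eps K m W lg w NB kap mu.
Hypothesis n5 : (5 <= n)%N.
Hypothesis d_gt0 : (0 < d)%N.
Hypothesis k_gt0 : (0 < k)%N.
Hypothesis phi01 : 0 < phi < 1.
Hypothesis eps_lo : phi / n%:R <= eps.
Hypothesis eps_hi : eps <= 1.

Local Notation M := (big_size n eps K lg).
Local Notation X := (k%:R * ln n%:R / (phi * eps)).
Local Notation s := (Num.sqrt (n%:R : R)).

Lemma eps_gt0 : 0 < eps.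
Proof.
case/andP: phi01 => p0 _; apply: lt_le_trans eps_lo.
by rewrite divr_gt0 // ltr0n; lia.
Qed.

(** All factors k, ln n, 1 / phi and 1 / eps of X are at least 1, so X absorbs each of them
    separately. *)
Lemma X_factors : [/\ 1 <= X, k%:R <= X, ln n%:R <= X, eps^-1 <= X & ln n%:R * eps^-1 <= X].
Proof.
have [l1 _] := lg_le_ln n5 spec.
have e0 := eps_gt0; case/andP: phi01 => p0 p1.
have k1 : 1 <= k%:R :> R by rewrite ler1n.
have hc : 1 <= phi^-1 by rewrite invf_ge1 // ltW.
have he : 1 <= eps^-1 by rewrite invf_ge1.
have -> : X = k%:R * (ln n%:R * eps^-1) * phi^-1 by field; rewrite !gt_eqF.
move: (k%:R : R) (ln n%:R : R) (eps^-1) (phi^-1) k1 l1 he hc => a b e c a1 b1 e1 c1.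
have h1 : 1 <= b * e by nra.
have h2 : b <= b * e by nra.
have h3 : e <= b * e by nra.
move: (b * e) h1 h2 h3 => f h1 h2 h3.
have h4 : f <= a * f by nra.
have h5 : a <= a * f by nra.
move: (a * f) h4 h5 => g h4 h5.
have h6 : g <= g * c by nra.
by split; lra.
Qed.

Lemma K_facts : [/\ 16 <= K%:R :> R, K%:R <= 64 * eps^-1 & K%:R * eps <= 32 * Num.sqrt eps].
Proof.
case: spec => KE _ _ _ _ _ _ _ _ _ _ _ _ _ _ Klo Khi.
have e0 := eps_gt0.
have K16 : 16 <= K%:R :> R.
  by rewrite ler_nat KE leq_pmulr // expn_gt0.
split=> //.
  rewrite -ler_pdivrMr ?invr_gt0 // invrK; nra.
have sE := sqr_sqrtr (ltW e0); have s0 := sqrtr_ge0 eps.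
have s0' : 0 < Num.sqrt eps by rewrite sqrtr_gt0.
have h : K%:R * Num.sqrt eps <= 32.
  rewrite leNgt; apply/negP => h; move: Khi; rewrite leNgt => /negP; apply.
  rewrite -[X in _ * X]sE -exprMn; nra.
by rewrite -[X in _ * X <= _]sE expr2 mulrA ler_wpM2r.
Qed.

Lemma m_facts : m%:R <= 2 * s /\ NB%:R <= 3 * s /\ 1 <= s.
Proof.
case: spec => _ _ m0 _ _ m2n _ _ _ _ _ _ _ _ NBE _ _.
have sE : s ^+ 2 = n%:R by rewrite sqr_sqrtr.
have s0 : 0 <= s := sqrtr_ge0 _.
have NBR : NB%:R = (m %/ K)%:R + 1 :> R by rewrite NBE natrD.
clear NBE m0.
have n1 : 5 <= n%:R :> R by rewrite ler_nat.
have s1 : 1 <= s by rewrite leNgt; apply/negP => h; nra.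
have m1 : (m%:R) ^+ 2 <= 2 * n%:R :> R by rewrite expr2 -!natrM ler_nat.
have hm : m%:R <= 2 * s by rewrite leNgt; apply/negP => h; nra.
split=> //; split=> //.
have : (m %/ K)%:R <= m%:R :> R by rewrite ler_nat leq_div.
lra.
Qed.

Lemma lg_facts : lg%:R <= 4 * X /\ (mu%:R <= 4 * X /\ kap%:R <= 64 * X) /\ w%:R <= 72 * X.
Proof.
have [_ l4] := lg_le_ln n5 spec.
have [X1 _ Xl Xe _] := X_factors.
have [_ hK _] := K_facts.
case: spec => KE _ _ _ _ _ _ _ _ _ lgE _ _ wE _ _ _.
have h1 : mu%:R <= lg%:R :> R by rewrite ler_nat lgE.
have h2 : kap%:R <= K%:R :> R.
  by rewrite ler_nat KE; move: (ltn_expl kap (isT : (1 < 2)%N)); clear; lia.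
split; first lra. split; first by split; lra.
rewrite wE !natrD; lra.
Qed.

(** Exploration is cheap in both regimes: with [all_links], M is O(lg / eps) because K <= 64 / eps;
    otherwise n itself is below lg / eps. *)
Lemma min_facts : (minn n M)%:R <= (512 * 512) * X ^+ 2 :> R.
Proof.
have [l1 l4] := lg_le_ln n5 spec.
have [X1 _ Xl Xe Xle] := X_factors.
have [_ hK _] := K_facts.
have e0 := eps_gt0.
have e1 : 0 < eps^-1 by rewrite invr_gt0.
have lg0 : 0 <= lg%:R :> R by [].
have XX : X <= X ^+ 2 by nra.
rewrite /big_size /all_links; case: ifPn => [_|].
  apply: le_trans (_ : (1024 * (K * lg))%N%:R <= _); first by rewrite ler_nat geq_minr.
  rewrite !natrM.
  have : K%:R * lg%:R <= (64 * eps^-1) * (4 * ln n%:R) by apply: ler_pM.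
  lra.
rewrite -ltNge => h.
apply: le_trans (_ : n%:R <= _); first by rewrite ler_nat geq_minl.
have : n%:R <= lg%:R * eps^-1 by rewrite ler_pdivlMr // ltW.
have : lg%:R * eps^-1 <= 4 * ln n%:R * eps^-1 by rewrite ler_wpM2r // ltW.
lra.
Qed.

Lemma bits_succ x : (bits x <= x.+1)%N.
Proof. by apply: bits_le => //; apply: leq_trans (ltn_expl x (isT : (1 < 2)%N)) _; rewrite leq_exp2l. Qed.

(** K, d, k and w may be bounded crudely by [bits x <= x.+1], as a polynomial in X is allowed, but
    n, m and W must enter through lg. *)
Lemma bits_word : (bits (word_bound n d k eps K m W lg w NB))%:R <= (330 + d%:R) * X.
Proof.
have [X1 Xk _ Xe _] := X_factors.
have [hlg [_ hw]] := lg_facts.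
have [_ hK _] := K_facts.
have h : (bits (word_bound n d k eps K m W lg w NB) <= 3 * K + 7 * lg + w + d + k + 36)%N.
  case: spec => KE _ m0 mge _ m2n WE Wge _ W2 lgE lgge _ _ NBE _ _.
  have bW : (bits W <= lg)%N by apply: bits_le; [rewrite lgE|rewrite WE lgE ltn_exp2l].
  have bm : (bits m <= lg)%N by apply: leq_trans bW; apply: bits_mono.
  have bNB : (bits NB <= lg + 1)%N.
    apply: leq_trans (_ : bits (m + 1) <= _)%N.
      by apply: bits_mono; rewrite NBE leq_add2r leq_div.
    by apply: leq_trans (bitsD _ _) _; rewrite leq_add // bits_le.
  have bn : (bits n <= 2 * lg)%N by apply: bits_le; [rewrite lgE mulnS|].
  have bM : (bits M <= 13 + K + 2 * lg)%N.
    rewrite /big_size; case: ifP => _.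
      apply: leq_trans (bitsM _ _) _; apply: leq_trans (leq_add (leqnn _) (bitsM _ _)) _.
      have -> : bits 1024 = 11%N by vm_compute.
      by move: (bits_succ K) (bits_succ lg); clear; lia.
    apply: leq_trans (bitsD _ _) _; have -> : bits 1 = 1%N by vm_compute.
    by move: bn; clear; lia.
  have b2 : (bits (2 * m * NB * w) <= 2 + lg + (lg + 1) + w.+1)%N.
    do 2 (apply: leq_trans (bitsM _ _) _; apply: leq_add; last by [|exact: bits_succ]).
    apply: leq_trans (bitsM _ _) _; apply: leq_add => //; vm_compute; reflexivity.
  have b3 : (bits (K * W) <= K.+1 + lg)%N.
    by apply: leq_trans (bitsM _ _) _; apply: leq_add => //; apply: bits_succ.
  have b4 : (bits (40 * n) <= 6 + 2 * lg)%N.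
    by apply: leq_trans (bitsM _ _) _; apply: leq_add => //; vm_compute.
  have b5 : bits 100 = 7%N by vm_compute.
  rewrite /word_bound.
  have e1 := bitsD (K * W) M.
  have e2 := bitsD (K * W + M) (2 * m * NB * w).
  have e3 := bitsD (K * W + M + 2 * m * NB * w) K.
  have e4 := bitsD (K * W + M + 2 * m * NB * w + K) 100.
  have e5 := bitsD (K * W + M + 2 * m * NB * w + K + 100) d.
  have e6 := bitsD (K * W + M + 2 * m * NB * w + K + 100 + d) k.
  have e7 := bitsD (K * W + M + 2 * m * NB * w + K + 100 + d + k) (40 * n).
  move: bM b2 b3 b4 b5 e1 e2 e3 e4 e5 e6 e7 (bits_succ K) (bits_succ d) (bits_succ k).
  by clear; lia.
apply: le_trans (_ : (3 * K + 7 * lg + w + d + k + 36)%N%:R <= _); first by rewrite ler_nat.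
rewrite 5!natrD 2!natrM.
have d0 : 0 <= d%:R :> R by [].
have : d%:R <= d%:R * X by rewrite ler_peMr.
lra.
Qed.

Lemma budget_bound :
  (filter_budget n d m w NB M kap mu)%:R <= (1000 * 1000) * (9 * d%:R + 5) * (s * X ^+ 2).
Proof.
have [X1 _ _ _ _] := X_factors.
have [hlg [[hmu hkap] hw]] := lg_facts.
have [hm [hNB s1]] := m_facts.
have hmin := min_facts.
rewrite /filter_budget !natrD !natrM !natrD ?natrM.
have d0 : 0 <= d%:R :> R by [].
have w0 : 0 <= w%:R :> R by [].
have NB0 : 0 <= NB%:R :> R by [].
move: (minn n M)%:R (kap%:R : R) (mu%:R : R) (w%:R : R) (NB%:R : R) (m%:R : R) (d%:R : R) s X
  hmin hkap hmu hw hNB hm s1 X1 d0 w0 NB0 => mn ka mu' w' nb m' d' S Y.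
move=> hmin hkap hmu hw hNB hm s1 X1 d0 w0 NB0.
have hnw : nb * w' <= (3 * S) * (72 * Y) by apply: ler_pM.
have Y2 : Y <= Y ^+ 2 by nra.
have SY : S * Y <= S * Y ^+ 2 by rewrite ler_wpM2l //; lra.
have S1 : S <= S * Y by nra.
have Y3 : Y ^+ 2 <= S * Y ^+ 2 by nra.
have hmd : mn * (9 * d' + 5) <= (512 * 512) * Y ^+ 2 * (9 * d' + 5) by apply: ler_wpM2r => //; lra.
have hyd : Y ^+ 2 * (9 * d' + 5) <= S * Y ^+ 2 * (9 * d' + 5) by apply: ler_wpM2r => //; lra.
have hd1 : d' <= d' * (S * Y ^+ 2) by rewrite ler_peMr //; lra.
move: (S * Y ^+ 2) SY Y3 hyd hd1 => Z SY Y3 hyd hd1.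
move: (Y ^+ 2) Y2 Y3 hmd hyd => Q Y2 Y3 hmd hyd.
lra.
Qed.

Lemma time_bound :
  (filter_budget n d m w NB M kap mu * (time_unit * bits (word_bound n d k eps K m W lg w NB)))%:R <=
  s * ((100 * (1000 * 1000)) * (9 * d%:R + 5) * (330 + d%:R) * X ^+ 3).
Proof.
have hb := budget_bound; have hw := bits_word.
have [X1 _ _ _ _] := X_factors; have [_ [_ s1]] := m_facts.
have d0 : 0 <= d%:R :> R by [].
rewrite natrM [(time_unit * _)%:R]natrM /time_unit.
apply: le_trans (_ : (1000 * 1000) * (9 * d%:R + 5) * (s * X ^+ 2) * (100 * ((330 + d%:R) * X)) <= _).
  by apply: ler_pM => //; [rewrite mulr_ge0|rewrite ler_wpM2l].
by rewrite le_eqVlt; apply/orP; left; apply/eqP; ring.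
Qed.

Definition tau : R := ((512 * 256) * d%:R)^-1 * (eps * phi / (k%:R ^+ 4 * ln n%:R)).

Lemma tau_le : tau * d%:R <= eps / 512 / 256 / ln n%:R.
Proof.
have [l1 _] := lg_le_ln n5 spec.
have e0 := eps_gt0; case/andP: phi01 => p0 p1.
have k1 : 1 <= (k%:R : R) ^+ 4 by rewrite exprn_ege1 // ler1n.
have dpos : 0 < d%:R :> R by rewrite ltr0n.
have -> : tau * d%:R = eps / 512 / 256 / ln n%:R * (phi / k%:R ^+ 4).
  have kpos : 0 < k%:R :> R by rewrite ltr0n.
  by rewrite /tau; field; rewrite !gt_eqF //; lra.
apply: ler_piMr.
  by rewrite !divr_ge0 //; lra.
rewrite ler_pdivrMr; lra.
Qed.

(** Origin of the constant 512 * 256 = 1024 * 32 * 4: M = 1024 * K * lg, K * eps <= 32 * sqrt eps <=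
    32 and lg <= 4 * ln n. *)
Lemma tau_small : all_links n eps lg -> tau * d%:R * M%:R <= 1.
Proof.
move=> hall; rewrite /big_size hall !natrM.
have [l1 l4] := lg_le_ln n5 spec.
have [K16 _ hK] := K_facts.
have e0 := eps_gt0.
have hs : Num.sqrt eps <= 1 by rewrite -sqrtr1 ler_sqrt.
apply: le_trans (_ : eps / 512 / 256 / ln n%:R * (1024 * (K%:R * lg%:R)) <= _).
  by rewrite ler_wpM2r ?tau_le // !mulr_ge0.
have -> : eps / 512 / 256 / ln n%:R * (1024 * (K%:R * lg%:R)) =
   (K%:R * eps) / 32 * ((lg%:R / 4) / ln n%:R) by field; rewrite gt_eqF //; lra.
rewrite -[leRHS]mulr1; apply: ler_pM.
- by rewrite divr_ge0 // mulr_ge0 // ltW.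
- by rewrite !divr_ge0 //; lra.
- by lra.
- by rewrite ler_pdivrMr; lra.
Qed.

(** Here n * eps < lg <= 4 * ln n, and one boundary edge already gives the required conductance to
    any set. *)
Lemma tau_tiny : ~~ all_links n eps lg -> tau * (d * n)%:R <= 1.
Proof.
rewrite /all_links -ltNge => hall.
have [l1 l4] := lg_le_ln n5 spec.
have h := tau_le; rewrite natrM mulrA.
apply: le_trans (_ : eps / 512 / 256 / ln n%:R * n%:R <= _); first by rewrite ler_wpM2r.
have -> : eps / 512 / 256 / ln n%:R * n%:R = (n%:R * eps) / 512 / 256 / ln n%:R by field; rewrite gt_eqF //; lra.
rewrite ler_pdivrMr; lra.
Qed.

Lemma tau_le1 : tau <= 1.
Proof.
have [l1 _] := lg_le_ln n5 spec.
have e0 := eps_gt0.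
have d1 : 1 <= d%:R :> R by rewrite ler1n.
have tau0 : 0 <= tau.
  case/andP: phi01 => p0 _.
  rewrite /tau mulr_ge0 ?invr_ge0 ?divr_ge0 ?mulr_ge0 ?exprn_ge0 //; lra.
have l0 : 0 < ln n%:R :> R by lra.
have h : eps / 512 / 256 / ln n%:R <= 1.
  rewrite ler_pdivrMr // mul1r.
  move: (ln n%:R : R) l1 e0 (eps_hi) => x x1 e0 e1; move: (eps) e0 e1 => e e0 e1; lra.
have := tau_le; nra.
Qed.

(** With q = sqrt (eps / phi), each contribution (minority links, k M further links, chords) is
    charged to k * q * n when k * q < 1. *)
Lemma edges_bound (a c : nat) : (a <= n)%N ->
  (a%:R <= 2 * eps / phi * n%:R + (k * if all_links n eps lg then 2 * M else 1%N)%N%:R) ->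
  (c <= a + 2 * m * NB)%N ->
  c%:R <= (100 * 700) * (Num.min 1 (k%:R * Num.sqrt (eps / phi)) * n%:R).
Proof.
move=> an ha hc.
have e0 := eps_gt0; case/andP: phi01 => p0 p1.
have [K16 _ hK] := K_facts.
have [hm [hNB s1]] := m_facts.
have sE : s ^+ 2 = n%:R by rewrite sqr_sqrtr.
set q := Num.sqrt (eps / phi).
have q0 : 0 <= q := sqrtr_ge0 _.
have qE : q ^+ 2 = eps / phi by rewrite sqr_sqrtr // divr_ge0 // ltW.
have nn : 5 <= n%:R :> R by rewrite ler_nat.
have k1 : 1 <= k%:R :> R by rewrite ler1n.
(* This is the lower bound phi / n <= eps; it makes sqrt n at most q * n below. *)
have nq : 1 <= q ^+ 2 * n%:R.
  rewrite qE mulrAC ler_pdivlMr // mul1r mulrC.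
  by move: eps_lo; rewrite ler_pdivrMr; [rewrite mulrC|lra].
have hcR : c%:R <= a%:R + 2 * m%:R * NB%:R :> R by rewrite -!natrM -natrD ler_nat.
have haR : a%:R <= n%:R :> R by rewrite ler_nat.
case: spec => _ _ _ _ _ m2n _ _ _ _ lgE _ _ _ NBE Klo _.
have m2R : m%:R * m%:R <= 2 * n%:R :> R by rewrite -!natrM ler_nat.
have hdiv : (m %/ K)%:R * K%:R <= m%:R :> R by rewrite -natrM ler_nat leq_trunc_div.
have NBR : NB%:R = (m %/ K)%:R + 1 :> R by rewrite NBE natrD.
have m0 : 0 <= m%:R :> R by [].
have g0 : 0 <= (m %/ K)%:R :> R by [].
(* If the minimum is 1, the claim is O(n): there are at most n links, and m^2 <= 2 n bounds the
   chords. *)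
case: (leP 1 (k%:R * q)) => hkq.
  rewrite mul1r; rewrite NBR in hcR.
  have : (m %/ K)%:R <= m%:R :> R by rewrite ler_nat leq_div.
  have : m%:R <= m%:R * m%:R :> R.
    by rewrite -natrM ler_nat; case: (m) => // ?; rewrite leq_pmulr.
  nra.
have q1 : q < 1 by nra.
have qn : q ^+ 2 * n%:R <= q * n%:R by rewrite ler_wpM2r // expr2; nra.
have qn1 : 1 <= q * n%:R by lra.
have kqn : q * n%:R <= k%:R * q * n%:R by rewrite ler_wpM2r // ler_peMl.
have sq1 : 1 <= q * s.
  rewrite leNgt; apply/negP => h; have : (q * s) ^+ 2 < 1 by rewrite expr_lt1 // mulr_ge0 //; lra.
  by rewrite exprMn sE; lra.
have sqn : s <= q * n%:R by rewrite (_ : q * n%:R = q * s * s) ?ler_peMl // -?mulrA -?expr2 ?sE //; lra.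
have seq : Num.sqrt eps <= q.
  by apply: ler_wsqrtr; rewrite ler_pdivlMr // ler_piMr // ltW.
have se0 := sqrtr_ge0 eps.
have seE : Num.sqrt eps ^+ 2 = eps by rewrite sqr_sqrtr // ltW.
have Kse : 16 <= K%:R * Num.sqrt eps.
  rewrite leNgt; apply/negP => h.
  have t0 : 0 <= K%:R * Num.sqrt eps by rewrite mulr_ge0.
  move: Klo; rewrite -seE -exprMn expr2 leNgt => /negP; apply.
  nra.
(* Combines m^2 <= 2 n with 1 / K <= sqrt eps / 16. The rest of [2 * m * NB] is 2 m, of order sqrt
   n, and is absorbed by [sqn]. *)
have hmg : m%:R * (m %/ K)%:R <= q * n%:R.
  have h1 : m%:R * (m %/ K)%:R * K%:R <= 2 * n%:R :> R by rewrite -mulrA; nra.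
  have h2 : m%:R * (m %/ K)%:R * 16 <= m%:R * (m %/ K)%:R * (K%:R * Num.sqrt eps).
    by rewrite ler_wpM2l // mulr_ge0.
  have h3 : m%:R * (m %/ K)%:R * (K%:R * Num.sqrt eps) <= 2 * n%:R * Num.sqrt eps.
    by rewrite mulrA ler_wpM2r.
  have h4 : n%:R * Num.sqrt eps <= n%:R * q by rewrite ler_wpM2l.
  lra.
have h1 : 2 * eps / phi * n%:R = 2 * (q ^+ 2 * n%:R) by rewrite qE; ring.
(* With [all_links], lg <= n * eps turns K * lg into K * eps * n <= 32 * sqrt eps * n. *)
have h2 : (k * if all_links n eps lg then 2 * M else 1%N)%N%:R <= (256 * 256) * (k%:R * q * n%:R).
  rewrite natrM; case: ifPn => hall; last first.
    have : k%:R <= k%:R * q * n%:R by rewrite -mulrA ler_peMr.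
    by rewrite mulr1; lra.
  rewrite /big_size hall !natrM -[k%:R * q * _]mulrA [in leRHS]mulrCA ler_wpM2l //.
  have : K%:R * lg%:R <= 32 * (q * n%:R) :> R.
    apply: le_trans (_ : K%:R * (n%:R * eps) <= _); first by rewrite ler_wpM2l.
    have : K%:R * eps * n%:R <= 32 * Num.sqrt eps * n%:R by rewrite ler_wpM2r.
    have : Num.sqrt eps * n%:R <= q * n%:R by rewrite ler_wpM2r.
    lra.
  lra.
rewrite NBR in hcR.
lra.
Qed.

End Estimates.

Lemma seed_prob_ge0 (R : realType) (L : nat) (Q : L.-tuple bool -> Prop) :
  0 <= seed_prob R Q.
Proof. by rewrite divr_ge0. Qed.

Lemma seed_prob_compl (R : realType) (L : nat) (B : {set L.-tuple bool})
    (Q : L.-tuple bool -> Prop) (delta : R) :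
  #|B|%:R / (2 ^ L)%:R <= delta -> (forall r, r \notin B -> Q r) ->
  1 - delta <= seed_prob R Q.
Proof.
move=> hB hQ; rewrite /seed_prob.
have L0 : 0 < (2 ^ L)%:R :> R by rewrite ltr0n expn_gt0.
have hc : (2 ^ L <= #|B| + #|[set r : L.-tuple bool | `[< Q r >]]|)%N.
  have -> : (2 ^ L = #|B| + #|~: B|)%N by rewrite cardsC card_tuple card_bool.
  rewrite leq_add2l subset_leq_card //; apply/fintype.subsetP => r.
  by rewrite !inE => /hQ ?; apply/asboolP.
have : (2 ^ L)%:R <= #|B|%:R + #|[set r : L.-tuple bool | `[< Q r >]]|%:R :> R.
  by rewrite -natrD ler_nat.
move: hB; rewrite ler_pdivrMr // ler_pdivlMr //; lra.
Qed.

(** * Edge count and clusterability for a fixed seed *)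

Section Guarantees.
Variables (R : realType) (n d k : nat) (phi eps : R) (G : sgraph 'I_n).
Variables (K m W lg w NB kap mu : nat).
Hypothesis spec : scale_spec n eps K m W lg w NB kap mu.
Hypothesis n5 : (5 <= n)%N.
Hypothesis d_gt0 : (0 < d)%N.
Hypothesis k_gt0 : (0 < k)%N.
Hypothesis phi01 : 0 < phi < 1.
Hypothesis eps_lo : phi / n%:R <= eps.
Hypothesis eps_hi : eps <= 1.

Local Notation M := (big_size n eps K lg).
Local Notation all := (all_links n eps lg).
Local Notation G' r := (filter_graph G K m NB (seed_val w r) M all).

Lemma filter_few_edges (phi_out : R) (r : seq bool) :
  perturbed_clusterable d G k phi phi_out eps ->
  #|edge_diff G (G' r)|%:R <=
    (100 * 700) * (Num.min 1 (k%:R * Num.sqrt (eps / phi)) * n%:R).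
Proof.
case=> G0 [P [_ [Ppart Pk Pcl] _ _ hdiff]].
have p0 : 0 < phi by case/andP: phi01.
have d0 : 0 < d%:R :> R by rewrite ltr0n.
apply: (edges_bound spec n5 d_gt0 k_gt0 phi01 eps_lo eps_hi
          (a := #|[set x | link G M all x]|)); last exact: filter_edge_diff.
  by rewrite -[X in (_ <= X)%N](card_ord n) max_card.
have := card_link G M all Ppart Pk; rewrite -(ler_nat R) natrD => h.
apply: le_trans h _; rewrite lerD2r.
have := minority_bound d_gt0 G Ppart (fun S hS => (Pcl S hS).2).
move: hdiff; rewrite card_ord natrM => h1 h2.
rewrite mulrAC ler_pdivlMr // -(ler_pM2r d0); nra.
Qed.

Lemma filter_clusterable (r : seq bool) :
  (all -> forall S : {set 'I_n}, S != set0 -> (2 * #|S| <= n)%N ->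
     (#|S| <= #|cut (G' r) S| * M)%N) ->
  clusterable d (G' r) k (tau n d k phi eps) 1.
Proof.
move=> hr; have n0 : (0 < n)%N by lia.
apply: clusterable_whole => //; first exact: (tau_le1 spec).
have t0 : 0 <= tau n d k phi eps.
  have [l1 _] := lg_le_ln n5 spec; case/andP: phi01 => p0 _.
  have := eps_gt0 n5 d_gt0 k_gt0 phi01 eps_lo eps_hi => e0.
  by rewrite /tau mulr_ge0 ?invr_ge0 ?divr_ge0 ?mulr_ge0 ?exprn_ge0 //; lra.
move=> S S0 Sn; case/orP: (orbN all) => hall.
  have hS : #|S|%:R <= #|cut (G' r) S|%:R * M%:R :> R.
    by rewrite -natrM ler_nat; apply: hr.
  have ht := tau_small spec n5 d_gt0 k_gt0 phi01 eps_lo eps_hi hall.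
  rewrite natrM mulrA; apply: le_trans (_ : tau n d k phi eps * d%:R * (#|cut (G' r) S|%:R * M%:R) <= _).
    by rewrite ler_wpM2l // mulr_ge0.
  by rewrite mulrCA ler_piMr.
have ht := tau_tiny spec n5 d_gt0 k_gt0 phi01 eps_lo eps_hi hall.
apply: le_trans (_ : tau n d k phi eps * (d * n)%:R <= _).
  by rewrite ler_wpM2l // ler_nat leq_mul2l; apply/orP; right; lia.
apply: le_trans ht _; rewrite (negbTE hall) ler1n; apply: filter_connected => //.
  by rewrite /big_size (negbTE hall) addn1.
by apply: contraTneq Sn => ->; rewrite cardsT card_ord -ltnNge; lia.
Qed.

End Guarantees.

Theorem theorem2 (R : realType) :
  exists (c0 c1 : R) (p : cmd), [/\ 0 < c0, 0 < c1 &
  forall d : nat, (10 < d)%N ->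
  exists (a b : R) (T : {poly R}), [/\ 0 < a, 0 < b &
  forall (n k : nat) (phi eps : R),
    (1 <= n)%N -> (1 <= k)%N -> 0 < phi < 1 -> c0 * (phi / n%:R) <= eps <= 1 ->
  exists L0 : nat, forall L : nat, (L0 <= L)%N ->
  forall G : sgraph 'I_n,
    perturbed_clusterable d G k phi
      (c1 * eps * phi / (k%:R ^+ 3 * ln n%:R)) eps ->
  exists G' : L.-tuple bool -> sgraph 'I_n,
  forall A : 'I_n -> seq 'I_n, adjacency_list G A ->
    (forall (r : L.-tuple bool) (v : 'I_n),
       exists t : nat, answers d k phi eps p A r (G' r) v t) /\
    1 - 4 / n%:R <= seed_prob R (fun r : L.-tuple bool =>
      [/\ clusterable d (G' r) k (a * (eps * phi / (k%:R ^+ 4 * ln n%:R))) 1,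
          (max_degree (G' r) <= d + 16)%N,
          #|edge_diff G (G' r)|%:R
            <= b * (Num.min 1 (k%:R * Num.sqrt (eps / phi)) * n%:R) &
          forall v : 'I_n, exists2 t : nat,
            answers d k phi eps p A r (G' r) v t &
            t%:R <= Num.sqrt n%:R * T.[k%:R * ln n%:R / (phi * eps)]])]].
Proof.
exists 1, 1, filter_program; split => // d d10.
have d_gt0 : (0 < d)%N by lia.
have d0 : 0 < d%:R :> R by rewrite ltr0n.
exists ((512 * 256) * d%:R)^-1, (100 * 700).
exists (((100 * (1000 * 1000)) * (9 * d%:R + 5) * (330 + d%:R)) *: 'X^3).
split=> [||n k phi eps n_gt0 k_gt0 phi01]; [by rewrite invr_gt0; lra|lra|].
rewrite mul1r => /andP[eps_lo eps_hi].
have p0 : 0 < phi by case/andP: phi01.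
have e0 : 0 < eps by apply: lt_le_trans eps_lo; rewrite divr_gt0 // ltr0n.
have [K [m [W [lg [w [NB [kap [mu spec]]]]]]]] := scale_exists n_gt0 (introT andP (conj e0 eps_hi)).
(* One word of w bits for each of the NB blocks of the 2 m lines. *)
exists (2 * m * NB * w)%N => L hL G hG.
set M := big_size n eps K lg; set all := all_links n eps lg.
exists (fun r => filter_graph G K m NB (seed_val w r) M all) => A hA.
have G_deg : (max_degree G <= d)%N by case: hG => ? [? []].
have hans := filter_answers k phi spec n_gt0 d_gt0 G_deg hA.
split=> [r v|]; first by have [t ? _] := hans r v; exists t.
(* For n <= 4 the claimed probability 1 - 4 / n is not positive; for n >= 5, ln n >= 1. *)
case: (ltnP n 5) => [n4|n5].
  apply: le_trans (seed_prob_ge0 _ _).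
  by rewrite subr_le0 ler_pdivlMr ?ltr0n // mul1r ler_nat.
(* The bad seeds. There are none without [all_links], where connectedness holds for every seed. *)
pose B := [set r : L.-tuple bool | all && [exists S : {set 'I_n},
  [&& S != set0, (2 * #|S| <= n)%N &
   (#|cut (filter_graph G K m NB (seed_val w r) M true) S| * M < #|S|)%N]]].
apply: le_trans (_ : 1 - n%:R^-1 <= _).
  by rewrite lerD2l lerN2 -[X in X <= _]mul1r ler_wpM2r ?invr_ge0 // ler1n.
have [K16 _ _] := K_facts spec n5 d_gt0 k_gt0 phi01 eps_lo eps_hi.
case: (spec) => KE _ m0 mge _ m2n _ Wge _ W2 lgE lgge wE _ NBE _ _.
apply: (seed_prob_compl (B := B)).
  case: (boolP all) => hall; last first.
    rewrite (_ : B = set0) ?cards0 ?mul0r ?invr_ge0 //.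
    by apply/setP => r; rewrite !inE (negbTE hall).
  rewrite /B hall /=.
  apply: sparse_cut_prob m2n Wge W2 wE NBE _ lgge _ hL => //.
  - by rewrite -(ler_nat R).
  - by rewrite lgE.
  - by rewrite /M /big_size -/all hall.
move=> r hr; split.
- rewrite -/(tau n d k phi eps); apply: (filter_clusterable spec) => //.
  rewrite -/all -/M => hall S S0 Sn; rewrite leqNgt; apply: contraNN hr => hS.
  by rewrite inE hall; apply/existsP; exists S; rewrite S0 Sn; move: hS; rewrite hall.
- have K0 : (0 < K)%N by rewrite -(ltr_nat R); lra.
  by apply: leq_trans (filter_max_degree G NB _ M all K0 m0 m2n) _; rewrite leq_add.
- exact: (filter_few_edges spec _ _ _ _ _ _ _ hG).
move=> v; have [t ht hle] := hans r v; exists t => //.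
rewrite hornerZ hornerXn.
apply: le_trans (time_bound spec n5 d_gt0 k_gt0 phi01 eps_lo eps_hi).
by rewrite ler_nat.
Qed.
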